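(* For every odd integer $n\ge 3$, the link $L_n$ has corner connection mosaic number $n$, that is, $m_c(L_n)=n$.
   Context: Each tile is a unit square; a connection point of a tile is an endpoint of a curve drawn on it. Corner connection tiles (11 of them): connection points are corners of the square. One tile is blank; four tiles carry one arc joining two adjacent corners; two tiles carry one diagonal; two tiles carry two disjoint arcs, each joining two adjacent corners, together using all four corners; two tiles ($T_9$, $T_{10}$) carry both diagonals, forming a crossing (two choices of over-strand). A tile in an $n\times n$ array is suitably connected if each of its connection points touches a connection point of exactly one other tile of the array. A corner connection $n$-mosaic is an $n\times n$ array of corner connection tiles in which every tile is suitably connected; it is a diagram of a knot or link. For a knot or link $K$, $m_c(K)$ is the smallest integer $n$ such that $K$ can be represented on a corner connection $n$-mosaic. Definition of $L_n$: for $n=2k+1$ odd, $L_n$ is the alternating link given by the corner connection $n$-mosaic whose crossing tiles are exactly at the positions $(i,j)$, $1\le i,j\le n$ (row $i$, column $j$), such that $i,j$ are not both even and not both odd (i.e. $i+j$ is odd), with the crossings chosen so that the diagram is alternating ($T_9$ in every odd row and $T_{10}$ in every even row). The remaining tiles are then forced by suitable connectedness: each of the four corner positions of the array carries the diagonal segment joining the two corners of that tile that lie on the array's boundary but are not the corner of the array; each other non-crossing tile on the perimeter carries the arc joining its two corners on the boundary of the array; all non-crossing tiles not on the perimeter are blank. *)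

(* Defs.v *)
From HB Require Import structures.
From Stdlib Require Export Relation_Operators.
From mathcomp Require Export all_boot all_order all_algebra.
From mathcomp Require Export boolp classical_sets reals.

Set Implicit Arguments.
Unset Strict Implicit.
Unset Printing Implicit Defensive.

Import Order.TTheory GRing.Theory Num.Theory.
Local Open Scope classical_set_scope.
Local Open Scope ring_scope.

(** * Polygonal links in R^3 *)

Section Links.
Variable R : realType.
Local Notation point := 'rV[R]_3.

Definition segment (A B : point) : set point :=
  [set p | exists t : R, 0 <= t <= 1 /\ p = (1 - t) *: A + t *: B].

Definition triangle (A B C : point) : set point :=
  [set p | exists a b c : R, [/\ [/\ 0 <= a, 0 <= b & 0 <= c], a + b + c = 1
                               & p = a *: A + b *: B + c *: C]].

Definition affinely_independent (A B C : point) : bool :=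
  row_free (col_mx (B - A) (C - A)).

(* A link is a nonempty closed polygonal 1-manifold.  The conditions on the
   list [E] of edges say that the edges meet only in common endpoints and that
   exactly two of them end at each vertex, i.e. that their union is a disjoint
   union of finitely many simple closed polygons. *)
Definition is_link (K : set point) : Prop :=
  exists E : seq (point * point),
    [/\ (0 < size E)%N /\ uniq E,
        forall e : point * point, e \in E -> e.1 != e.2,
        forall (e : point * point) (P : point), e \in E -> P \in [:: e.1; e.2] ->
          count (fun f => P \in [:: f.1; f.2]) E = 2%N,
        forall (e f : point * point) (P : point), e \in E -> f \in E -> e != f ->
          segment e.1 e.2 P -> segment f.1 f.2 P ->
          P \in [:: e.1; e.2] /\ P \in [:: f.1; f.2]
      & K = [set P | exists2 e : point * point, e \in E & segment e.1 e.2 P]].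

(* Elementary (Delta-) move.  Links are point sets, so A and B need not have
   been vertices beforehand: subdividing an edge does not change the link. *)
Definition delta_move (K K' : set point) : Prop :=
  [/\ is_link K, is_link K'
    & exists A B C : point,
        [/\ affinely_independent A B C,
            K `&` triangle A B C = segment A B
          & K' = (K `\` segment A B) `|` (segment A C `|` segment C B)]].

(* Equivalence of (unoriented) polygonal links in the sense of Reidemeister:
   finitely many elementary moves and inverses of such moves. *)
Definition link_equiv (K K' : set point) : Prop :=
  [/\ is_link K, is_link K'
    & clos_refl_sym_trans (set point) delta_move K K'].

End Links.

(** * Corner connection tiles *)

(* A corner of the unit tile: (is it at the bottom?, is it at the right?). *)
Definition corner := (bool * bool)%type.
Definition TL : corner := (false, false).
Definition TR : corner := (false, true).
Definition BL : corner := (true, false).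
Definition BR : corner := (true, true).

(* A curve drawn on a tile: its two endpoints, and whether it is the over-strand
   of a crossing. *)
Definition curve := (corner * corner * bool)%type.

Inductive tile := T0 | T1 | T2 | T3 | T4 | T5 | T6 | T7 | T8 | T9 | T10.

Definition curves (t : tile) : seq curve :=
  match t with
  | T0 => [::]
  | T1 => [:: (TL, TR, false)]
  | T2 => [:: (TR, BR, false)]
  | T3 => [:: (BL, BR, false)]
  | T4 => [:: (TL, BL, false)]
  | T5 => [:: (TL, BR, false)]
  | T6 => [:: (TR, BL, false)]
  | T7 => [:: (TL, TR, false); (BL, BR, false)]
  | T8 => [:: (TL, BL, false); (TR, BR, false)]
  | T9 => [:: (TL, BR, true); (TR, BL, false)]
  | T10 => [:: (TL, BR, false); (TR, BL, true)]
  end.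

Definition connection_corners (t : tile) : seq corner :=
  flatten [seq [:: g.1.1; g.1.2] | g <- curves t].

(** * Mosaics *)

Definition mosaic (n : nat) := 'M[tile]_n.

(* (row, column) coordinates, counted from the top left corner of the array, of
   the corner c of the tile in position (i, j); here i and j start at 0. *)
Definition lattice_corner (i j : nat) (c : corner) : nat * nat :=
  ((i + c.1)%N, (j + c.2)%N).

Definition connection_points n (M : mosaic n) (t : 'I_n * 'I_n) :
    seq (nat * nat) :=
  [seq lattice_corner t.1 t.2 c | c <- connection_corners (M t.1 t.2)].

Definition suitably_connected n (M : mosaic n) : Prop :=
  forall (t : 'I_n * 'I_n) (p : nat * nat), p \in connection_points M t ->
    #|[set u : 'I_n * 'I_n | (u != t) && (p \in connection_points M u)]%SET|
      = 1%N.

Section Realization.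
Variable R : realType.
Local Notation point := 'rV[R]_3.

Definition pt (x y z : R) : point := \row_(k < 3) [:: x; y; z]`_k.

(* The array lies in the plane z = 0, seen from z > 0, rows going downwards. *)
Definition lattice_pt (p : nat * nat) : point := pt p.2%:R (- p.1%:R) 0.

(* Each curve is drawn as a polygonal path P - W - Q between two corners of its
   tile.  For a diagonal, W is the centre of the tile, raised to height 1 for an
   over-strand; for an arc joining adjacent corners, W is halfway between the
   midpoint of that side and the centre, so that the arc runs inside the tile
   and arcs of neighbouring tiles do not overlap. *)
Definition draw_curve (i j : nat) (g : curve) : set point :=
  let P := lattice_pt (lattice_corner i j g.1.1) in
  let Q := lattice_pt (lattice_corner i j g.1.2) in
  let centre := pt (j%:R + 2^-1) (- (i%:R + 2^-1)) 0 in
  let W := 4^-1 *: (P + Q) + 2^-1 *: centre + pt 0 0 (g.2 : nat)%:R in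
  segment P W `|` segment W Q.

Definition mosaic_link n (M : mosaic n) : set point :=
  [set p | exists (i j : 'I_n) (g : curve),
             g \in curves (M i j) /\ draw_curve i j g p].

Definition representable (K : set point) (n : nat) : Prop :=
  exists M : mosaic n, suitably_connected M /\ link_equiv (mosaic_link M) K.

(* m_c(K), the least n such that K is representable on an n-mosaic.  The default
   value 0 is taken only when there is no such n, since a link is nonempty. *)
Definition corner_mosaic_number (K : set point) : nat :=
  xget 0%N [set n | representable K n /\
                    forall m, representable K m -> (n <= m)%N].

End Realization.

(** * The links L_n *)

(* Rows and columns are numbered from 1 to n here. *)
Definition L_tile (n i j : nat) : tile :=
  if odd (i + j) then (if odd i then T9 else T10)
  else if ((i, j) == (1, 1)%N) || ((i, j) == (n, n)) then T6
  else if ((i, j) == (1%N, n)) || ((i, j) == (n, 1%N)) then T5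
  else if i == 1%N then T1
  else if j == n then T2
  else if i == n then T3
  else if j == 1%N then T4
  else T0.

Definition L_mosaic (n : nat) : mosaic n :=
  \matrix_(i < n, j < n) L_tile n i.+1 j.+1.

Definition L (R : realType) (n : nat) : set 'rV[R]_3 :=
  @mosaic_link R n (L_mosaic n).
Arguments L : clear implicits.

(* Main.v *)
Require Import Defs.
From mathcomp Require Import ring lra zify.

(** The mosaic that defines L_n shows that its mosaic number is at most n.  The lower bound is a
    crossing number argument in which linking numbers suffice.

    The link L_n has (n + 1) / 2 components.  Its strands are reflected at the sides of the array, so
    that each component is a rectangle with sides parallel to the diagonals, and any two of these
    rectangles cross four times.  Going around a rectangle, one crosses another one alternately
    from left to right and from right to left; since the diagram alternates, the four crossings
    have the same sign.  With the components numbered from 0, suitably oriented, the crossings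
    between the components s and t all have the sign (-1)^(s + t).  Hence the sum over all ordered
    pairs of components, with these coefficients, of the signed numbers of their crossings is
    n^2 - 1, which is twice the number of crossings (linking_L).

    This linking sum is an invariant (link_equiv_linking), while in an arbitrary mosaic it is at most
    twice the number of crossing tiles (linking_bound).  In a suitably connected m-mosaic
    each of the (m + 1)^2 lattice points, except for the four corners of the array, which are not
    available, is shared by two tiles or by none, and a crossing tile uses four points
    (crossing_count).  So n^2 - 1 <= (m + 1)^2 - 4, and m >= n.

    For the invariance, a link is projected along (t, t^2, 1) for all sufficiently small t > 0; this is
    generic with respect to any finite set of points.  A link is described by a list of oriented edges
    with labels such that every vertex is the start of one edge and the end of one edge with the
    same label.  An elementary move on a triangle ABC replaces an edge AB by AC and CB.  The change
    of the linking sum comes from the signed crossings of the boundary of ABC with the other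
    sublinks.  A segment that does not meet the triangle, but crosses its boundary in projection,
    enters or leaves the space above or below it; its crossings therefore add up to the difference
    of the values, at its two ends, of a function that is, up to a common sign, 1 above the
    triangle, -1 below it and 0 elsewhere (triangle_sum).  Over a closed polygon these differences
    cancel (for_small_linking_triangle).  It remains to arrange that AB is an edge: elementary
    moves are defined for point sets, so the edges have to be subdivided and merged first
    (straighten). *)

Set Implicit Arguments.
Unset Strict Implicit.
Unset Printing Implicit Defensive.

Import Order.TTheory GRing.Theory Num.Theory.

(** * Properties of all small positive parameters *)

Section SmallParameters.
Local Open Scope ring_scope.
Variable R : realType.

(** The filter of right neighbourhoods of 0.  Genericity of a direction of projection always
    takes the form of finitely many properties of this kind, so they can be met at once. *)
Definition for_small (P : R -> Prop) : Prop :=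
  exists2 eps : R, 0 < eps & forall t, 0 < t < eps -> P t.

Lemma for_smallT (P : R -> Prop) : (forall t, P t) -> for_small P.
Proof. by move=> h; exists 1. Qed.

Lemma for_smallI (P Q : R -> Prop) : for_small P -> for_small Q -> for_small (fun t => P t /\ Q t).
Proof.
move=> [e he hP] [f hf hQ]; exists (Num.min e f); first by rewrite lt_min he hf.
by move=> t; rewrite lt_min => /and3P[t0 te tf]; split; [apply: hP|apply: hQ]; rewrite t0.
Qed.

Lemma for_smallW (P Q : R -> Prop) : for_small P -> (forall t, P t -> Q t) -> for_small Q.
Proof. by move=> [e he hP] h; exists e => // t ht; apply/h/hP. Qed.

Lemma for_small_lt (c : R) : 0 < c -> for_small (fun t => 0 < t < c).
Proof. by move=> hc; exists c. Qed.

Lemma for_small_all (T : eqType) (s : seq T) (P : T -> R -> Prop) :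
  (forall x, x \in s -> for_small (P x)) -> for_small (fun t => forall x, x \in s -> P x t).
Proof.
elim: s => [|a s IH] h; first exact: for_smallT.
have h1 : for_small (P a) by apply: h; rewrite mem_head.
have h2 : for_small (fun t => forall x, x \in s -> P x t).
  by apply: IH => x xs; apply: h; rewrite inE xs orbT.
apply: (for_smallW (for_smallI h1 h2)) => t [ha hs] x; rewrite inE => /orP[/eqP->//|]; exact: hs.
Qed.

Lemma for_small_ex (P : R -> Prop) : for_small P -> exists t, 0 < t /\ P t.
Proof. move=> [e he hP]; exists (e / 2); have h : 0 < e / 2 < e by lra.
by split; [lra | apply: hP]. Qed.

Lemma for_small_affine (a b : R) : 0 < a -> for_small (fun t => 0 < (1 - t) * a + t * b).
Proof.
move=> a0; have d0 : 0 < a + `|b| by rewrite ltr_pwDl.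
exists (a / (a + `|b|)) => [|t /andP[t0]]; first exact: divr_gt0.
rewrite ltr_pdivlMr // => ht; have hb : - `|b| <= b by rewrite lerNl ler_normr lexx orbT.
nra.
Qed.

(** A quadratic polynomial that is not identically zero has no root in some interval (0, e).
    This is the only source of genericity in the whole argument. *)
Lemma for_small_quad (a b c : R) :
  (a != 0) || (b != 0) || (c != 0) -> for_small (fun t => a + t * b + t ^+ 2 * c != 0).
Proof.
suff lin (u v : R) : u != 0 -> for_small (fun t => u + t * v != 0).
  move=> h; have [a0|a0] := eqVneq a 0; last first.
    have d : 0 < `|a| + `|b| + `|c| by rewrite -addrA ltr_pwDl ?addr_ge0 ?normr_gt0.
    exists (Num.min 1 (`|a| / (`|a| + `|b| + `|c|))).
      by rewrite lt_min ltr01 divr_gt0 // normr_gt0.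
    move=> t; rewrite lt_min => /and3P[t0 t1]; rewrite ltr_pdivlMr // => ht.
    apply/eqP => e; have e' : `|a| = `|t * b + t ^+ 2 * c|.
      have -> : a = - (t * b + t ^+ 2 * c) by lra.
      by rewrite normrN.
    have : `|a| <= t * `|b| + t ^+ 2 * `|c|.
      rewrite e'; apply: (le_trans (ler_normD _ _)).
      by rewrite [`|t * b|]normrM [`|t ^+ 2 * c|]normrM normrX (gtr0_norm t0).
    have hc := normr_ge0 c; have ha : 0 < `|a| by rewrite normr_gt0.
    have : t ^+ 2 * `|c| <= t * `|c| by apply: ler_wpM2r => //; nra.
    nra.
  have [b0|b0] := eqVneq b 0; last first.
    apply: (for_smallW (for_smallI (lin b c b0) (for_small_lt ltr01))) => t [hh /andP[t0 _]].
    rewrite a0 add0r (_ : _ + _ = t * (b + t * c)); last by ring.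
    by rewrite mulf_neq0 // gt_eqF.
  apply: (for_smallW (for_small_lt ltr01)) => t /andP[t0 _].
  have c0 : c != 0 by move: h; rewrite a0 b0 eqxx.
  by rewrite a0 b0 mulr0 !add0r mulf_neq0 // expf_neq0 // gt_eqF.
move=> u0; have d : 0 < `|u| + `|v| by rewrite ltr_pwDl ?normr_gt0.
exists (`|u| / (`|u| + `|v|)); first by rewrite divr_gt0 ?normr_gt0.
move=> t /andP[t0]; rewrite ltr_pdivlMr // => ht.
apply/eqP => e; have e' : `|u| = t * `|v|.
  have -> : u = - (t * v) by lra.
  by rewrite normrN normrM (gtr0_norm t0).
have : 0 < `|u| by rewrite normr_gt0.
nra.
Qed.

End SmallParameters.

(** * A segment moving across a triangle, in barycentric coordinates *)

Section SegmentTriangle.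
Local Open Scope ring_scope.
Variable R : realType.

(** The points P and Q have projections with barycentric coordinates p and q in a triangle and
    heights h and k over its plane.  The value is the signed crossing of PQ with the side opposite
    the first vertex: the sign is that of the height at the crossing, negated when PQ enters. *)
Definition bary_sign (p1 p2 p3 q1 q2 q3 h k : R) : R :=
  if (p1 * q1 < 0) && ((p2 * q1 - p1 * q2) * (p1 * q3 - p3 * q1) < 0)
  then Num.sg (p1 * k - q1 * h) else 0.

(** The potential whose increments are the sums of crossing signs: nonzero only over the interior of
    the triangle, where it tells whether the point is above or below. *)
Definition bary_in (p1 p2 p3 h : R) : R :=
  if [&& 0 < p1, 0 < p2 & 0 < p3] then Num.sg h else 0.

Let mid (s p q : R) := (1 - s) * p + s * q.

(** The segment passes from the outside to the inside through the relative interior of the side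
    opposite the first vertex; the last two terms are, up to a positive factor, the other two
    coordinates of the point where the first one vanishes. *)
Definition enters (p1 p2 p3 q1 q2 q3 : R) : bool :=
  [&& p1 < 0, 0 < q1, 0 < p2 * q1 - p1 * q2 & 0 < p3 * q1 - p1 * q3].

Let mid_neg s p q : 0 <= s <= 1 -> p < 0 -> 0 < mid s p q -> 0 < s /\ 0 < q.
Proof.
rewrite /mid => /andP[s0 s1] p0 h.
have sq : 0 < s * q by nra.
have s2 : 0 < s by rewrite lt_neqAle s0 andbT; apply/eqP => e; move: sq; rewrite -e mul0r ltxx.
by split=> //; rewrite -(pmulr_rgt0 _ s2).
Qed.

Let mid_det s p1 q1 p2 q2 : 0 <= s <= 1 -> p1 < 0 -> 0 <= p2 ->
  0 < mid s p1 q1 -> 0 < mid s p2 q2 -> 0 < p2 * q1 - p1 * q2.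
Proof.
move=> hs h1 h2 m1 m2; have [s0 _] := mid_neg hs h1 m1.
rewrite -(pmulr_rgt0 _ s0).
have -> : s * (p2 * q1 - p1 * q2) = p2 * mid s p1 q1 + - p1 * mid s p2 q2.
  by rewrite /mid; ring.
by apply: ltr_wpDl; [rewrite mulr_ge0 // ltW | rewrite mulr_gt0 // oppr_gt0].
Qed.

Let mid_tie p1 q1 p2 q2 : p1 < 0 -> p2 < 0 -> 0 < q1 ->
  (forall s, 0 <= s <= 1 -> mid s p1 q1 = 0 -> mid s p2 q2 != 0) ->
  p2 * q1 - p1 * q2 != 0.
Proof.
move=> h1 h2 h3 H; apply/eqP => e.
have d : 0 < q1 - p1 by lra.
have d' : q1 - p1 != 0 by rewrite gt_eqF.
have h : 0 <= - p1 / (q1 - p1) <= 1.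
  by apply/andP; split; [rewrite divr_ge0 //; lra | rewrite ler_pdivrMr //; lra].
suff /(H _ h)/eqP : mid (- p1 / (q1 - p1)) p1 q1 = 0; last by rewrite /mid; field.
apply; rewrite /mid.
have -> : (1 - - p1 / (q1 - p1)) * p2 + - p1 / (q1 - p1) * q2 =
  (p2 * q1 - p1 * q2) / (q1 - p1) by field.
by rewrite e mul0r.
Qed.

(** A segment that has a point strictly inside a triangle, and meets no vertex, enters exactly once,
    unless it starts inside.  With y the coordinates of the inner point, the sides that can be
    entered are those with p_i < 0, and the true entry is where p_i / y_i is smallest; a tie would
    be a passage through a vertex. *)
Lemma enters_count (p1 p2 p3 q1 q2 q3 s : R) :
  p1 + p2 + p3 = 1 ->
  0 <= s <= 1 -> 0 < mid s p1 q1 -> 0 < mid s p2 q2 -> 0 < mid s p3 q3 ->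
  (forall s, 0 <= s <= 1 -> mid s p1 q1 = 0 -> mid s p2 q2 != 0) ->
  (forall s, 0 <= s <= 1 -> mid s p2 q2 = 0 -> mid s p3 q3 != 0) ->
  (forall s, 0 <= s <= 1 -> mid s p3 q3 = 0 -> mid s p1 q1 != 0) ->
  (0 <= p1 -> 0 <= p2 -> 0 <= p3 -> [&& 0 < p1, 0 < p2 & 0 < p3]) ->
  (enters p1 p2 p3 q1 q2 q3)%:R + (enters p2 p3 p1 q2 q3 q1)%:R
   + (enters p3 p1 p2 q3 q1 q2)%:R = (~~ [&& 0 < p1, 0 < p2 & 0 < p3])%:R :> R.
Proof.
move=> sum hs m1 m2 m3 t12 t23 t31 bd.
(* two sides can be entered: the sign of the minor decides which one is *)
have two a b c qa qb qc : a < 0 -> b < 0 -> 0 <= c ->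
    0 < mid s a qa -> 0 < mid s b qb -> 0 < mid s c qc ->
    (forall s, 0 <= s <= 1 -> mid s a qa = 0 -> mid s b qb != 0) ->
    (enters a b c qa qb qc)%:R + (enters b c a qb qc qa)%:R
     + (enters c a b qc qa qb)%:R = 1 :> R.
  move=> a0 b0 c0 ma mb mc tab.
  have [_ qa0] := mid_neg hs a0 ma; have [_ qb0] := mid_neg hs b0 mb.
  have dac := mid_det hs a0 c0 ma mc; have dbc := mid_det hs b0 c0 mb mc.
  have := mid_tie a0 b0 qa0 tab.
  rewrite /enters a0 b0 qa0 qb0 dac dbc (ltNge c) c0 /= andbT.
  rewrite neq_lt => /orP[h|h].
    by rewrite (ltNge 0) ltW //= (_ : 0 < _) //=; [ring | lra].
  by rewrite h (ltNge 0) (_ : _ <= 0) /=; [ring | lra].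
have one a b c qa qb qc : a < 0 -> 0 <= b -> 0 <= c ->
    0 < mid s a qa -> 0 < mid s b qb -> 0 < mid s c qc ->
    (enters a b c qa qb qc)%:R + (enters b c a qb qc qa)%:R
     + (enters c a b qc qa qb)%:R = 1 :> R.
  move=> a0 b0 c0 ma mb mc.
  have [_ qa0] := mid_neg hs a0 ma.
  rewrite /enters a0 qa0 (ltNge c) c0 (ltNge b) b0 /=.
  by rewrite (mid_det hs a0 b0 ma mb) (mid_det hs a0 c0 ma mc) /=; ring.
have [h1|h1] := ltP p1 0; have [h2|h2] := ltP p2 0; have [h3|h3] := ltP p3 0.
- lra.
- by rewrite (lt_gtF h1) /=; apply: two.
- by rewrite (lt_gtF h1) /= -[RHS](two p3 p1 p2 q3 q1 q2) //; ring.
- by rewrite (lt_gtF h1) /=; apply: one.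
- by rewrite (lt_gtF h2) andbF /= -[RHS](two p2 p3 p1 q2 q3 q1) //; ring.
- by rewrite (lt_gtF h2) andbF /= -[RHS](one p2 p3 p1 q2 q3 q1) //; ring.
- by rewrite (lt_gtF h3) !andbF /= -[RHS](one p3 p1 p2 q3 q1 q2) //; ring.
rewrite bd //= /enters !ltNge h1 h2 h3 /=; ring.
Qed.

Let mid_convex (u s s' p q : R) : mid (mid u s s') p q = mid u (mid s p q) (mid s' p q).
Proof. rewrite /mid; ring. Qed.

Let mid_ge0 u p q : 0 <= u <= 1 -> 0 <= p -> 0 <= q -> 0 <= mid u p q.
Proof. by move=> /andP[u0 u1] hp hq; rewrite addr_ge0 // mulr_ge0 // subr_ge0. Qed.

Let mid_01 u s s' : 0 <= u <= 1 -> 0 <= s <= 1 -> 0 <= s' <= 1 -> 0 <= mid u s s' <= 1.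
Proof.
move=> hu /andP[a b] /andP[c d]; rewrite mid_ge0 //=.
have : 0 <= mid u (1 - s) (1 - s') by apply: mid_ge0 => //; lra.
rewrite /mid; lra.
Qed.

Section Segment.
Variables p1 p2 p3 q1 q2 q3 h k : R.
Let ins s := [/\ 0 <= mid s p1 q1, 0 <= mid s p2 q2 & 0 <= mid s p3 q3].
Hypothesis disj : forall s, 0 <= s <= 1 -> ins s -> mid s h k != 0.

(** The part of a segment lying over a triangle is convex, so if it avoids the plane of the triangle
    there, it stays on one side of it. *)
Lemma same_side s s' : 0 <= s <= 1 -> ins s -> 0 <= s' <= 1 -> ins s' ->
  Num.sg (mid s h k) = Num.sg (mid s' h k).
Proof.
move=> hs is1 hs' is2.
have d u : 0 <= u <= 1 -> mid u (mid s h k) (mid s' h k) != 0.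
  move=> hu; rewrite -mid_convex; apply: disj; first exact: mid_01.
  by move: is1 is2 => [? ? ?] [? ? ?]; split; rewrite mid_convex mid_ge0.
have n1 := disj hs is1; have n2 := disj hs' is2.
case: (ltgtP (mid s h k) 0) n1 => // a _; case: (ltgtP (mid s' h k) 0) n2 => // b _.
- by rewrite !ltr0_sg.
- have e0 : mid s h k - mid s' h k != 0 by rewrite lt_eqF //; lra.
  have : 0 <= mid s h k / (mid s h k - mid s' h k) <= 1.
    by apply/andP; split; [rewrite mulr_le0 ?invr_le0 //; lra | rewrite ler_ndivrMr; lra].
  by move/d/eqP; case; rewrite {1}/mid; field.
- have e0 : mid s h k - mid s' h k != 0 by rewrite gt_eqF //; lra.
  have : 0 <= mid s h k / (mid s h k - mid s' h k) <= 1.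
    by apply/andP; split; [rewrite divr_ge0 //; lra | rewrite ler_pdivrMr; lra].
  by move/d/eqP; case; rewrite {1}/mid; field.
- by rewrite !gtr0_sg.
Qed.

End Segment.

Let mid_flip s p q : mid s p q = mid (1 - s) q p.
Proof. by rewrite /mid; ring. Qed.

Lemma bary_sign_flip p1 p2 p3 q1 q2 q3 h k :
  bary_sign q1 q2 q3 p1 p2 p3 k h = - bary_sign p1 p2 p3 q1 q2 q3 h k.
Proof.
rewrite /bary_sign (mulrC q1 p1).
rewrite (_ : (q2 * p1 - q1 * p2) * (q1 * p3 - q3 * p1) =
   (p2 * q1 - p1 * q2) * (p1 * q3 - p3 * q1)); last by ring.
case: ifP => _; last by rewrite oppr0.
by rewrite -sgrN; congr Num.sg; ring.
Qed.

Lemma bary_sign0 p1 p2 p3 q1 q2 q3 h k :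
  p1 + p2 + p3 = 1 -> q1 + q2 + q3 = 1 ->
  ~~ enters p1 p2 p3 q1 q2 q3 -> ~~ enters q1 q2 q3 p1 p2 p3 ->
  bary_sign p1 p2 p3 q1 q2 q3 h k = 0.
Proof.
suff main a1 a2 a3 b1 b2 b3 : a1 + a2 + a3 = 1 -> b1 + b2 + b3 = 1 -> a1 < 0 -> 0 < b1 ->
    (a2 * b1 - a1 * b2) * (a1 * b3 - a3 * b1) < 0 -> enters a1 a2 a3 b1 b2 b3.
  move=> sp sq n1 n2; rewrite /bary_sign; case: ifP => // /andP[pq det].
  have [hp|hp|hp] := ltgtP p1 0.
  - by move: n1; rewrite main // -(nmulr_rlt0 _ hp).
  - move: n2; rewrite main //; first by rewrite -(pmulr_rlt0 _ hp).
    by rewrite (_ : _ * _ = (p2 * q1 - p1 * q2) * (p1 * q3 - p3 * q1)) //; ring.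
  - by move: pq; rewrite hp mul0r ltxx.
move=> sp sq a0 b0 d; rewrite /enters a0 b0 /=.
have e : (a2 * b1 - a1 * b2) + (a3 * b1 - a1 * b3) = b1 - a1.
  have -> : a3 = 1 - a1 - a2 by lra.
  have -> : b3 = 1 - b1 - b2 by lra.
  ring.
set x := a2 * b1 - a1 * b2 in d e *; set y := a3 * b1 - a1 * b3 in e *.
have d' : 0 < x * y by rewrite -oppr_lt0 -mulrN /y opprB.
have [x0|x0|x0] := ltgtP x 0; last by move: d'; rewrite x0 mul0r ltxx.
- by move: d'; rewrite nmulr_rgt0 // => y0; lra.
- by move: d'; rewrite pmulr_rgt0.
Qed.

Lemma enters_mid p1 p2 p3 q1 q2 q3 : enters p1 p2 p3 q1 q2 q3 ->
  let s := - p1 / (q1 - p1) in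
  [/\ 0 <= s <= 1, mid s p1 q1 = 0, 0 < mid s p2 q2 & 0 < mid s p3 q3].
Proof.
move=> /and4P[p0 q0 h2 h3] s; have d : 0 < q1 - p1 by lra.
have d' : q1 - p1 != 0 by rewrite gt_eqF.
split.
- by apply/andP; split; [rewrite divr_ge0 //; lra | rewrite ler_pdivrMr //; lra].
- by rewrite /mid /s; field.
- rewrite (_ : mid _ _ _ = (p2 * q1 - p1 * q2) / (q1 - p1)) ?divr_gt0 //.
  by rewrite /mid /s; field.
- rewrite (_ : mid _ _ _ = (p3 * q1 - p1 * q3) / (q1 - p1)) ?divr_gt0 //.
  by rewrite /mid /s; field.
Qed.

Lemma enters_inside p1 p2 p3 q1 q2 q3 : enters p1 p2 p3 q1 q2 q3 ->
  exists s, [/\ 0 <= s <= 1, 0 < mid s p1 q1, 0 < mid s p2 q2 & 0 < mid s p3 q3].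
Proof.
move=> en; have [hs m1 m2 m3] := enters_mid en; set s := - p1 / _ in hs m1 m2 m3.
have [_ q0 _ _] := and4P en.
have [e [e0 [[E2 E3] /andP[_ e1]]]] :=
  for_small_ex (for_smallI (for_smallI (for_small_affine q2 m2) (for_small_affine q3 m3)) (for_small_lt (@ltr01 R))).
have one1 : 0 <= (1 : R) <= 1 by rewrite ler01 lexx.
have at1 a b : mid 1 a b = b by rewrite /mid; ring.
exists (mid e s 1); split; rewrite ?mid_convex ?at1 //.
- by apply: mid_01 => //; rewrite !ltW.
- by rewrite m1 /mid mulr0 add0r mulr_gt0.
Qed.

Lemma bary_sign_enters p1 p2 p3 q1 q2 q3 h k s :
  (forall s, 0 <= s <= 1 ->
     [/\ 0 <= mid s p1 q1, 0 <= mid s p2 q2 & 0 <= mid s p3 q3] -> mid s h k != 0) ->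
  0 <= s <= 1 -> [/\ 0 <= mid s p1 q1, 0 <= mid s p2 q2 & 0 <= mid s p3 q3] ->
  enters p1 p2 p3 q1 q2 q3 -> bary_sign p1 p2 p3 q1 q2 q3 h k = - Num.sg (mid s h k).
Proof.
move=> disj hs is1 en; have [hs' m1 m2 m3] := enters_mid en.
rewrite -(@same_side p1 p2 p3 q1 q2 q3 h k disj _ _ hs' _ hs is1); last first.
  by rewrite m1 lexx !ltW.
have [p0 q0 h2 h3] := and4P en; have d : 0 < q1 - p1 by lra.
rewrite /bary_sign nmulr_rlt0 // q0 pmulr_rlt0 // -oppr_gt0 opprB h3 /=.
rewrite (_ : mid _ h k = (q1 * h - p1 * k) / (q1 - p1)); last first.
  by rewrite /mid; field; rewrite gt_eqF.
rewrite sgrM [Num.sg (_^-1)]gtr0_sg ?invr_gt0 // mulr1 -sgrN; congr Num.sg; ring.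
Qed.

(** Either PQ stays out of the open triangle, and nothing happens, or it has a point inside; then all
    crossings carry the sign of the height there, and one counts entries from both ends. *)
Lemma bary_sum p1 p2 p3 q1 q2 q3 h k :
  p1 + p2 + p3 = 1 -> q1 + q2 + q3 = 1 ->
  (forall s, 0 <= s <= 1 ->
     0 <= mid s p1 q1 -> 0 <= mid s p2 q2 -> 0 <= mid s p3 q3 -> mid s h k != 0) ->
  (forall s, 0 <= s <= 1 -> mid s p1 q1 = 0 -> mid s p2 q2 != 0) ->
  (forall s, 0 <= s <= 1 -> mid s p2 q2 = 0 -> mid s p3 q3 != 0) ->
  (forall s, 0 <= s <= 1 -> mid s p3 q3 = 0 -> mid s p1 q1 != 0) ->
  (0 <= p1 -> 0 <= p2 -> 0 <= p3 -> [&& 0 < p1, 0 < p2 & 0 < p3]) ->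
  (0 <= q1 -> 0 <= q2 -> 0 <= q3 -> [&& 0 < q1, 0 < q2 & 0 < q3]) ->
  bary_sign p1 p2 p3 q1 q2 q3 h k + bary_sign p2 p3 p1 q2 q3 q1 h k +
  bary_sign p3 p1 p2 q3 q1 q2 h k = bary_in p1 p2 p3 h - bary_in q1 q2 q3 k.
Proof.
move=> sp sq disj t12 t23 t31 bp bq.
have disj' s : 0 <= s <= 1 ->
    [/\ 0 <= mid s p1 q1, 0 <= mid s p2 q2 & 0 <= mid s p3 q3] -> mid s h k != 0.
  by move=> hs [? ? ?]; apply: disj.
have mid0 p q : mid 0 p q = p by rewrite /mid; ring.
have mid1 p q : mid 1 p q = q by rewrite /mid; ring.
have z01 : 0 <= (0 : R) <= 1 by rewrite lexx ler01.
have o01 : 0 <= (1 : R) <= 1 by rewrite lexx ler01.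
have [[s [hs m1 m2 m3]]|no] := pselect (exists s, [/\ 0 <= s <= 1,
   0 < mid s p1 q1, 0 < mid s p2 q2 & 0 < mid s p3 q3]); last first.
  have nopq a1 a2 a3 b1 b2 b3 : (forall s, [/\ 0 <= s <= 1, 0 < mid s a1 b1,
        0 < mid s a2 b2 & 0 < mid s a3 b3] -> exists s, [/\ 0 <= s <= 1,
        0 < mid s p1 q1, 0 < mid s p2 q2 & 0 < mid s p3 q3]) ->
      ~~ enters a1 a2 a3 b1 b2 b3.
    by move=> H; apply/negP => /enters_inside[s /H].
  have [sp' sq'] : p2 + p3 + p1 = 1 /\ q2 + q3 + q1 = 1 by split; lra.
  have [sp2 sq2] : p3 + p1 + p2 = 1 /\ q3 + q1 + q2 = 1 by split; lra.
  have fl (s : R) : 0 <= s <= 1 -> 0 <= 1 - s <= 1 by lra.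
  rewrite !bary_sign0 //; try by apply: nopq => s [hs ? ? ?];
    (by exists s) || (exists (1 - s); split; rewrite -?mid_flip //; exact: fl).
  rewrite /bary_in; case: ifP => [/and3P[? ? ?]|_].
    by case: no; exists 0; rewrite !mid0.
  case: ifP => [/and3P[? ? ?]|_]; first by case: no; exists 1; rewrite !mid1.
  ring.
set sg := Num.sg (mid s h k).
have is1 : [/\ 0 <= mid s p1 q1, 0 <= mid s p2 q2 & 0 <= mid s p3 q3] by rewrite !ltW.
have split1 a1 a2 a3 b1 b2 b3 : a1 + a2 + a3 = 1 -> b1 + b2 + b3 = 1 ->
    (forall s, [/\ 0 <= mid s a1 b1, 0 <= mid s a2 b2 & 0 <= mid s a3 b3] <->
       [/\ 0 <= mid s p1 q1, 0 <= mid s p2 q2 & 0 <= mid s p3 q3]) ->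
    bary_sign a1 a2 a3 b1 b2 b3 h k =
      sg * ((enters b1 b2 b3 a1 a2 a3)%:R - (enters a1 a2 a3 b1 b2 b3)%:R).
  move=> sa sb E.
  have [en|en] := boolP (enters a1 a2 a3 b1 b2 b3).
    have -> : enters b1 b2 b3 a1 a2 a3 = false.
      by move: en => /and4P[_ b0 _ _]; rewrite /enters ltNge ltW.
    rewrite (@bary_sign_enters a1 a2 a3 b1 b2 b3 h k s) //; last exact/E.
      rewrite /sg /=; ring.
    by move=> s' hs' /E; apply: disj'.
  have [en'|en'] := boolP (enters b1 b2 b3 a1 a2 a3).
    rewrite bary_sign_flip (@bary_sign_enters b1 b2 b3 a1 a2 a3 k h (1 - s)) //.
    - by rewrite -mid_flip /sg /=; ring.
    - move=> s' hs'; rewrite ![mid s' _ _]mid_flip => /E; apply: disj'; lra.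
    - lra.
    - by rewrite -!mid_flip; apply/E.
  by rewrite bary_sign0 //=; ring.
have rot a b c a' b' c' s' : [/\ 0 <= mid s' a a', 0 <= mid s' b b' & 0 <= mid s' c c'] <->
    [/\ 0 <= mid s' c c', 0 <= mid s' a a' & 0 <= mid s' b b'] by split=> -[].
have [sp' sq'] : p2 + p3 + p1 = 1 /\ q2 + q3 + q1 = 1 by split; lra.
have [sp2 sq2] : p3 + p1 + p2 = 1 /\ q3 + q1 + q2 = 1 by split; lra.
rewrite (split1 p1 p2 p3 q1 q2 q3 sp sq) // (split1 p2 p3 p1 q2 q3 q1 sp' sq') //.
rewrite (split1 p3 p1 p2 q3 q1 q2 sp2 sq2) //; last by move=> s'; split=> -[].
have cp := enters_count sp hs m1 m2 m3 t12 t23 t31 bp.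
have cq : (enters q1 q2 q3 p1 p2 p3)%:R + (enters q2 q3 q1 p2 p3 p1)%:R
   + (enters q3 q1 q2 p3 p1 p2)%:R = (~~ [&& 0 < q1, 0 < q2 & 0 < q3])%:R :> R.
  apply: (@enters_count _ _ _ _ _ _ (1 - s)); rewrite -?mid_flip //; first by lra.
  - by move=> s' hs'; rewrite ![mid s' _ _]mid_flip; apply: t12; lra.
  - by move=> s' hs'; rewrite ![mid s' _ _]mid_flip; apply: t23; lra.
  - by move=> s' hs'; rewrite ![mid s' _ _]mid_flip; apply: t31; lra.
have inp : bary_in p1 p2 p3 h = sg * [&& 0 < p1, 0 < p2 & 0 < p3]%:R.
  rewrite /bary_in; case: ifP => [/and3P[a b c]|_]; last by rewrite mulr0.
  rewrite mulr1 /sg -(same_side disj' z01 _ hs is1) !mid0 //.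
  by rewrite !ltW.
have inq : bary_in q1 q2 q3 k = sg * [&& 0 < q1, 0 < q2 & 0 < q3]%:R.
  rewrite /bary_in; case: ifP => [/and3P[a b c]|_]; last by rewrite mulr0.
  rewrite mulr1 /sg -(same_side disj' o01 _ hs is1) !mid1 //.
  by rewrite !ltW.
rewrite inp inq -!mulrDr -mulrBr; congr (sg * _).
move: cp cq; case: [&& 0 < p1, _ & _]; case: [&& 0 < q1, _ & _] => /=; lra.
Qed.

End SegmentTriangle.

(** * Projecting space along the direction (t, t^2, 1) *)

Section Projection.
Local Open Scope classical_set_scope.
Local Open Scope ring_scope.
Variable R : realType.
Local Notation point := 'rV[R]_3.
Implicit Types (A B C P Q X Y : point) (t s : R).

Definition cx P : R := P ord0 (@Ordinal 3 0 isT).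
Definition cy P : R := P ord0 (@Ordinal 3 1 isT).
Definition cz P : R := P ord0 (@Ordinal 3 2 isT).

Lemma point_ext P Q : cx P = cx Q -> cy P = cy Q -> cz P = cz Q -> P = Q.
Proof.
move=> hx hy hz; apply/rowP => -[[|[|[|i]]] hi] //.
- by rewrite (_ : Ordinal hi = @Ordinal 3 0 isT) //; apply/val_inj.
- by rewrite (_ : Ordinal hi = @Ordinal 3 1 isT) //; apply/val_inj.
- by rewrite (_ : Ordinal hi = @Ordinal 3 2 isT) //; apply/val_inj.
Qed.

Lemma coordE :
  (((forall P Q, cx (P + Q)%R = (cx P + cx Q)%R) *
    (forall P Q, cy (P + Q)%R = (cy P + cy Q)%R) *
    (forall P Q, cz (P + Q)%R = (cz P + cz Q)%R)) *
  ((forall a P, cx (a *: P)%R = (a * cx P)%R) *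
   (forall a P, cy (a *: P)%R = (a * cy P)%R) *
   (forall a P, cz (a *: P)%R = (a * cz P)%R)) *
  ((forall P, cx (- P)%R = (- cx P)%R) * (forall P, cy (- P)%R = (- cy P)%R) *
   (forall P, cz (- P)%R = (- cz P)%R)) *
  ((forall x y z : R, cx (pt x y z) = x) * (forall x y z : R, cy (pt x y z) = y) *
   (forall x y z : R, cz (pt x y z) = z)))%type.
Proof. by do !split; move=> *; rewrite /cx /cy /cz ?/pt mxE. Qed.

Definition point_at P Q s : point := (1 - s) *: P + s *: Q.

Lemma point_at_E P Q s : ((cx (point_at P Q s) = (1 - s) * cx P + s * cx Q)%R *
  (cy (point_at P Q s) = (1 - s) * cy P + s * cy Q)%R *
  (cz (point_at P Q s) = (1 - s) * cz P + s * cz Q)%R)%type.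
Proof. by rewrite /point_at !coordE. Qed.

Lemma segmentP P Q X : segment P Q X <-> exists2 s, 0 <= s <= 1 & X = point_at P Q s.
Proof. by split=> -[s]; [case=> h e|move=> h e]; exists s. Qed.

Lemma segment_l P Q : segment P Q P.
Proof. apply/segmentP; exists 0; first lra. by rewrite /point_at subr0 scale1r scale0r addr0. Qed.

Lemma segment_r P Q : segment P Q Q.
Proof. apply/segmentP; exists 1; first lra. by rewrite /point_at subrr scale1r scale0r add0r. Qed.

Lemma point_at_flip P Q s : point_at P Q s = point_at Q P (1 - s).
Proof. by rewrite /point_at subKr addrC. Qed.

Lemma segmentC P Q : segment P Q = segment Q P.
Proof.
apply/seteqP; split=> X /segmentP[s hs ->]; apply/segmentP; exists (1 - s);
  by rewrite -?point_at_flip //; lra.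
Qed.

(** Coordinates of the projection along (t, t^2, 1) to the plane z = 0.  This curve of directions
    tends to the vertical one and lies in no plane through the origin, so a nonzero linear form
    vanishes on none of these directions for small t. *)
Definition shear_x t P := cx P - t * cz P.
Definition shear_y t P := cy P - t ^+ 2 * cz P.

Definition orient t P Q X :=
  (shear_x t Q - shear_x t P) * (shear_y t X - shear_y t P) - (shear_y t Q - shear_y t P) * (shear_x t X - shear_x t P).

Definition det3 (a1 a2 a3 b1 b2 b3 c1 c2 c3 : R) :=
  a1 * (b2 * c3 - b3 * c2) - a2 * (b1 * c3 - b3 * c1) + a3 * (b1 * c2 - b2 * c1).

(** The sign of this determinant is the sign of the crossing of the lines PQ and XY, whatever the
    direction of projection for which they cross. *)
Definition vol P Q X Y :=
  det3 (cx Q - cx P) (cy Q - cy P) (cz Q - cz P)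
       (cx Y - cx X) (cy Y - cy X) (cz Y - cz X)
       (cx X - cx P) (cy X - cy P) (cz X - cz P).

Definition crosses t (e f : point * point) : bool :=
  (orient t e.1 e.2 f.1 * orient t e.1 e.2 f.2 < 0) &&
  (orient t f.1 f.2 e.1 * orient t f.1 f.2 e.2 < 0).

Definition csign t (e f : point * point) : R :=
  if crosses t e f then Num.sg (vol e.1 e.2 f.1 f.2) else 0.

Lemma csignC t e f : csign t e f = csign t f e.
Proof.
rewrite /csign /crosses andbC; case: ifP => // _; congr Num.sg.
by rewrite /vol /det3; ring.
Qed.

Lemma csignNl t P Q f : csign t (Q, P) f = - csign t (P, Q) f.
Proof.
rewrite /csign /crosses /=.
rewrite (_ : orient t Q P f.1 * orient t Q P f.2 = orient t P Q f.1 * orient t P Q f.2);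
  last by rewrite /orient; ring.
rewrite [orient _ _ _ Q * _]mulrC; case: ifP => _; last by rewrite oppr0.
by rewrite -sgrN; congr Num.sg; rewrite /vol /det3; ring.
Qed.

Lemma orient_at t A B P Q s :
  orient t A B (point_at P Q s) = (1 - s) * orient t A B P + s * orient t A B Q.
Proof. by rewrite /orient /shear_x /shear_y !point_at_E; ring. Qed.

Lemma orient_cycle t A B C : orient t B C A = orient t A B C.
Proof. by rewrite /orient; ring. Qed.

(** The vanishing of the three coordinates of the vector product of PQ and PX. *)
Definition collinear P Q X : Prop :=
  [/\ (cx Q - cx P) * (cy X - cy P) = (cy Q - cy P) * (cx X - cx P),
      (cy Q - cy P) * (cz X - cz P) = (cz Q - cz P) * (cy X - cy P)
    & (cz Q - cz P) * (cx X - cx P) = (cx Q - cx P) * (cz X - cz P)].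

Definition generic t P Q X : Prop := orient t P Q X = 0 -> collinear P Q X.

(** The orientation of the projected triangle is the scalar product of (t, t^2, 1) with the normal
    vector of PQX, a quadratic polynomial in t. *)
Lemma for_small_generic P Q X : for_small (fun t => generic t P Q X).
Proof.
pose a := (cx Q - cx P) * (cy X - cy P) - (cy Q - cy P) * (cx X - cx P).
pose b := (cy Q - cy P) * (cz X - cz P) - (cz Q - cz P) * (cy X - cy P).
pose c := (cz Q - cz P) * (cx X - cx P) - (cx Q - cx P) * (cz X - cz P).
have [|h] := boolP ((a != 0) || (b != 0) || (c != 0)).
  move/(for_small_quad (c := c))/for_smallW; apply => t /eqP h e; case: h; rewrite -[RHS]e.
  by rewrite /orient /shear_x /shear_y /a /b /c; ring.
apply: for_smallT => t _; move: h; rewrite !negb_or !negbK => /andP[/andP[/eqP ha /eqP hb] /eqP hc].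
by rewrite /collinear; split; apply/eqP; rewrite -subr_eq0; apply/eqP.
Qed.

Lemma collinear_line P Q X : P != Q -> collinear P Q X -> exists s, X = point_at P Q s.
Proof.
move=> ne [h1 h2 h3].
have [dx|dx] := eqVneq (cx Q - cx P) 0; last first.
  exists ((cx X - cx P) / (cx Q - cx P)); apply: point_ext; rewrite point_at_E.
  - by field.
  - apply: (mulfI dx); rewrite (_ : _ * cy X = (cx Q - cx P) * (cy X - cy P) +
      (cx Q - cx P) * cy P); last by ring.
    by rewrite h1; field.
  - apply: (mulfI dx); rewrite (_ : _ * cz X = (cx Q - cx P) * (cz X - cz P) +
      (cx Q - cx P) * cz P); last by ring.
    by rewrite -h3; field.
have [dy|dy] := eqVneq (cy Q - cy P) 0; last first.
  exists ((cy X - cy P) / (cy Q - cy P)); apply: point_ext; rewrite point_at_E.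
  - apply: (mulfI dy); rewrite (_ : _ * cx X = (cy Q - cy P) * (cx X - cx P) +
      (cy Q - cy P) * cx P); last by ring.
    by rewrite -h1; field.
  - by field.
  - apply: (mulfI dy); rewrite (_ : _ * cz X = (cy Q - cy P) * (cz X - cz P) +
      (cy Q - cy P) * cz P); last by ring.
    by rewrite h2; field.
have dz : cz Q - cz P != 0.
  apply: contraNneq ne => dz; apply/eqP/point_ext; lra.
exists ((cz X - cz P) / (cz Q - cz P)); apply: point_ext; rewrite point_at_E.
- apply: (mulfI dz); rewrite (_ : _ * cx X = (cz Q - cz P) * (cx X - cx P) +
    (cz Q - cz P) * cx P); last by ring.
  by rewrite h3; field.
- apply: (mulfI dz); rewrite (_ : _ * cy X = (cz Q - cz P) * (cy X - cy P) +
    (cz Q - cz P) * cy P); last by ring.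
  by rewrite -h2; field.
- by field.
Qed.

(** Proportional to the height of P over the plane ABC. *)
Definition tvol A B C P :=
  det3 (cx B - cx A) (cy B - cy A) (cz B - cz A)
       (cx C - cx A) (cy C - cy A) (cz C - cz A)
       (cx P - cx A) (cy P - cy A) (cz P - cz A).

Lemma tvol_cycle A B C P : tvol B C A P = tvol A B C P.
Proof. by rewrite /tvol /det3; ring. Qed.

Lemma tvol_at A B C P Q s :
  tvol A B C (point_at P Q s) = (1 - s) * tvol A B C P + s * tvol A B C Q.
Proof. by rewrite /tvol /det3 !point_at_E; ring. Qed.

(** Barycentric coordinate, belonging to the vertex A, of the projection of P. *)
Definition bary t A B C P := orient t B C P / orient t A B C.

Lemma bary_at t A B C P Q s :
  bary t A B C (point_at P Q s) = (1 - s) * bary t A B C P + s * bary t A B C Q.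
Proof. by rewrite /bary orient_at; ring. Qed.

Lemma bary_total t A B C P : orient t A B C != 0 ->
  bary t A B C P + bary t B C A P + bary t C A B P = 1.
Proof.
move=> D0; rewrite /bary (orient_cycle t B C A) !(orient_cycle t A B C) -!mulrDl.
by apply: (mulIf D0); rewrite mul1r divfK // /orient; ring.
Qed.

(** Height of P over the plane ABC, measured along the direction of projection. *)
Definition height t A B C P := tvol A B C P / orient t A B C.

(** Translation of geometric crossings into barycentric ones.  The determinants that
    involve both P and Q are, up to sign, orient t A B C times a 2x2 minor of barycentric
    coordinates and heights. *)
Lemma side_sign t A B C P Q : orient t A B C != 0 ->
  csign t (B, C) (P, Q) = - Num.sg (orient t A B C) *
    bary_sign (bary t A B C P) (bary t B C A P) (bary t C A B P)
              (bary t A B C Q) (bary t B C A Q) (bary t C A B Q)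
              (height t A B C P) (height t A B C Q).
Proof.
move=> D0; rewrite /csign /crosses /bary_sign /bary /height /=.
rewrite (orient_cycle t B C A) !(orient_cycle t A B C); set D := orient t A B C in D0 *.
have D2 : 0 < D ^+ 2 by rewrite lt_neqAle eq_sym sqrf_eq0 D0 sqr_ge0.
set p1 := orient t B C P; set p2 := orient t C A P; set p3 := orient t A B P.
set q1 := orient t B C Q; set q2 := orient t C A Q; set q3 := orient t A B Q.
pose a := p2 * q1 - p1 * q2; pose b := p1 * q3 - p3 * q1.
have hB : D * orient t P Q B = - b.
  by rewrite /D /b /p1 /q1 /p3 /q3 /orient; ring.
have hC : D * orient t P Q C = - a.
  by rewrite /D /a /p1 /q1 /p2 /q2 /orient; ring.
have -> : (p1 / D * (q1 / D) < 0) = (p1 * q1 < 0).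
  by rewrite -[LHS](pmulr_llt0 _ D2); congr (_ < _); field.
have -> : ((p2 / D * (q1 / D) - p1 / D * (q2 / D)) * (p1 / D * (q3 / D) - p3 / D * (q1 / D)) < 0) =
    (orient t P Q B * orient t P Q C < 0).
  rewrite -[RHS](pmulr_rlt0 _ D2).
  rewrite (_ : D ^+ 2 * _ = (D * orient t P Q B) * (D * orient t P Q C)); last by ring.
  rewrite hB hC -[LHS](pmulr_rlt0 _ D2) -[LHS](pmulr_rlt0 _ D2); congr (_ < _).
  have gen (d x y z w u v : R) : d != 0 -> d ^+ 2 * (d ^+ 2 * ((x / d * (y / d) - z / d * (w / d)) *
     (z / d * (u / d) - v / d * (y / d)))) = - (z * u - v * y) * - (x * y - z * w).
    by move=> d0; field.
  by rewrite gen.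
case: ifP => _; last by rewrite mulr0.
rewrite -sgrN -sgrM; congr Num.sg.
have gen (d x y z w : R) : d != 0 -> d * (- d * (x / d * (y / d) - z / d * (w / d))) = z * w - x * y.
  by move=> d0; field.
apply: (mulfI D0); rewrite gen //.
by rewrite /D /p1 /q1 /tvol /vol /det3 /orient /shear_x /shear_y; ring.
Qed.

Lemma triangle_edge A B C : segment A B `<=` triangle A B C.
Proof.
move=> X /segmentP[s hs ->]; exists (1 - s), s, 0; split; [split; lra | ring |].
by rewrite scale0r addr0.
Qed.

Lemma triangle_cycle A B C : triangle B C A = triangle A B C.
Proof.
apply/seteqP; split=> X [a [b [c [[ha hb hc] h ->]]]].
  by exists c, a, b; split=> //; [rewrite -h; ring | rewrite addrC addrA].
by exists b, c, a; split=> //; [rewrite -h; ring | rewrite -addrA addrC].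
Qed.

(** A vector with zero projection is a multiple of (t, t^2, 1), and this direction is not
    parallel to the plane ABC. *)
Lemma bary_triangle t A B C P : orient t A B C != 0 ->
  0 <= bary t A B C P -> 0 <= bary t B C A P -> 0 <= bary t C A B P ->
  height t A B C P = 0 -> triangle A B C P.
Proof.
move=> D0 h1 h2 h3 hh.
exists (bary t A B C P), (bary t B C A P), (bary t C A B P).
split=> //; first exact: bary_total.
have E : tvol A B C P = 0.
  by rewrite -[LHS](divfK D0) -/(height t A B C P) hh mul0r.
have gen (d p q r a b c : R) : d != 0 ->
    d * (p / d * a + q / d * b + r / d * c) = p * a + q * b + r * c.
  by move=> d0; field.
rewrite /bary (orient_cycle t B C A) !(orient_cycle t A B C).
apply: point_ext; rewrite !coordE; apply: (mulfI D0); rewrite gen //.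
- rewrite -[LHS]subr0 -[X in _ - X](mulr0 t) -E.
  by rewrite /tvol /det3 /orient /shear_x /shear_y; ring.
- rewrite -[LHS]subr0 -[X in _ - X](mulr0 (t ^+ 2)) -E.
  by rewrite /tvol /det3 /orient /shear_x /shear_y; ring.
- rewrite -[LHS]subr0 -E.
  by rewrite /tvol /det3 /orient /shear_x /shear_y; ring.
Qed.

Definition side t A B C P := bary_in (bary t A B C P) (bary t B C A P) (bary t C A B P)
  (height t A B C P).

Definition generic_triangle t A B C P Q : Prop :=
  [/\ orient t A B C != 0,
      [/\ generic t B C P, generic t C A P & generic t A B P],
      [/\ generic t B C Q, generic t C A Q & generic t A B Q]
    & [/\ generic t P Q A, generic t P Q B & generic t P Q C]].

Lemma bary_vertex t A B C : orient t A B C != 0 ->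
  [/\ bary t A B C A = 1, bary t A B C B = 0 & bary t A B C C = 0].
Proof.
move=> D0; rewrite /bary orient_cycle divff //; split=> //.
- by rewrite (_ : orient t B C B = 0) ?mul0r // /orient; ring.
- by rewrite (_ : orient t B C C = 0) ?mul0r // /orient; ring.
Qed.

Lemma edge_bary t A B C P : orient t A B C != 0 -> generic t B C P ->
  bary t A B C P = 0 -> 0 <= bary t B C A P -> 0 <= bary t C A B P -> segment B C P.
Proof.
move=> D0 g h0 h1 h2.
have BC : B != C.
  by apply: contraNneq D0 => ->; apply/eqP; rewrite /orient; ring.
have [|s e] := collinear_line BC (g _).
  by apply/eqP; rewrite -(mulIr_eq0 _ (mulIf (invr_neq0 D0))) -/(bary t A B C P) h0.
have [D1 D2] : orient t B C A != 0 /\ orient t C A B != 0 by rewrite (orient_cycle t B C A) !(orient_cycle t A B C).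
have [b1 b2 b3] := bary_vertex D1; have [c1 c2 c3] := bary_vertex D2.
move: h1 h2; rewrite e !bary_at b1 b2 c1 c3 !mulr0 !mulr1 addr0 add0r => h1 h2.
by apply/segmentP; exists s => //; lra.
Qed.

Lemma generic_triangle_cycle t A B C P Q :
  generic_triangle t A B C P Q -> generic_triangle t B C A P Q.
Proof. by move=> [h [? ? ?] [? ? ?] [? ? ?]]; split=> //; rewrite orient_cycle. Qed.

Section Triangle.
Variables (t : R) (A B C P Q : point).
Hypothesis gen : generic_triangle t A B C P Q.
Hypothesis PQ : P != Q.
Hypothesis disj : forall X, segment P Q X -> ~ triangle A B C X.

Lemma off_boundary X : X \in [:: P; Q] ->
  0 <= bary t A B C X -> 0 <= bary t B C A X -> 0 <= bary t C A B X ->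
  [&& 0 < bary t A B C X, 0 < bary t B C A X & 0 < bary t C A B X].
Proof.
move=> hX h1 h2 h3; have [D0 gP gQ _] := gen.
have nX : ~ triangle A B C X.
  move: hX; rewrite !inE => /orP[] /eqP->; apply: disj; [exact: segment_l|exact: segment_r].
have [g1 g2 g3] : [/\ generic t B C X, generic t C A X & generic t A B X].
  by move: hX; rewrite !inE => /orP[] /eqP->.
have [D1 D2] : orient t B C A != 0 /\ orient t C A B != 0 by rewrite (orient_cycle t B C A) !(orient_cycle t A B C).
rewrite !lt_neqAle h1 h2 h3 !andbT; apply/and3P; split; apply/eqP => /esym e; apply: nX.
- by rewrite -triangle_cycle; apply: triangle_edge; apply: (edge_bary D0 g1 e).
- by rewrite -2!triangle_cycle; apply: triangle_edge; apply: (edge_bary D1 g2 e).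
- by apply: triangle_edge; apply: (edge_bary D2 g3 e).
Qed.

(** If the projection of PQ met that of C, then C, being collinear with P and Q in space, would
    lie on PQ itself. *)
Lemma off_vertex s : 0 <= s <= 1 ->
  (1 - s) * bary t A B C P + s * bary t A B C Q = 0 ->
  (1 - s) * bary t B C A P + s * bary t B C A Q != 0.
Proof.
move=> hs; rewrite -!bary_at => h1; apply/eqP => h2.
have [D0 gP gQ [_ _ gC]] := gen.
have [D1 D2] : orient t B C A != 0 /\ orient t C A B != 0 by rewrite (orient_cycle t B C A) !(orient_cycle t A B C).
have sumP := bary_total P D0.
(* C is the point of PQ with parameter s', and its projection the one with parameter s *)
have [|s' e] := collinear_line PQ (gC _).
  have : orient t A B C * orient t P Q C = 0; last first.
    by move/eqP; rewrite mulf_eq0 (negPf D0) => /eqP.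
  have E1 : orient t B C (point_at P Q s) = 0.
    by rewrite -[LHS](divfK D0) -/(bary _ _ _ _ _) h1 mul0r.
  have E2 : orient t C A (point_at P Q s) = 0.
    by rewrite -[LHS](divfK D1) -/(bary _ _ _ _ _) h2 mul0r.
  rewrite !orient_at in E1 E2.
  have -> : orient t A B C * orient t P Q C =
     - (orient t C A P * orient t B C Q - orient t B C P * orient t C A Q).
    by rewrite /orient; ring.
  move: E1 E2; set p1 := orient t B C P; set q1 := orient t B C Q.
  set p2 := orient t C A P; set q2 := orient t C A Q => E1 E2.
  have [s0|s0] := eqVneq s 0.
    by move: E1 E2; rewrite s0 subr0 !mul1r !mul0r !addr0 => -> ->; ring.
  apply: (mulfI s0); rewrite mulr0.
  have -> : s * - (p2 * q1 - p1 * q2) =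
    p1 * ((1 - s) * p2 + s * q2) - p2 * ((1 - s) * p1 + s * q1) by ring.
  by rewrite E1 E2; ring.
have [b1 b2 b3] := bary_vertex D0; have [c1 c2 c3] := bary_vertex D1.
have m1 : bary t A B C (point_at P Q s') = 0 by rewrite -e.
have m2 : bary t B C A (point_at P Q s') = 0 by rewrite -e.
have [es|ns] := eqVneq s s'.
  apply: (disj (X := C)); first by rewrite e -es; apply/segmentP; exists s.
  by rewrite -triangle_cycle; apply: triangle_edge; apply: segment_r.
have d : s - s' != 0 by rewrite subr_eq0.
rewrite !bary_at in h1 h2 m1 m2.
have z (p q : R) : (1 - s) * p + s * q = 0 -> (1 - s') * p + s' * q = 0 -> p = 0.
  move=> e1 e2; apply: (mulfI d); rewrite mulr0.
  have -> : (s - s') * p = s * ((1 - s') * p + s' * q) - s' * ((1 - s) * p + s * q) by ring.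
  by rewrite e1 e2; ring.
have p1 := z _ _ h1 m1; have p2 := z _ _ h2 m2.
have := off_boundary (mem_head P [:: Q]); rewrite p1 p2 lexx ltxx => H.
by suff /(H isT isT) : 0 <= bary t C A B P by []; move: sumP; rewrite p1 p2; lra.
Qed.

End Triangle.

(** The reason for the invariance of linking numbers: the signed crossings of a segment with the
    boundary of a triangle that it does not meet add up to the difference of a function of the end
    points of the segment.  Summed over the edges of a closed polygon, they cancel. *)
Lemma triangle_sum t A B C P Q : generic_triangle t A B C P Q -> P != Q ->
  (forall X, segment P Q X -> ~ triangle A B C X) ->
  csign t (A, B) (P, Q) + csign t (B, C) (P, Q) + csign t (C, A) (P, Q) =
  Num.sg (orient t A B C) * (side t A B C Q - side t A B C P).
Proof.
move=> gen PQ disj.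
have gen1 := generic_triangle_cycle gen; have gen2 := generic_triangle_cycle gen1.
have disj1 X : segment P Q X -> ~ triangle B C A X by rewrite triangle_cycle; exact: disj.
have disj2 X : segment P Q X -> ~ triangle C A B X by rewrite triangle_cycle; exact: disj1.
have [D0 _ _ _] := gen; have [D1 _ _ _] := gen1; have [D2 _ _ _] := gen2.
rewrite (side_sign _ _ D0) (side_sign _ _ D1) (side_sign _ _ D2).
rewrite (_ : height t B C A P = height t A B C P); last first.
  by rewrite /height tvol_cycle orient_cycle.
rewrite (_ : height t B C A Q = height t A B C Q); last first.
  by rewrite /height tvol_cycle orient_cycle.
rewrite (_ : height t C A B P = height t A B C P); last first.
  by rewrite /height (tvol_cycle B C A) (tvol_cycle A B C) (orient_cycle t B C A) (orient_cycle t A B C).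
rewrite (_ : height t C A B Q = height t A B C Q); last first.
  by rewrite /height (tvol_cycle B C A) (tvol_cycle A B C) (orient_cycle t B C A) (orient_cycle t A B C).
rewrite (orient_cycle t B C A) !(orient_cycle t A B C).
rewrite [_ + - _ * bary_sign (bary t A B C P) _ _ _ _ _ _ _]addrC addrAC -!mulrDr.
rewrite (bary_sum (bary_total P D0) (bary_total Q D0)).
- by rewrite /side; ring.
- move=> s hs; rewrite -!bary_at => h1 h2 h3; apply/eqP => h0.
  apply: (disj (point_at P Q s)); first by apply/segmentP; exists s.
  apply: (bary_triangle D0 h1 h2 h3).
  by rewrite -h0 /height tvol_at; ring.
- exact: off_vertex gen PQ disj.
- exact: off_vertex gen1 PQ disj1.
- exact: off_vertex gen2 PQ disj2.
- by apply: (off_boundary gen disj); rewrite !inE eqxx.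
- by apply: (off_boundary gen disj); rewrite !inE eqxx orbT.
Qed.

Lemma cross_split (a b s v : R) : 0 < s < 1 -> (1 - s) * a + s * b != 0 ->
  (if a * b < 0 then v else 0) = (if a * ((1 - s) * a + s * b) < 0 then v else 0)
   + (if ((1 - s) * a + s * b) * b < 0 then v else 0).
Proof.
move=> /andP[s0 s1]; set x := _ + _ => x0.
have [a0|a0|a0] := ltgtP a 0; have [b0|b0|b0] := ltgtP b 0.
- have h : x < 0 by rewrite /x; nra.
  by rewrite !(nmulr_rlt0 _ a0) (nmulr_rlt0 _ h) (lt_gtF b0) (lt_gtF h) addr0.
- rewrite !(nmulr_rlt0 _ a0) (pmulr_llt0 _ b0) b0.
  by move: x0; rewrite neq_lt => /orP[h|h]; rewrite h (lt_gtF h) ?addr0 ?add0r.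
- have h : x < 0 by rewrite /x b0; nra.
  by rewrite b0 !mulr0 ltxx (nmulr_rlt0 _ a0) (lt_gtF h) addr0.
- rewrite !(pmulr_rlt0 _ a0) (nmulr_llt0 _ b0) b0.
  by move: x0; rewrite neq_lt => /orP[h|h]; rewrite h (lt_gtF h) ?addr0 ?add0r.
- have h : 0 < x by rewrite /x; nra.
  by rewrite !(pmulr_rlt0 _ a0) (pmulr_rlt0 _ h) (lt_gtF b0) (lt_gtF h) addr0.
- have h : 0 < x by rewrite /x b0; nra.
  by rewrite b0 !mulr0 ltxx (pmulr_rlt0 _ a0) (lt_gtF h) addr0.
- have h : x < 0 by rewrite /x a0; nra.
  by rewrite a0 !mul0r ltxx add0r (nmulr_rlt0 _ h) (lt_gtF b0).
- have h : 0 < x by rewrite /x a0; nra.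
  by rewrite a0 !mul0r ltxx add0r (pmulr_rlt0 _ h) (lt_gtF b0).
- by move: x0; rewrite /x a0 b0 !mulr0 addr0 eqxx.
Qed.

(** The degenerate triangle P, X, Q.  Genericity is needed in the case where X would project to
    the line of the other edge. *)
Lemma csign_split t P Q A B s : 0 < s < 1 -> A != B -> generic t A B (point_at P Q s) ->
  (forall X, segment P Q X -> ~ segment A B X) ->
  csign t (P, Q) (A, B) = csign t (P, point_at P Q s) (A, B) + csign t (point_at P Q s, Q) (A, B).
Proof.
move=> /andP[s0 s1] AB g disj; set X := point_at P Q s; have s1' : 0 < 1 - s by lra.
have oPX Y : orient t P X Y = s * orient t P Q Y.
  by rewrite /X /orient /shear_x /shear_y !point_at_E; ring.
have oXQ Y : orient t X Q Y = (1 - s) * orient t P Q Y.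
  by rewrite /X /orient /shear_x /shear_y !point_at_E; ring.
have vPX : vol P X A B = s * vol P Q A B by rewrite /X /vol /det3 !point_at_E; ring.
have vXQ : vol X Q A B = (1 - s) * vol P Q A B by rewrite /X /vol /det3 !point_at_E; ring.
rewrite /csign /crosses /= !oPX !oXQ vPX vXQ !sgrM (gtr0_sg s0) (gtr0_sg s1') !mul1r.
rewrite (mulrACA s _ s) (mulrACA (1 - s) _ (1 - s)).
rewrite (pmulr_rlt0 _ (mulr_gt0 s0 s0)) (pmulr_rlt0 _ (mulr_gt0 s1' s1')).
have [oAB|] := ltP; last by rewrite /= addr0.
have x0 : orient t A B X != 0.
  apply/eqP => x0; have [r e] := collinear_line AB (g x0).
  have : orient t P Q X = 0 by rewrite /X /orient /shear_x /shear_y !point_at_E; ring.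
  rewrite /X e orient_at => hr.
  have hX : segment P Q X by apply/segmentP; exists s => //; lra.
  apply: (disj X hX); rewrite /X e; apply/segmentP; exists r => //.
  move: oAB hr; set a := orient t P Q A; set b := orient t P Q B => oAB hr.
  have ha : (1 - r) * a ^+ 2 + r * (a * b) = 0 by rewrite -[RHS](mulr0 a) -hr; ring.
  have hb : (1 - r) * (a * b) + r * b ^+ 2 = 0 by rewrite -[RHS](mulr0 b) -hr; ring.
  have a2 := sqr_ge0 a; have b2 := sqr_ge0 b.
  apply/andP; split; rewrite leNgt; apply/negP => hr'.
    have h1 : 0 < r * (a * b) by rewrite nmulr_rgt0.
    have h2 : 0 <= (1 - r) * a ^+ 2 by rewrite mulr_ge0 //; lra.
    lra.
  have h1 : 0 < (1 - r) * (a * b) by rewrite nmulr_lgt0 //; lra.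
  have h2 : 0 <= r * b ^+ 2 by rewrite mulr_ge0 //; lra.
  lra.
rewrite /= (_ : orient t A B X = (1 - s) * orient t A B P + s * orient t A B Q) ?orient_at //.
rewrite /X orient_at in x0; apply: cross_split => //; lra.
Qed.

End Projection.

(** * Labelled oriented polygonal links and their linking sum *)

Section OrientedLinks.
Local Open Scope classical_set_scope.
Local Open Scope ring_scope.
Variable R : realType.
Local Notation point := 'rV[R]_3.
Local Notation ledge := (nat * (point * point))%type.
Implicit Types (A B C P Q X Y : point) (t s : R) (a b c : ledge) (D E : seq ledge).
Implicit Types (K : set point) (i : nat).

Definition seg a : set point := segment a.2.1 a.2.2.
Definition ends a : seq point := [:: a.2.1; a.2.2].

(** Each vertex is the start of one edge and the end of one edge with the same label.  So D is an
    orientation of the link K together with a partition of K into sublinks, given by the labels;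
    the sublinks need not be connected. *)
Definition oriented_link D K : Prop :=
  [/\ uniq [seq a.2.1 | a <- D],
      perm_eq [seq (a.1, a.2.1) | a <- D] [seq (a.1, a.2.2) | a <- D],
      forall a, a \in D -> a.2.1 != a.2.2,
      forall a b X, a \in D -> b \in D -> a != b -> seg a X -> seg b X -> X \in ends a
    & K = [set X | exists2 a, a \in D & seg a X]].

(** The sign (-1)^(i + j) is the sign of all crossings between the components i and j of the link
    L_n, so that its crossings all count with the same sign. *)
Definition weight t a b : R :=
  if a.1 == b.1 then 0 else (-1) ^+ (a.1 + b.1) * csign t a.2 b.2.

(** For generic t, the sum over all unordered pairs of distinct labels i and j of (-1)^(i + j) times
    four times the linking number of the sublinks i and j. *)
Definition linking t D : R := \sum_(a <- D) \sum_(b <- D) weight t a b.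

Lemma weightC t a b : weight t a b = weight t b a.
Proof. by rewrite /weight eq_sym addnC csignC. Qed.

Lemma linking_perm t D E : perm_eq D E -> linking t D = linking t E.
Proof.
move=> h; rewrite /linking (perm_big _ h) /=; apply: eq_bigr => a _; exact: perm_big.
Qed.

Lemma oriented_link_perm D E K : perm_eq D E -> oriented_link D K -> oriented_link E K.
Proof.
move=> h [v1 v2 v3 v4 v5]; have m a : (a \in E) = (a \in D) by rewrite (perm_mem h).
split.
- by rewrite -(perm_uniq (perm_map _ h)).
- by rewrite -(permPl (perm_map _ h)) -(permPr (perm_map _ h)).
- by move=> a; rewrite m; exact: v3.
- by move=> a b X; rewrite !m; exact: v4.
by rewrite v5; apply/seteqP; split=> X [a]; rewrite ?m => ha hX; exists a; rewrite ?m.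
Qed.

Lemma linking_cons t a D :
  linking t (a :: D) = linking t D + 2 * \sum_(b <- D) weight t a b.
Proof.
rewrite /linking big_cons big_cons {1}/weight eqxx add0r.
under [X in _ + X]eq_bigr => b _ do rewrite big_cons weightC.
by rewrite big_split /=; ring.
Qed.

(** Only the crossings of the changed edge matter, and not those among edges with its label. *)
Lemma linking_replace t i P Q X D :
  \sum_(b <- D) weight t (i, (P, Q)) b =
    \sum_(b <- D) weight t (i, (P, X)) b + \sum_(b <- D) weight t (i, (X, Q)) b ->
  linking t ((i, (P, Q)) :: D) = linking t [:: (i, (P, X)), (i, (X, Q)) & D].
Proof.
by move=> h; rewrite !linking_cons h big_cons {4}/weight eqxx; ring.
Qed.

Lemma map_uniq_inj (T1 T2 : eqType) (f : T1 -> T2) (s : seq T1) :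
  uniq (map f s) -> {in s &, injective f}.
Proof.
elim: s => //= x s IH /andP[hx hs] y z; rewrite !inE => /predU1P[->|hy] /predU1P[->|hz] // e.
- by move: hx; rewrite e map_f.
- by move: hx; rewrite -e map_f.
- exact: IH.
Qed.

Section Facts.
Variables (D : seq ledge) (K : set point).
Hypothesis ol : oriented_link D K.

Lemma start_inj : {in D &, injective (fun a => a.2.1)}.
Proof. by case: ol => v1 _ _ _ _; apply: map_uniq_inj. Qed.

Lemma end_uniq : uniq [seq a.2.2 | a <- D].
Proof.
case: ol => v1 v2 _ _ _; rewrite -(perm_uniq (s1 := [seq a.2.1 | a <- D])) //.
by have := perm_map snd v2; rewrite -!map_comp.
Qed.

Lemma end_inj : {in D &, injective (fun a => a.2.2)}.
Proof. exact: map_uniq_inj end_uniq. Qed.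

Lemma next_edge a : a \in D -> exists b, [/\ b \in D, b.1 = a.1 & b.2.1 = a.2.2].
Proof.
case: ol => _ v2 _ _ _ ha.
have : (a.1, a.2.2) \in [seq (a.1, a.2.1) | a <- D].
  by rewrite (perm_mem v2); apply: (map_f (fun a => (a.1, a.2.2))).
by move=> /mapP[b hb [-> ->]]; exists b.
Qed.

Lemma prev_edge a : a \in D -> exists b, [/\ b \in D, b.1 = a.1 & b.2.2 = a.2.1].
Proof.
case: ol => _ v2 _ _ _ ha.
have : (a.1, a.2.1) \in [seq (a.1, a.2.2) | a <- D].
  by rewrite -(perm_mem v2); apply: (map_f (fun a => (a.1, a.2.1))).
by move=> /mapP[b hb [-> ->]]; exists b.
Qed.

Lemma out_edge a X : a \in D -> X \in ends a ->
  exists b, [/\ b \in D, b.1 = a.1 & b.2.1 = X].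
Proof.
move=> ha; rewrite !inE => /orP[]/eqP->; last exact: next_edge.
by exists a.
Qed.

(** Distinct labels thus belong to disjoint sublinks. *)
Lemma same_label a b X : a \in D -> b \in D -> X \in ends a -> X \in ends b -> a.1 = b.1.
Proof.
move=> ha hb /(out_edge ha)[a' [ha' <- ea]] /(out_edge hb)[b' [hb' <- eb]].
by rewrite (start_inj ha' hb') // eb.
Qed.

Lemma seg_meet a b X : a \in D -> b \in D -> a != b -> seg a X -> seg b X ->
  X \in ends a /\ X \in ends b.
Proof.
case: ol => _ _ _ v4 _ ha hb ab sa sb.
by split; [apply: v4 sa sb|apply: v4 sb sa; rewrite 1?eq_sym].
Qed.

Lemma seg_disjoint a b X : a \in D -> b \in D -> a.1 != b.1 -> seg a X -> ~ seg b X.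
Proof.
move=> ha hb ab sa sb.
have ne : a != b by apply: contraNneq ab => ->.
have [ea eb] := seg_meet ha hb ne sa sb.
by move: ab; rewrite (same_label ha hb ea eb) eqxx.
Qed.

Lemma seg_sub a : a \in D -> seg a `<=` K.
Proof. by case: ol => _ _ _ _ -> ha X hX; exists a. Qed.

(** Among three edges with a common vertex two start there, or two end there. *)
Lemma three_edges a b c X : a \in D -> b \in D -> c \in D ->
  X \in ends a -> X \in ends b -> X \in ends c -> [|| a == b, b == c | a == c].
Proof.
move=> ha hb hc; rewrite !inE.
move=> /orP[]/eqP-> /orP[]/eqP e /orP[]/eqP e'; apply/or3P;
  try (by constructor 1; apply/eqP; (exact: start_inj || exact: end_inj));
  try (by constructor 3; apply/eqP; (exact: start_inj || exact: end_inj));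
  by constructor 2; apply/eqP; (apply: start_inj; rewrite // -e //) || (apply: end_inj; rewrite // -e //).
Qed.

End Facts.

(** Reversing the orientation of a whole link does not change crossing signs. *)
Definition flip a : ledge := (a.1, (a.2.2, a.2.1)).

Lemma flipK : involutive flip. Proof. by case=> i [P Q]. Qed.

Lemma weight_flip t a b : weight t (flip a) (flip b) = weight t a b.
Proof.
case: a b => i [P Q] [j [A B]]; rewrite /weight /flip /=; case: ifP => // _.
by rewrite csignNl csignC csignNl opprK csignC.
Qed.

Lemma linking_flip t D : linking t (map flip D) = linking t D.
Proof.
rewrite /linking big_map; apply: eq_bigr => a _; rewrite big_map.
by apply: eq_bigr => b _; exact: weight_flip.
Qed.

Lemma oriented_link_flip D K : oriented_link D K -> oriented_link (map flip D) K.
Proof.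
move=> ol; have [v1 v2 v3 v4 v5] := ol.
have m a : (a \in map flip D) = (flip a \in D).
  by rewrite -[in LHS](flipK a) mem_map //; exact: (can_inj flipK).
have sf a : seg (flip a) = seg a by rewrite /seg segmentC.
split.
- by rewrite -map_comp; exact: end_uniq ol.
- by rewrite -!map_comp perm_sym.
- by move=> a; rewrite m => /v3; rewrite eq_sym.
- move=> a b X; rewrite !m => ha hb ab sa sb.
  have := v4 _ _ X ha hb; rewrite !sf (inj_eq (can_inj flipK)) => /(_ ab sa sb).
  by rewrite !inE orbC.
rewrite v5; apply/seteqP; split=> X [a]; rewrite ?m => ha hX; exists (flip a);
  by rewrite ?m ?flipK ?sf.
Qed.

Lemma for_small_linking_split i P Q D K s : oriented_link ((i, (P, Q)) :: D) K -> 0 < s < 1 ->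
  for_small (fun t => linking t ((i, (P, Q)) :: D) =
    linking t [:: (i, (P, point_at P Q s)), (i, (point_at P Q s, Q)) & D]).
Proof.
move=> ol hs.
have : for_small (fun t => forall b, b \in D -> generic t b.2.1 b.2.2 (point_at P Q s)).
  by apply: for_small_all => b _; apply: for_small_generic.
move/for_smallW; apply => t h; apply: linking_replace; rewrite -big_split /=.
apply: eq_big_seq => b hb; rewrite /weight; case: ifP => [|/negbT ib]; first by rewrite addr0.
have hb' : b \in (i, (P, Q)) :: D by rewrite inE hb orbT.
rewrite -mulrDr; congr (_ * _); case: b ib hb hb' => j [A B] /= ib hb hb'.
apply: csign_split => //.
- by case: ol => _ _ v3 _ _; apply: (v3 _ hb').
- exact: (h _ hb).
- by move=> Y; apply: (seg_disjoint ol (mem_head _ _) hb').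
Qed.

Lemma for_small_generic_triangle A B C P Q : ~ collinear A B C ->
  for_small (fun t => generic_triangle t A B C P Q).
Proof.
move=> nc.
apply: (for_smallW (for_smallI (for_small_generic A B C) (for_smallI (for_smallI (for_small_generic B C P) (for_smallI (for_small_generic C A P)
  (for_small_generic A B P))) (for_smallI (for_smallI (for_small_generic B C Q) (for_smallI (for_small_generic C A Q)
  (for_small_generic A B Q))) (for_smallI (for_small_generic P Q A) (for_smallI (for_small_generic P Q B) (for_small_generic P Q C))))))).
move=> t [h [[? [? ?]] [[? [? ?]] [? [? ?]]]]]; split=> //.
by apply/eqP => /h.
Qed.

(** Replacing AB by ACB changes the linking sum by the crossings of the boundary of ABC with the other
    sublinks.  By triangle_sum these form a telescoping sum over each sublink: the potential depends
    on vertex and label only, and these are equidistributed among starts and ends. *)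
Lemma for_small_linking_triangle i A B C D K : oriented_link ((i, (A, B)) :: D) K ->
  ~ collinear A B C -> (forall X, K X -> triangle A B C X -> segment A B X) ->
  for_small (fun t => linking t ((i, (A, B)) :: D) = linking t [:: (i, (A, C)), (i, (C, B)) & D]).
Proof.
move=> ol nc sub.
have : for_small (fun t => forall b, b \in D -> generic_triangle t A B C b.2.1 b.2.2).
  by apply: for_small_all => b _; apply: for_small_generic_triangle.
move/for_smallW; apply => t gen; apply: linking_replace.
apply/eqP; rewrite -subr_eq0 opprD -!sumrN -!big_split /=; apply/eqP.
(* the potential, as a function of label and vertex *)
pose f (x : nat * point) : R := if i == x.1 then 0 else
  (-1) ^+ (i + x.1) * (Num.sg (orient t A B C) * side t A B C x.2).
have E b : b \in D -> weight t (i, (A, B)) b + (- weight t (i, (A, C)) b - weight t (i, (C, B)) b)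
    = f (b.1, b.2.2) - f (b.1, b.2.1).
  move=> hb; rewrite /weight /f; case: ifP => [|/negbT ib]; first by rewrite /= => _; ring.
  have hb' : b \in (i, (A, B)) :: D by rewrite inE hb orbT.
  have disj X : segment b.2.1 b.2.2 X -> ~ triangle A B C X.
    move=> hX hT; have KX : K X by apply: (seg_sub ol hb').
    by apply: (seg_disjoint ol (mem_head _ _) hb' ib (sub _ KX hT)).
  have bb : b.2.1 != b.2.2 by case: ol => _ _ v3 _ _; apply: (v3 _ hb').
  have := triangle_sum (gen b hb) bb disj.
  rewrite (csignNl t C B) (csignNl t A C) -surjective_pairing => e.
  rewrite -!mulrN -!mulrDr; congr (_ * _).
  by rewrite -e; ring.
rewrite (eq_big_seq _ E) sumrB.
have [_ v2 _ _ _] := ol.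
have := perm_big (op := +%R) (x := 0) _ v2 (P := xpredT) (F := f).
rewrite !big_cons !big_map /= /f /= eqxx !add0r => ->.
by rewrite subrr.
Qed.

End OrientedLinks.

(** * Subdividing an edge and merging two edges *)

Section Subdivision.
Local Open Scope classical_set_scope.
Local Open Scope ring_scope.
Variable R : realType.
Local Notation point := 'rV[R]_3.
Local Notation ledge := (nat * (point * point))%type.
Implicit Types (A B C P Q X Y Z : point) (t s u v : R) (a b c : ledge) (D E : seq ledge).
Implicit Types (K : set point) (i : nat).

Lemma point_at_0 P Q : point_at P Q 0 = P.
Proof. by rewrite /point_at subr0 scale1r scale0r addr0. Qed.

Lemma point_at_1 P Q : point_at P Q 1 = Q.
Proof. by rewrite /point_at subrr scale1r scale0r add0r. Qed.

Lemma point_at_at P Q u v s :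
  point_at (point_at P Q u) (point_at P Q v) s = point_at P Q ((1 - s) * u + s * v).
Proof. by apply: point_ext; rewrite !point_at_E; ring. Qed.

Lemma point_at_left P Q s u : point_at P (point_at P Q s) u = point_at P Q (u * s).
Proof. by apply: point_ext; rewrite !point_at_E; ring. Qed.

Lemma point_at_right P Q s u : point_at (point_at P Q s) Q u = point_at P Q ((1 - u) * s + u).
Proof. by apply: point_ext; rewrite !point_at_E; ring. Qed.

Lemma point_at_inj P Q : P != Q -> injective (point_at P Q).
Proof.
move=> PQ u v e; apply/eqP; rewrite -subr_eq0.
have : (u - v) *: (Q - P) = 0.
  have -> : (u - v) *: (Q - P) = point_at P Q u - point_at P Q v.
    apply: point_ext; rewrite !(point_at_E, coordE); ring.
  by rewrite e subrr.
by move/eqP; rewrite scaler_eq0 (subr_eq0 Q P) (eq_sym Q) (negPf PQ) orbF.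
Qed.

Lemma point_at_eql P Q s : P != Q -> point_at P Q s = P -> s = 0.
Proof. by move=> PQ e; apply: (point_at_inj PQ); rewrite e point_at_0. Qed.

Lemma point_at_eqr P Q s : P != Q -> point_at P Q s = Q -> s = 1.
Proof. by move=> PQ e; apply: (point_at_inj PQ); rewrite e point_at_1. Qed.

Section Between.
Variables (P Q : point) (s : R).
Hypothesis PQ : P != Q.
Hypothesis hs : 0 < s < 1.
Let X := point_at P Q s.

Lemma segment_left Y : segment P X Y <-> exists2 u, 0 <= u <= s & Y = point_at P Q u.
Proof.
have [s0 s1] := andP hs; split.
  move=> /segmentP[u /andP[u0 u1] ->]; exists (u * s).
    by apply/andP; split; nra.
  exact: point_at_left.
move=> [u /andP[u0 us] ->]; apply/segmentP; exists (u / s).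
  by apply/andP; split; [rewrite divr_ge0 // ltW | rewrite ler_pdivrMr // mul1r].
by rewrite point_at_left divfK // gt_eqF.
Qed.

Lemma segment_right Y : segment X Q Y <-> exists2 u, s <= u <= 1 & Y = point_at P Q u.
Proof.
have [s0 s1] := andP hs; split.
  move=> /segmentP[u /andP[u0 u1] ->]; exists ((1 - u) * s + u).
    by apply/andP; split; nra.
  exact: point_at_right.
move=> [u /andP[u0 us] ->]; apply/segmentP; exists ((u - s) / (1 - s)).
  by apply/andP; split; [rewrite divr_ge0; lra | rewrite ler_pdivrMr; lra].
by rewrite point_at_right; congr point_at; field; rewrite gt_eqF //; lra.
Qed.

Lemma segment_cat Y : segment P Q Y <-> segment P X Y \/ segment X Q Y.
Proof.
have [s0 s1] := andP hs; rewrite segment_left segment_right segmentP; split.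
  move=> [u /andP[u0 u1] e]; have [us|su] := leP u s; [left|right];
  by exists u; rewrite // ?u0 ?u1 ?us ?ltW.
by move=> [] [u /andP[u0 u1] e]; exists u => //; lra.
Qed.

Lemma segment_cap Y : segment P X Y -> segment X Q Y -> Y = X.
Proof.
move=> /segment_left[u hu ->] /segment_right[v hv] /(point_at_inj PQ) e.
by congr point_at; lra.
Qed.

Lemma segment_leftE Y : segment P X Y -> Y != Q.
Proof.
by move=> /segment_left[u hu ->]; apply/eqP => /(point_at_eqr PQ) e;
  have [u0 u1] := andP hu; have [s0 s1] := andP hs; lra.
Qed.

Lemma segment_rightE Y : segment X Q Y -> Y != P.
Proof.
by move=> /segment_right[u hu ->]; apply/eqP => /(point_at_eql PQ) e;
  have [u0 u1] := andP hu; have [s0 s1] := andP hs; lra.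
Qed.

Lemma between_neq : P != X /\ X != Q.
Proof.
split; first by rewrite eq_sym; apply: segment_rightE; apply: segment_l.
by apply: segment_leftE; apply: segment_r.
Qed.

End Between.

(** The disjointness condition in a form that is symmetric in the two edges. *)
Definition meet_at_ends a b : Prop :=
  a != b -> forall X, seg a X -> seg b X -> X \in ends a /\ X \in ends b.

Lemma meet_sym a b : meet_at_ends a b -> meet_at_ends b a.
Proof. by move=> h ab X sa sb; have [] := h _ X sb sa; rewrite 1?eq_sym. Qed.

Lemma meet_cons a D : (forall b, b \in D -> meet_at_ends a b) ->
  (forall b c, b \in D -> c \in D -> meet_at_ends b c) ->
  forall b c, b \in a :: D -> c \in a :: D -> meet_at_ends b c.
Proof.
move=> h1 h2 b c; rewrite !inE => /predU1P[->|hb] /predU1P[->|hc].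
- by rewrite /meet_at_ends eqxx.
- exact: h1.
- by apply: meet_sym; apply: h1.
- exact: h2.
Qed.

Lemma oriented_link_intro D K :
  uniq [seq a.2.1 | a <- D] ->
  perm_eq [seq (a.1, a.2.1) | a <- D] [seq (a.1, a.2.2) | a <- D] ->
  (forall a, a \in D -> a.2.1 != a.2.2) ->
  (forall a b, a \in D -> b \in D -> meet_at_ends a b) ->
  (forall X, K X <-> exists2 a, a \in D & seg a X) -> oriented_link D K.
Proof.
move=> v1 v2 v3 v4 v5; split=> //; last by apply/seteqP; split=> X /v5.
by move=> a b X ha hb ab sa sb; have [] := v4 a b ha hb ab X sa sb.
Qed.

Lemma oriented_link_meet D K a b : oriented_link D K -> a \in D -> b \in D -> meet_at_ends a b.
Proof. by move=> ol ha hb ab X; apply: (seg_meet ol). Qed.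

Lemma oriented_link_neq a D K b : oriented_link (a :: D) K -> b \in D -> a != b.
Proof.
case=> /= /andP[n _] _ _ _ _ hb; apply: contraNneq n => ->.
by apply: (map_f (fun a : ledge => a.2.1)).
Qed.

Lemma oriented_link_K D K X : oriented_link D K -> K X <-> exists2 a, a \in D & seg a X.
Proof. by case=> _ _ _ _ ->. Qed.

(** The balance of starts and ends does not see an intermediate vertex. *)
Lemma perm_chain (T : eqType) (x y z : T) (S U : seq T) :
  perm_eq [:: x, y & S] [:: y, z & U] = perm_eq (x :: S) (z :: U).
Proof.
by rewrite (perm_catCA [:: x] [:: y] S) /= perm_cons.
Qed.

Lemma oriented_link_split i P Q D K s : oriented_link ((i, (P, Q)) :: D) K -> 0 < s < 1 ->
  oriented_link [:: (i, (P, point_at P Q s)), (i, (point_at P Q s, Q)) & D] K.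
Proof.
set x := (i, (P, Q)); set X := point_at P Q s.
set y := (i, (P, X)); set z := (i, (X, Q)) => ol hs.
have [v1 v2 v3 v4 v5] := ol.
have PQ : P != Q by exact: (v3 x (mem_head _ _)).
have [PX XQ] := between_neq PQ hs.
have catP Y : seg x Y <-> seg y Y \/ seg z Y := segment_cat P Q hs Y.
have old b : b \in D -> b \in x :: D by rewrite inE orbC => ->.
have SX : seg x X by apply/catP; left; apply: segment_r.
have noX b : b \in D -> seg b X -> False.
  move=> hb sb; have [] := seg_meet ol (mem_head _ _) (old _ hb) (oriented_link_neq ol hb) SX sb.
  by rewrite !inE eq_sym (negPf PX) (negPf XQ).
apply: oriented_link_intro.
- move: v1 => /= /andP[n ->]; rewrite andbT inE negb_or PX n /=.
  by apply/mapP => -[b hb e]; apply: (noX b hb); rewrite e; apply: segment_l.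
- by rewrite /= perm_chain.
- by move=> a; rewrite !inE => /or3P[/eqP->|/eqP->|/old/v3].
- apply: meet_cons => [b|].
    rewrite inE => /predU1P[->|hb] _ Y shear_y sz.
      have -> : Y = X by apply: (segment_cap PQ hs).
      by rewrite !inE !eqxx orbT.
    have shear_x : seg x Y by apply/catP; left.
    have [e1 e2] := seg_meet ol (mem_head _ _) (old _ hb) (oriented_link_neq ol hb) shear_x sz.
    split=> //; move: e1; rewrite !inE.
    by rewrite (negPf (segment_leftE PQ hs shear_y)) orbF => ->.
  apply: meet_cons => [b hb _ Y shear_y sz|b c hb hc]; last by apply: (oriented_link_meet ol); apply: old.
  have shear_x : seg x Y by apply/catP; right.
  have [e1 e2] := seg_meet ol (mem_head _ _) (old _ hb) (oriented_link_neq ol hb) shear_x sz.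
  split=> //; move: e1; rewrite !inE.
  by rewrite (negPf (segment_rightE PQ hs shear_y)) /= => ->; rewrite orbT.
move=> Y; rewrite (oriented_link_K _ ol); split=> -[a].
  rewrite inE => /predU1P[->|ha] sa; last by exists a; rewrite // !inE ha !orbT.
  by move: sa => /catP[sa|sa]; [exists y|exists z]; rewrite // !inE eqxx ?orbT.
rewrite !inE => /or3P[/eqP->|/eqP->|ha] sa; last by exists a; rewrite // inE ha orbT.
- by exists x; rewrite ?mem_head //; apply/catP; left.
- by exists x; rewrite ?mem_head //; apply/catP; right.
Qed.

(** No third edge can end at the point X where the two edges are merged. *)
Lemma oriented_link_merge i P Q D K s : P != Q -> 0 < s < 1 ->
  oriented_link [:: (i, (P, point_at P Q s)), (i, (point_at P Q s, Q)) & D] K ->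
  oriented_link ((i, (P, Q)) :: D) K.
Proof.
set x := (i, (P, Q)); set X := point_at P Q s.
set y := (i, (P, X)); set z := (i, (X, Q)) => PQ hs ol.
have [v1 v2 v3 v4 v5] := ol.
have [PX XQ] := between_neq PQ hs.
have catP Y : seg x Y <-> seg y Y \/ seg z Y := segment_cat P Q hs Y.
have old b : b \in D -> b \in [:: y, z & D] by rewrite !inE => ->; rewrite !orbT.
have hy : y \in [:: y, z & D] by rewrite mem_head.
have hz : z \in [:: y, z & D] by rewrite !inE eqxx orbT.
have yb b : b \in D -> y != b by move=> hb; apply: (oriented_link_neq ol); rewrite inE hb orbT.
have zb b : b \in D -> z != b.
  move=> hb; apply/eqP => e; move: v1 => /= /and3P[_ n _]; case/negP: n.
  by rewrite -[X]/(z.2.1) e; apply: (map_f (fun a : ledge => a.2.1)).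
have noX b : b \in D -> X \notin ends b.
  move=> hb; apply/negP => Xb.
  have := three_edges ol hy hz (old _ hb) (X := X).
  rewrite (negPf (yb _ hb)) (negPf (zb _ hb)) /= orbF => H.
  have : y == z by apply: H; rewrite // !inE eqxx ?orbT.
  by move=> /eqP[] /eqP; rewrite (negPf PX).
apply: oriented_link_intro.
- by move: v1 => /= /and3P[n _ ->]; rewrite andbT; move: n; rewrite inE negb_or => /andP[].
- by move: v2; rewrite /= perm_chain.
- by move=> a; rewrite !inE => /orP[/eqP->|/old/v3].
- apply: meet_cons => [b hb _ Y shear_x sb|b c hb hc]; last by apply: (oriented_link_meet ol); apply: old.
  move: shear_x => /catP[shear_y|sz].
    have [e1 e2] := seg_meet ol hy (old _ hb) (yb _ hb) shear_y sb.
    move: e1; rewrite inE => /predU1P[e|]; first by split; rewrite // e inE eqxx.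
    by rewrite inE => /eqP e; move: (noX _ hb); rewrite -[X]e e2.
  have [e1 e2] := seg_meet ol hz (old _ hb) (zb _ hb) sz sb.
  move: e1; rewrite inE => /predU1P[e|]; first by move: (noX _ hb); rewrite -[X]e e2.
  by rewrite inE => /eqP e; split; rewrite // e !inE eqxx orbT.
move=> Y; rewrite (oriented_link_K _ ol); split=> -[a].
  rewrite !inE => /or3P[/eqP->|/eqP->|ha] sa; last by exists a; rewrite // inE ha orbT.
  - by exists x; rewrite ?mem_head //; apply/catP; left.
  - by exists x; rewrite ?mem_head //; apply/catP; right.
rewrite inE => /predU1P[->|ha] sa; last by exists a; rewrite // !inE ha !orbT.
by move: sa => /catP[sa|sa]; [exists y|exists z]; rewrite // !inE eqxx ?orbT.
Qed.

End Subdivision.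

(** * An elementary move on an edge *)

Section DeltaMove.
Local Open Scope classical_set_scope.
Local Open Scope ring_scope.
Variable R : realType.
Local Notation point := 'rV[R]_3.
Local Notation ledge := (nat * (point * point))%type.
Implicit Types (A B C P Q X Y Z : point) (t s u v : R) (a b c : ledge) (D E : seq ledge).
Implicit Types (K : set point) (i : nat).

Lemma coord0 : ((cx (0 : point) = 0)%R * (cy (0 : point) = 0)%R * (cz (0 : point) = 0)%R)%type.
Proof. by rewrite /cx /cy /cz !mxE. Qed.

(** The form in which affine independence is used: comparison of the coefficients of B - A and
    C - A. *)
Definition independent A B C : Prop :=
  forall u v, u *: (B - A) + v *: (C - A) = 0 -> u = 0 /\ v = 0.

Lemma affinely_independentP A B C : affinely_independent A B C -> independent A B C.
Proof.
move=> /row_freeP[M hM] u v e.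
have h : row_mx (u%:M : 'M_1) (v%:M : 'M_1) *m col_mx (B - A) (C - A) = 0.
  by rewrite mul_row_col !mul_scalar_mx.
have : row_mx (u%:M : 'M[R]_1) (v%:M : 'M[R]_1) = row_mx 0 0.
  by rewrite -[LHS]mulmx1 -hM mulmxA h mul0mx row_mx0.
move=> /eq_row_mx[hu hv].
by split; [move/matrixP: hu|move/matrixP: hv] => /(_ ord0 ord0); rewrite !mxE eqxx.
Qed.

Section Independent.
Variables A B C : point.
Hypothesis ind : independent A B C.

Lemma independent_at u v u' v' :
  A + (u *: (B - A) + v *: (C - A)) = A + (u' *: (B - A) + v' *: (C - A)) -> u = u' /\ v = v'.
Proof.
move=> /addrI e; have [] := ind (u := u - u') (v := v - v'); last by move=> *; split; lra.
by rewrite !scalerBl addrACA -opprD e subrr.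
Qed.

Lemma point_at_AB s : point_at A B s = A + (s *: (B - A) + 0 *: (C - A)).
Proof.
apply: point_ext; rewrite !(point_at_E, coordE); ring.
Qed.

Lemma point_at_AC s : point_at A C s = A + (0 *: (B - A) + s *: (C - A)).
Proof.
apply: point_ext; rewrite !(point_at_E, coordE); ring.
Qed.

Lemma point_at_CB s : point_at C B s = A + (s *: (B - A) + (1 - s) *: (C - A)).
Proof.
apply: point_ext; rewrite !(point_at_E, coordE); ring.
Qed.

Lemma independent_neq : [/\ A != B, A != C & C != B].
Proof.
split; apply/eqP => e.
- have [] := ind (u := 1) (v := 0); last lra.
  by rewrite e subrr scaler0 scale0r addr0.
- have [] := ind (u := 0) (v := 1); last lra.
  by rewrite e subrr scaler0 scale0r addr0.
- have [] := ind (u := 1) (v := -1); last lra.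
  by rewrite e scaleN1r scale1r subrr.
Qed.

Lemma independent_not_collinear : ~ collinear A B C.
Proof.
move=> [h1 h2 h3].
have key (f : point -> R) : (f C - f A) *: (B - A) + (- (f B - f A)) *: (C - A) = 0 ->
    f B = f A by move=> e; have [_] := ind e; lra.
have [AB _ _] := independent_neq.
case/eqP: AB; apply/esym/point_ext; apply: key; apply: point_ext; rewrite !coordE !coord0; lra.
Qed.

Lemma cap_AB_AC X : segment A B X -> segment A C X -> X = A.
Proof.
move=> /segmentP[s _ ->] /segmentP[u _]; rewrite point_at_AB point_at_AC => /independent_at[-> _].
by rewrite !scale0r !addr0.
Qed.

Lemma cap_AB_CB X : segment A B X -> segment C B X -> X = B.
Proof.
move=> /segmentP[s _ ->] /segmentP[u _]; rewrite point_at_AB point_at_CB => /independent_at[-> h].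
have -> : u = 1 by lra.
by rewrite scale0r addr0 scale1r addrC subrK.
Qed.

Lemma cap_AC_CB X : segment A C X -> segment C B X -> X = C.
Proof.
move=> /segmentP[s _ ->] /segmentP[u _]; rewrite point_at_AC point_at_CB => /independent_at[h ->].
by rewrite -h scale0r add0r subr0 scale1r addrC subrK.
Qed.

Lemma triangle_AC : segment A C `<=` triangle A B C.
Proof.
by move=> X h; rewrite -triangle_cycle -triangle_cycle; apply: triangle_edge; rewrite segmentC.
Qed.

Lemma triangle_CB : segment C B `<=` triangle A B C.
Proof. by move=> X h; rewrite -triangle_cycle; apply: triangle_edge; rewrite segmentC. Qed.

Variables K K' : set point.
Hypothesis KT : K `&` triangle A B C = segment A B.
Hypothesis K'E : K' = (K `\` segment A B) `|` (segment A C `|` segment C B).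

Let KTP X : K X -> triangle A B C X -> segment A B X.
Proof. by move=> h1 h2; rewrite -KT. Qed.

Let ABK X : segment A B X -> K X.
Proof. by rewrite -KT => -[]. Qed.

(** Any other edge meets the triangle ABC only along AB, so at A or B. *)
Lemma oriented_link_delta i D : oriented_link ((i, (A, B)) :: D) K ->
  oriented_link [:: (i, (A, C)), (i, (C, B)) & D] K'.
Proof.
set x := (i, (A, B)); set y := (i, (A, C)); set z := (i, (C, B)) => ol.
have [v1 v2 v3 v4 v5] := ol.
have [AB AC CB] := independent_neq.
have old b : b \in D -> b \in x :: D by rewrite inE orbC => ->.
have hx : x \in x :: D by rewrite mem_head.
have bK b Y : b \in D -> seg b Y -> K Y by move=> hb; apply: (seg_sub ol); apply: old.
have nC : ~ K C.
  move=> /KTP H; have := cap_AB_AC (H (triangle_AC (segment_r _ _))) (segment_r _ _).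
  by move/eqP; rewrite eq_sym (negPf AC).
have my b : b \in D -> meet_at_ends y b.
  move=> hb _ Y shear_y sb; have shear_x := KTP (bK _ _ hb sb) (triangle_AC shear_y).
  have e := cap_AB_AC shear_x shear_y.
  have [_ e2] := seg_meet ol hx (old _ hb) (oriented_link_neq ol hb) shear_x sb.
  by rewrite e2 e mem_head.
have mz b : b \in D -> meet_at_ends z b.
  move=> hb _ Y sz sb; have shear_x := KTP (bK _ _ hb sb) (triangle_CB sz).
  have e := cap_AB_CB shear_x sz.
  have [_ e2] := seg_meet ol hx (old _ hb) (oriented_link_neq ol hb) shear_x sb.
  by rewrite e2 e !inE eqxx orbT.
apply: oriented_link_intro.
- move: v1 => /= /andP[n ->]; rewrite andbT inE negb_or AC n /=.
  by apply/mapP => -[b hb e]; apply: nC; apply: (bK b) => //; rewrite e; apply: segment_l.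
- by rewrite /= perm_chain.
- by move=> a; rewrite !inE => /or3P[/eqP->|/eqP->|/old/v3].
- apply: meet_cons => [b|].
    rewrite inE => /predU1P[->|/my//] _ Y shear_y sz.
    have -> : Y = C by apply: cap_AC_CB.
    by rewrite !inE !eqxx orbT.
  apply: meet_cons => [b /mz //|b c hb hc]; apply: (oriented_link_meet ol); exact: old.
move=> Y; rewrite K'E; split.
  move=> [[/(oriented_link_K _ ol)[a]]|[h|h]].
  - rewrite inE => /predU1P[->|ha] sa; first by [].
    by exists a; rewrite // !inE ha !orbT.
  - by exists y; rewrite ?mem_head.
  - by exists z; rewrite // !inE eqxx orbT.
move=> [a]; rewrite !inE => /or3P[/eqP->|/eqP->|ha] sa.
- by right; left.
- by right; right.
have [hAB|hAB] := pselect (segment A B Y); last by left; split=> //; apply: (bK a).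
have [e _] := seg_meet ol hx (old _ ha) (oriented_link_neq ol ha) hAB sa.
right; move: e; rewrite !inE => /orP[]/eqP->; [left; exact: segment_l|right; exact: segment_r].
Qed.

(** A point of another edge that lies on AB lies in K' as well; the part of AB that survives in K'
    belongs to AC or CB, so the point is A or B. *)
Lemma oriented_link_deltaV i D : oriented_link [:: (i, (A, C)), (i, (C, B)) & D] K' ->
  oriented_link ((i, (A, B)) :: D) K.
Proof.
set x := (i, (A, B)); set y := (i, (A, C)); set z := (i, (C, B)) => ol.
have [v1 v2 v3 v4 v5] := ol.
have [AB AC CB] := independent_neq.
have old b : b \in D -> b \in [:: y, z & D] by rewrite !inE => ->; rewrite !orbT.
have hy : y \in [:: y, z & D] by rewrite mem_head.
have hz : z \in [:: y, z & D] by rewrite !inE eqxx orbT.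
have yb b : b \in D -> y != b by move=> hb; apply: (oriented_link_neq ol); rewrite inE hb orbT.
have zb b : b \in D -> z != b.
  move=> hb; apply/eqP => e; move: v1 => /= /and3P[_ n _]; case/negP: n.
  by rewrite -[C]/(z.2.1) e; apply: (map_f (fun a : ledge => a.2.1)).
have noC b : b \in D -> C \notin ends b.
  move=> hb; apply/negP => Xb.
  have := three_edges ol hy hz (old _ hb) (X := C).
  rewrite (negPf (yb _ hb)) (negPf (zb _ hb)) /= orbF => H.
  have : y == z by apply: H; rewrite // !inE eqxx ?orbT.
  by move=> /eqP[] /eqP; rewrite (negPf AC).
have bK b Y : b \in D -> seg b Y -> K' Y by move=> hb; apply: (seg_sub ol); apply: old.
have side b Y : b \in D -> seg b Y -> segment A C Y \/ segment C B Y ->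
    Y \in ends x /\ Y \in ends b.
  move=> hb sb [h|h].
    have [e e2] := seg_meet ol hy (old _ hb) (yb _ hb) h sb.
    split=> //; move: e; rewrite !inE => /orP[->//|/eqP e].
    by move: (noC _ hb); rewrite -[C]/(y.2.2) -e e2.
  have [e e2] := seg_meet ol hz (old _ hb) (zb _ hb) h sb.
  split=> //; move: e; rewrite !inE => /orP[/eqP e|->]; last by rewrite orbT.
  by move: (noC _ hb); rewrite -[C]/(z.2.1) -e e2.
apply: oriented_link_intro.
- by move: v1 => /= /and3P[n _ ->]; rewrite andbT; move: n; rewrite inE negb_or => /andP[].
- by move: v2; rewrite /= perm_chain.
- by move=> a; rewrite !inE => /orP[/eqP->|/old/v3].
- apply: meet_cons => [b hb _ Y shear_x sb|b c hb hc]; last by apply: (oriented_link_meet ol); apply: old.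
  apply: side => //; have := bK _ _ hb sb; rewrite K'E => -[[_ /(_ shear_x)[]]|//].
move=> Y; split.
  move=> KY; have [h|h] := pselect (segment A B Y); first by exists x; rewrite ?mem_head.
  have : K' Y by rewrite K'E; left.
  move=> /(oriented_link_K _ ol)[a]; rewrite !inE => /or3P[/eqP->|/eqP->|ha] sa.
  - by case: h; apply: KTP => //; apply: triangle_AC.
  - by case: h; apply: KTP => //; apply: triangle_CB.
  - by exists a; rewrite // inE ha orbT.
move=> [a]; rewrite inE => /predU1P[->|ha] sa; first exact: ABK.
have := bK _ _ ha sa; rewrite K'E => -[[]//|h].
have [e _] := side _ _ ha sa h.
by apply: ABK; move: e; rewrite !inE => /orP[]/eqP->; [exact: segment_l|exact: segment_r].
Qed.

End Independent.

End DeltaMove.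

(** * Making a given segment of a link an edge *)

Section Straightening.
Local Open Scope classical_set_scope.
Local Open Scope ring_scope.
Variable R : realType.
Local Notation point := 'rV[R]_3.
Local Notation ledge := (nat * (point * point))%type.
Implicit Types (A B C P Q X Y Z : point) (t s u v : R) (a b c : ledge) (D E : seq ledge).
Implicit Types (K : set point) (i : nat).

(** A closed segment is convex and closed, so near X it either misses the ray from X to Y or contains
    a beginning of it. *)
Lemma germ P Q X Y : P != Q -> X != Y ->
  for_small (fun s => ~ segment P Q (point_at X Y s)) \/
  (segment P Q X /\ exists2 s, 0 < s & segment P Q (point_at X Y s)).
Proof.
move=> PQ XY.
have [h|h] := pselect (for_small (fun s => ~ segment P Q (point_at X Y s))); [by left|right].
have ex e : 0 < e -> exists2 s, 0 < s < e & segment P Q (point_at X Y s).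
  move=> e0; apply: contrapT => no; apply: h; exists e => // s hs hh.
  by apply: no; exists s.
have [s1 /andP[s10 _] h1] := ex 1 ltr01.
have [s2 /andP[s20 s21] h2] := ex s1 s10.
split; last by exists s1.
have [u1 hu1 e1] := (segmentP _ _ _).1 h1; have [u2 hu2 e2] := (segmentP _ _ _).1 h2.
(* two common points make the ray a part of the line PQ, with the affine parameter u0 + s * m *)
pose u0 := (s1 * u2 - s2 * u1) / (s1 - s2); pose m := (u1 - u2) / (s1 - s2).
have d : s1 - s2 != 0 by rewrite gt_eqF //; lra.
have line s : point_at X Y s = point_at P Q (u0 + s * m).
  pose w := (s - s2) / (s1 - s2).
  have -> : point_at X Y s = point_at (point_at X Y s2) (point_at X Y s1) w.
    by rewrite point_at_at; congr point_at; rewrite /w; field.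
  by rewrite e1 e2 point_at_at; congr point_at; rewrite /w /u0 /m; field.
apply/segmentP; exists u0; last by rewrite -(point_at_0 X Y) line mul0r addr0.
apply/andP; split; rewrite leNgt; apply/negP => hu.
  have hu' : 0 < - u0 by lra.
  have [e e0 he] := for_small_affine (- u0 - m) hu'.
  have [s hs] := ex e e0.
  rewrite line => /segmentP[u /andP[hu0 _]] /(point_at_inj PQ) eu.
  have := he s hs; lra.
have hu' : 0 < u0 - 1 by lra.
have [e e0 he] := for_small_affine (u0 - 1 + m) hu'.
have [s hs] := ex e e0.
rewrite line => /segmentP[u /andP[_ hu0]] /(point_at_inj PQ) eu.
have := he s hs; lra.
Qed.

Section Fixed.
Variables (D : seq ledge) (K : set point).
Hypothesis ol : oriented_link D K.

(** Finitely many edges cover the segment, so one of them contains points of it arbitrarily close to X. *)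
Lemma cover X Y : X != Y -> segment X Y `<=` K ->
  exists a, [/\ a \in D, seg a X & exists2 s, 0 < s & seg a (point_at X Y s)].
Proof.
move=> XY sub; apply: contrapT => no.
have : for_small (fun s => forall a, a \in D -> ~ seg a (point_at X Y s)).
  apply: for_small_all => a ha; have a12 : a.2.1 != a.2.2 by case: ol => _ _ v3 _ _; apply: v3.
  by have [|[h1 h2]] := germ a12 XY => //; case: no; exists a.
move=> /for_smallI/(_ (for_small_lt ltr01))/for_small_ex[s [_ [h /andP[s0 s1]]]].
have /(oriented_link_K _ ol)[a ha sa] : K (point_at X Y s).
  by apply: sub; apply/segmentP; exists s; rewrite // !ltW.
exact: h sa.
Qed.

Definition vertex X := exists2 a, a \in D & X \in ends a.

Definition interior a X := exists2 s, 0 < s < 1 & X = point_at a.2.1 a.2.2 s.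

Lemma ends_seg a X : X \in ends a -> seg a X.
Proof. by rewrite !inE => /orP[]/eqP->; [apply: segment_l|apply: segment_r]. Qed.

Lemma vertex_ends a X : vertex X -> a \in D -> seg a X -> X \in ends a.
Proof.
move=> [b hb Xb] ha sa; have [->//|ab] := eqVneq a b.
by have [] := seg_meet ol ha hb ab sa (ends_seg Xb).
Qed.

Lemma seg_interior a X : seg a X -> X \notin ends a -> interior a X.
Proof.
move=> /segmentP[s /andP[s0 s1] e] n; exists s => //.
move: n; rewrite e !inE negb_or => /andP[n0 n1].
rewrite !lt_neqAle s0 s1 !andbT; apply/andP; split; apply/eqP => es.
  by move: n0; rewrite -es point_at_0 eqxx.
by move: n1; rewrite es point_at_1 eqxx.
Qed.

Lemma interior_ends a X : a \in D -> interior a X -> X \notin ends a.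
Proof.
move=> ha [s hs ->]; have a12 : a.2.1 != a.2.2 by case: ol => _ _ v3 _ _; apply: v3.
have [h1 h2] := between_neq a12 hs.
by rewrite !inE negb_or eq_sym h1.
Qed.

End Fixed.

Definition equi D E := for_small (fun t => linking t D = linking t E).

Lemma equi_refl D : equi D D. Proof. exact: for_smallT. Qed.

Lemma equi_sym D E : equi D E -> equi E D.
Proof. by move/for_smallW; apply. Qed.

Lemma equi_trans E D F : equi D E -> equi E F -> equi D F.
Proof. by move=> h1 h2; apply: (for_smallW (for_smallI h1 h2)) => t [-> ->]. Qed.

Lemma equi_perm D E : perm_eq D E -> equi D E.
Proof. by move=> h; apply: for_smallT => t; exact: linking_perm. Qed.

Lemma make_vertex D K X : oriented_link D K -> K X ->
  exists E, [/\ oriented_link E K, equi D E, vertex E X,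
    forall Z, vertex D Z -> vertex E Z
    & forall a, a \in D -> ~ interior a X -> a \in E].
Proof.
move=> ol /(oriented_link_K _ ol)[a ha sa].
have [Xa|nX] := boolP (X \in ends a); first by exists D; split=> //; [exact: equi_refl|exists a].
have [s hs eX] := seg_interior sa nX.
case: a ha sa nX eX => i [P Q] ha sa nX /= eX.
have pe := perm_to_rem ha; set D' := rem _ D in pe.
have ol1 := oriented_link_perm pe ol.
exists [:: (i, (P, X)), (i, (X, Q)) & D']; split.
- by rewrite eX; apply: oriented_link_split ol1 hs.
- by apply: (equi_trans (equi_perm pe)); rewrite eX; apply: for_small_linking_split ol1 hs.
- by exists (i, (P, X)); rewrite ?mem_head // !inE eqxx orbT.
- move=> Z [b]; rewrite (perm_mem pe) inE => /predU1P[->|hb].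
    rewrite inE => /predU1P[->|]; first by exists (i, (P, X)); rewrite !inE eqxx.
    rewrite inE => /eqP->; exists (i, (X, Q)); rewrite !inE eqxx ?orbT //.
  by exists b; rewrite // !inE hb !orbT.
move=> b; rewrite (perm_mem pe) inE => /predU1P[->|hb _]; last by rewrite !inE hb !orbT.
by case; exists s.
Qed.

Definition strictly_between A B Z := exists2 s, 0 < s < 1 & Z = point_at A B s.

Lemma other_end A B P Q s s' : A != B -> s != s' -> P = point_at A B s ->
  segment P Q (point_at A B s') -> exists2 r, Q = point_at A B r & 0 < (r - s) * (s' - s).
Proof.
move=> AB ss eP /segmentP[u /andP[u0 u1] e].
have un : u != 0.
  by apply: contra_neq ss => u00; move: e; rewrite u00 point_at_0 eP => /(point_at_inj AB).
have up : 0 < u by rewrite lt_neqAle eq_sym un.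
exists (s + (s' - s) / u).
  have : point_at P (point_at P Q u) u^-1 = Q by rewrite point_at_left mulVf // point_at_1.
  by rewrite -e {1}eP point_at_at => <-; congr point_at; field.
rewrite addrAC subrr add0r mulrAC mulr_gt0 ?invr_gt0 //.
by rewrite -expr2 lt_neqAle eq_sym sqrf_eq0 subr_eq0 eq_sym ss sqr_ge0.
Qed.

Lemma ends_pair c X Y : X \in ends c -> Y \in ends c -> X != Y ->
  c = (c.1, (X, Y)) \/ c = (c.1, (Y, X)).
Proof.
case: c => i [x y]; rewrite !inE /= => /orP[]/eqP-> /orP[]/eqP->; rewrite ?eqxx //; by [left|right].
Qed.

(** Induction on the number of edges.  At a vertex Z of the link strictly between A and B, the two edges
    at Z lead towards A and towards B by cover, hence they can be merged.  If there is none, the edge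
    at A that leads towards B ends at B. *)
Lemma straighten D K A B : oriented_link D K -> A != B -> segment A B `<=` K ->
  vertex D A -> vertex D B ->
  exists E, [/\ oriented_link E K, equi D E,
    exists i, ((i, (A, B)) \in E) || ((i, (B, A)) \in E)
    & forall a, a \in D -> (forall Z, Z \in ends a -> ~ strictly_between A B Z) -> a \in E].
Proof.
move=> + AB sub.
have [n] := ubnP (size D); elim: n D => // n IH D; rewrite ltnS => sz ol vA vB.
have line s : 0 <= s <= 1 -> K (point_at A B s) by move=> hs; apply: sub; apply/segmentP; exists s.
have cov s s' : 0 <= s <= 1 -> 0 <= s' <= 1 -> s != s' -> vertex D (point_at A B s) ->
    exists a, [/\ a \in D, point_at A B s \in ends a & exists2 r, point_at A B r \in ends a & 0 < (r - s) * (s' - s)].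
  move=> hs hs' ss vs.
  have [||a [ha sa [u u0 hu]]] := cover ol (X := point_at A B s) (Y := point_at A B s').
  - by rewrite (inj_eq (point_at_inj AB)).
  - move=> X /segmentP[u /andP[u0 u1] ->]; rewrite point_at_at; apply: line.
    by have [h1 h2] := andP hs; have [h3 h4] := andP hs'; apply/andP; split; nra.
  have ea := vertex_ends ol vs ha sa.
  exists a; split=> //; rewrite point_at_at in hu; set s2 := _ + _ in hu.
  have es2 : s2 - s = u * (s' - s) by rewrite /s2; ring.
  have ns2 : s != s2.
    by rewrite eq_sym -subr_eq0 es2; apply: mulf_neq0; [rewrite gt_eqF|rewrite subr_eq0 eq_sym].
  have pos r : 0 < (r - s) * (s2 - s) -> 0 < (r - s) * (s' - s).
    by rewrite es2 mulrCA pmulr_rgt0.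
  move: ea hu; rewrite /seg !inE => /orP[]/eqP ea hu.
    by have [r er hr] := other_end AB ns2 (esym ea) hu; exists r; [rewrite !inE -er eqxx orbT|exact: pos].
  rewrite segmentC in hu.
  by have [r er hr] := other_end AB ns2 (esym ea) hu; exists r; [rewrite !inE -er eqxx|exact: pos].
have [[s hs vs]|no] := pselect (exists2 s, 0 < s < 1 & vertex D (point_at A B s)); last first.
  have vA0 : vertex D (point_at A B 0) by rewrite point_at_0.
  have [|||a [ha ea [r er]]] := cov 0 1 _ _ _ vA0; try lra.
    by rewrite eq_sym oner_neq0.
  rewrite !subr0 mulr1 => r0.
  have [r1|r1|r1] := ltgtP r 1.
  - by case: no; exists r; [rewrite r0 | exists a].
  - rewrite point_at_0 in ea.
    have Ar : A != point_at A B r by apply/eqP => /esym/(point_at_eql AB); lra.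
    have sB : seg a B.
      have hB : segment A (point_at A B r) B.
        apply/segmentP; exists r^-1; last by rewrite point_at_left mulVf ?point_at_1 // gt_eqF.
        by rewrite invr_ge0 ltW //= invf_le1 // ltW.
      by have [->|->] := ends_pair ea er Ar; rewrite /seg //= segmentC.
    have Br : B != point_at A B r by apply/eqP => /esym/(point_at_eqr AB); lra.
    have := vertex_ends ol vB ha sB.
    by have [->|->] := ends_pair ea er Ar; rewrite !inE /= (eq_sym B A) (negPf AB) (negPf Br).
  exists D; split=> //; first exact: equi_refl.
  rewrite r1 point_at_1 in er; rewrite point_at_0 in ea.
  exists a.1; case: a ha ea er => i [P Q] /= ha; rewrite !inE.
  move=> /orP[]/eqP eA /orP[]/eqP eB; rewrite eA eB ?ha ?orbT //.
  - by move: AB; rewrite eA eB eqxx.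
  - by move: AB; rewrite eA eB eqxx.
have [s0 s1] := andP hs.
set Z := point_at A B s in vs.
have s01 : 0 <= s <= 1 by rewrite !ltW.
have z01 : 0 <= (0 : R) <= 1 by rewrite lexx ler01.
have o01 : 0 <= (1 : R) <= 1 by rewrite lexx ler01.
have [a [ha ea [ra era hra]]] := cov s 0 s01 z01 (negbT (gt_eqF s0)) vs.
have [b [hb eb [rb erb hrb]]] := cov s 1 s01 o01 (negbT (lt_eqF s1)) vs.
have ra0 : ra < s by rewrite sub0r mulrN oppr_gt0 pmulr_llt0 // in hra; lra.
have rb0 : s < rb by rewrite pmulr_lgt0 in hrb; lra.
have ZP : Z != point_at A B ra by rewrite (inj_eq (point_at_inj AB)) gt_eqF.
have ZQ : Z != point_at A B rb by rewrite (inj_eq (point_at_inj AB)) lt_eqF.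
have PQ : point_at A B ra != point_at A B rb by rewrite (inj_eq (point_at_inj AB)) lt_eqF //; lra.
have lab : a.1 = b.1 by apply: (same_label ol ha hb ea eb).
pose w := (s - ra) / (rb - ra).
have d : 0 < rb - ra by lra.
have hw : 0 < w < 1.
  by rewrite /w; apply/andP; split; [apply: divr_gt0; lra|rewrite ltr_pdivrMr //; lra].
have eZ : Z = point_at (point_at A B ra) (point_at A B rb) w.
  by rewrite point_at_at; congr point_at; rewrite /w; field; rewrite gt_eqF.
have ZA : Z != A by apply/eqP => /(point_at_eql AB); lra.
have ZB : Z != B by apply/eqP => /(point_at_eqr AB); lra.
have merge i P Q v : P != Q -> 0 < v < 1 -> Z = point_at P Q v ->
    (i, (P, Z)) \in D -> (i, (Z, Q)) \in D ->
  exists E, [/\ oriented_link E K, equi D E,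
    exists i, ((i, (A, B)) \in E) || ((i, (B, A)) \in E)
    & forall a, a \in D -> (forall Z, Z \in ends a -> ~ strictly_between A B Z) -> a \in E].
  move=> PQ' hv eZ' hy hz; have [PZ QZ] := between_neq PQ' hv.
  rewrite -eZ' in PZ QZ.
  set y := (i, (P, Z)) in hy; set z := (i, (Z, Q)) in hz.
  have yz : z \in rem y D.
    move: hz; rewrite (perm_mem (perm_to_rem hy)) inE => /orP[/eqP[] /eqP|//].
    by rewrite eq_sym (negPf PZ).
  pose D2 := rem z (rem y D).
  have pe : perm_eq D [:: y, z & D2].
    by apply: (perm_trans (perm_to_rem hy)); rewrite perm_cons; apply: perm_to_rem.
  have ol1 := oriented_link_perm pe ol.
  have ol2 : oriented_link ((i, (P, Q)) :: D2) K.
    by apply: (oriented_link_merge PQ' hv); rewrite -eZ'.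
  have eq2 : equi D ((i, (P, Q)) :: D2).
    apply: (equi_trans (equi_perm pe)); apply: equi_sym.
    by rewrite /y /z eZ'; apply: for_small_linking_split ol2 hv.
  have keepv X : X != Z -> vertex D X -> vertex ((i, (P, Q)) :: D2) X.
    move=> XZ [c + Xc]; rewrite (perm_mem pe) !inE => /or3P[/eqP ec|/eqP ec|hc].
    - exists (i, (P, Q)); first by rewrite mem_head.
      by move: Xc; rewrite ec !inE (negPf XZ) orbF => ->.
    - exists (i, (P, Q)); first by rewrite mem_head.
      by move: Xc; rewrite ec !inE (negPf XZ) /= => ->; rewrite orbT.
    - by exists c; rewrite // inE hc orbT.
  have [|||E [olE eqE eE keep]] := IH _ _ ol2.
  - by move: sz; rewrite (perm_size pe) /=; apply: leq_trans.
  - by apply: keepv vA; rewrite eq_sym.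
  - by apply: keepv vB; rewrite eq_sym.
  exists E; split=> //; first exact: equi_trans eq2 eqE.
  have bZ : strictly_between A B Z by exists s.
  move=> c; rewrite (perm_mem pe) !inE => /or3P[/eqP->|/eqP->|hc] nc.
  - by case: (nc Z); rewrite // !inE eqxx orbT.
  - by case: (nc Z); rewrite // !inE eqxx.
  - by apply: keep => //; rewrite inE hc orbT.
have [ea'|ea'] := ends_pair ea era ZP; have [eb'|eb'] := ends_pair eb erb ZQ.
- have e : a = b by apply: (start_inj ol) => //; rewrite ea' eb'.
  by case/eqP: PQ; move: (congr1 (fun a => a.2.2) e); rewrite ea' eb'.
- apply: (merge a.1 (point_at A B rb) (point_at A B ra) (1 - w)).
  + by rewrite eq_sym.
  + by have [w0 w1] := andP hw; lra.
  + by rewrite -point_at_flip.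
  + by rewrite lab -eb'.
  + by rewrite -ea'.
- apply: (merge a.1 (point_at A B ra) (point_at A B rb) w) => //; [by rewrite -ea'|by rewrite lab -eb'].
- have e : a = b by apply: (end_inj ol) => //; rewrite ea' eb'.
  by case/eqP: PQ; move: (congr1 (fun a => a.2.1) e); rewrite ea' eb'.
Qed.

End Straightening.

(** * Invariance of the linking sum under link equivalence *)

Section Invariance.
Local Open Scope classical_set_scope.
Local Open Scope ring_scope.
Variable R : realType.
Local Notation point := 'rV[R]_3.
Local Notation ledge := (nat * (point * point))%type.
Implicit Types (A B C P Q X Y Z : point) (t s u v : R) (a b c : ledge) (D E : seq ledge).
Implicit Types (K : set point) (i : nat).

(** Some orientation and some partition into sublinks give the value x.  This existential form makes it
    unnecessary to compare different systems of edges for the same point set. *)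
Definition has_linking (x : R) K : Prop :=
  exists2 D, oriented_link D K & for_small (fun t => linking t D = x).

Lemma has_linking_equi x D E K : oriented_link E K -> equi D E ->
  for_small (fun t => linking t D = x) -> has_linking x K.
Proof. by move=> ol h1 h2; exists E => //; apply: (for_smallW (for_smallI h1 h2)) => t [<-]. Qed.

Lemma equi_flip D : equi D (map (@flip R) D).
Proof. by apply: for_smallT => t; rewrite linking_flip. Qed.

(** AB is first made an edge; it can be taken to be oriented from A to B, as all orientations may be
    reversed together. *)
Lemma delta_linking x K K' : delta_move K K' -> has_linking x K -> has_linking x K'.
Proof.
move=> [_ _ [A [B [C [/affinely_independentP ind KT K'E]]]]] [D ol lk].
have [AB AC CB] := independent_neq ind.
have sub : segment A B `<=` K by move=> X; rewrite -KT => -[].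
have [D1 [ol1 eq1 vA _ _]] := make_vertex ol (sub _ (segment_l A B)).
have [D2 [ol2 eq2 vB keepv _]] := make_vertex ol1 (sub _ (segment_r A B)).
have [D3 [ol3 eq3 [i hi] _]] := straighten ol2 AB sub (keepv _ vA) vB.
have eqD := equi_trans eq1 (equi_trans eq2 eq3).
have [D4 [ol4 eq4 h4]] : exists D4, [/\ oriented_link D4 K, equi D D4 & (i, (A, B)) \in D4].
  move: hi => /orP[h|h]; first by exists D3.
  exists (map (@flip R) D3); split.
  - exact: oriented_link_flip.
  - exact: equi_trans eqD (equi_flip _).
  - by rewrite -[(i, (A, B))]/(flip (i, (B, A))) map_f.
have pe := perm_to_rem h4; have ol5 := oriented_link_perm pe ol4.
apply: (has_linking_equi (D := D) (oriented_link_delta ind KT K'E ol5)) => //.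
apply: (equi_trans eq4); apply: (equi_trans (equi_perm pe)).
apply: for_small_linking_triangle ol5 _ _; first exact: independent_not_collinear.
by move=> X h1 h2; rewrite -KT.
Qed.

(** AC is made an edge first; making CB an edge afterwards leaves it alone, since A and C are not
    strictly between C and B. *)
Lemma delta_linkingV x K K' : delta_move K K' -> has_linking x K' -> has_linking x K.
Proof.
move=> [_ _ [A [B [C [/affinely_independentP ind KT K'E]]]]] [D ol lk].
have [AB AC CB] := independent_neq ind.
have subAC : segment A C `<=` K' by move=> X h; rewrite K'E; right; left.
have subCB : segment C B `<=` K' by move=> X h; rewrite K'E; right; right.
have [D1 [ol1 eq1 vA _ _]] := make_vertex ol (subAC _ (segment_l A C)).
have [D2 [ol2 eq2 vC keepv _]] := make_vertex ol1 (subAC _ (segment_r A C)).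
have [D3 [ol3 eq3 [i hi] _]] := straighten ol2 AC subAC (keepv _ vA) vC.
have nB : ~ segment A C B.
  move=> h; have /eqP := cap_AB_AC ind (segment_r A B) h.
  by rewrite eq_sym (negPf AB).
have nA : ~ segment C B A.
  move=> h; have /eqP := cap_AB_CB ind (segment_l A B) h.
  by rewrite (negPf AB).
have intB P Q : segment P Q = segment A C -> ~ interior (i, (P, Q)) B.
  by move=> e [s hs eB]; apply: nB; rewrite -e; apply/segmentP; exists s; [lra|].
have [D4 [ol4 eq4 vB keepv4 keep4]] := make_vertex ol3 (subCB _ (segment_r C B)).
have hi4 : ((i, (A, C)) \in D4) || ((i, (C, A)) \in D4).
  move: hi => /orP[h|h]; apply/orP; [left|right]; apply: keep4 => //; apply: intB => //.
  exact: segmentC.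
have vC4 : vertex D4 C.
  by move: hi4 => /orP[] h; [exists (i, (A, C))|exists (i, (C, A))]; rewrite // !inE eqxx ?orbT.
have [D5 [ol5 eq5 [j hj] keep5]] := straighten ol4 CB subCB vC4 vB.
have notbetween Z : Z \in [:: A; C] -> ~ strictly_between C B Z.
  move=> hZ [s hs eZ]; move: hZ; rewrite !inE => /orP[/eqP e|/eqP e].
    by apply: nA; rewrite -e eZ; apply/segmentP; exists s => //; lra.
  by move: eZ; rewrite e => /esym/(point_at_eql CB); lra.
have hi5 : ((i, (A, C)) \in D5) || ((i, (C, A)) \in D5).
  move: hi4 => /orP[h|h]; apply/orP; [left|right]; apply: keep5 => //.
  by move=> Z; rewrite !inE orbC => h'; apply: notbetween; rewrite !inE.
have eqD := equi_trans eq1 (equi_trans eq2 (equi_trans eq3 (equi_trans eq4 eq5))).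
have [D6 [ol6 eq6 hi6 hj6]] : exists D6, [/\ oriented_link D6 K', equi D D6,
    (i, (A, C)) \in D6 & ((j, (C, B)) \in D6) || ((j, (B, C)) \in D6)].
  move: hi5 => /orP[h|h]; first by exists D5.
  exists (map (@flip R) D5); split.
  - exact: oriented_link_flip.
  - exact: equi_trans eqD (equi_flip _).
  - by rewrite -[(i, (A, C))]/(flip (i, (C, A))) map_f.
  - move: hj => /orP[h'|h']; apply/orP; [right|left].
    + by rewrite -[(j, (B, C))]/(flip (j, (C, B))) map_f.
    + by rewrite -[(j, (C, B))]/(flip (j, (B, C))) map_f.
have hj7 : (j, (C, B)) \in D6.
  move: hj6 => /orP[//|h].
  have := end_inj ol6 hi6 h erefl => -[_ e]; move: AB; rewrite e eqxx //.
have ij : i = j.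
  by apply: (same_label ol6 hi6 hj7 (X := C)); rewrite !inE eqxx ?orbT.
subst j; have pe1 := perm_to_rem hi6; set D7 := rem _ _ in pe1.
have hj8 : (i, (C, B)) \in D7.
  by move: hj7; rewrite (perm_mem pe1) inE => /predU1P[[e _]|//]; move: AC; rewrite e eqxx.
have pe : perm_eq D6 [:: (i, (A, C)), (i, (C, B)) & rem (i, (C, B)) D7].
  by apply: (perm_trans pe1); rewrite perm_cons; apply: perm_to_rem.
have ol8 := oriented_link_deltaV ind KT K'E (oriented_link_perm pe ol6).
apply: (has_linking_equi (D := D) ol8) => //.
apply: (equi_trans eq6); apply: (equi_trans (equi_perm pe)); apply: equi_sym.
apply: for_small_linking_triangle ol8 _ _; first exact: independent_not_collinear.
by move=> X h1 h2; rewrite -KT.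
Qed.

Lemma link_equiv_linking x K K' : link_equiv K K' -> has_linking x K' -> has_linking x K.
Proof.
move=> [_ _ h]; suff : has_linking x K <-> has_linking x K' by case.
elim: h => {K K'} [K K' h|K|K K' _ ->|K K' K'' _ -> _ ->] //.
by split; [exact: delta_linking|exact: delta_linkingV].
Qed.

End Invariance.

(** * Crossings of a mosaic bound the linking sum *)

Section CrossingPoints.
Local Open Scope classical_set_scope.
Local Open Scope ring_scope.
Variable R : realType.
Local Notation point := 'rV[R]_3.
Local Notation ledge := (nat * (point * point))%type.
Implicit Types (A B C P Q X Y Z p q : point) (t s u v : R) (a b : ledge) (c : corner) (D E : seq ledge).
Implicit Types (K : set point) (i j : nat) (g : curve).

Definition corner_pt i j (c : corner) : point := lattice_pt R (lattice_corner i j c).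

(** The point at which the polygonal arc representing a curve is bent. *)
Definition apex i j g : point :=
  4^-1 *: (corner_pt i j g.1.1 + corner_pt i j g.1.2)
  + 2^-1 *: pt (j%:R + 2^-1) (- (i%:R + 2^-1)) 0 + pt 0 0 (g.2 : nat)%:R.

(** Both halves of a curve run from a corner to the apex. *)
Lemma draw_curveP i j g p : draw_curve i j g p <->
  exists2 c, c \in [:: g.1.1; g.1.2] & segment (corner_pt i j c) (apex i j g) p.
Proof.
split=> [[h|h]|[c]].
- by exists g.1.1; rewrite // inE eqxx.
- by exists g.1.2; rewrite ?inE ?eqxx ?orbT // segmentC.
by rewrite !inE => /orP[]/eqP-> h; [left|right; rewrite segmentC].
Qed.

Lemma corner_ptE i j c : ((cx (corner_pt i j c) = j%:R + (c.2 : nat)%:R)%R *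
  (cy (corner_pt i j c) = - (i%:R + (c.1 : nat)%:R))%R * (cz (corner_pt i j c) = 0)%R)%type.
Proof. by rewrite /corner_pt /lattice_pt /lattice_corner !coordE !natrD. Qed.

Lemma apexE i j g : ((cx (apex i j g) = j%:R + 4^-1 + 4^-1 * ((g.1.1.2 : nat)%:R + (g.1.2.2 : nat)%:R))%R *
  (cy (apex i j g) = - (i%:R + 4^-1 + 4^-1 * ((g.1.1.1 : nat)%:R + (g.1.2.1 : nat)%:R)))%R *
  (cz (apex i j g) = (g.2 : nat)%:R)%R)%type.
Proof. by rewrite /apex !(coordE, corner_ptE); do !split; field. Qed.

(** Coordinates of the projection of p relative to the top left corner of tile (i, j), downwards for
    tile_y. *)
Definition tile_x t j p := shear_x t p - j%:R.
Definition tile_y t i p := - shear_y t p - i%:R.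

Lemma tile_x_at t j P Q s : tile_x t j (point_at P Q s) = (1 - s) * tile_x t j P + s * tile_x t j Q.
Proof. by rewrite /tile_x /shear_x !point_at_E; ring. Qed.

Lemma tile_y_at t i P Q s : tile_y t i (point_at P Q s) = (1 - s) * tile_y t i P + s * tile_y t i Q.
Proof. by rewrite /tile_y /shear_y !point_at_E; ring. Qed.

Lemma tile_xy_corner t i j c :
  ((tile_x t j (corner_pt i j c) = (c.2 : nat)%:R) * (tile_y t i (corner_pt i j c) = (c.1 : nat)%:R))%type.
Proof. by rewrite /tile_x /tile_y /shear_x /shear_y !corner_ptE; split; ring. Qed.

Lemma tile_xy_apex t i j g :
  ((tile_x t j (apex i j g) = 4^-1 + 4^-1 * ((g.1.1.2 : nat)%:R + (g.1.2.2 : nat)%:R) - t * (g.2 : nat)%:R)%R *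
   (tile_y t i (apex i j g) = 4^-1 + 4^-1 * ((g.1.1.1 : nat)%:R + (g.1.2.1 : nat)%:R) + t ^+ 2 * (g.2 : nat)%:R)%R)%type.
Proof. by rewrite /tile_x /tile_y /shear_x /shear_y !apexE; split; ring. Qed.

Lemma apex_open t i j g (T : tile) : 0 < t < 2^-1 -> g \in curves T ->
  (0 < tile_x t j (apex i j g) < 1) && (0 < tile_y t i (apex i j g) < 1).
Proof.
move=> /andP[t0 t1] hg; rewrite !tile_xy_apex.
have t2 : 0 < t ^+ 2 by rewrite exprn_gt0.
have t3 : t ^+ 2 < 2^-1 by nra.
by case: T hg => //=; rewrite ?inE;
  try (move=> /orP[]); move=> /eqP-> /=; apply/andP; split; lra.
Qed.

Definition in_tile t i j p := (0 < tile_x t j p < 1) && (0 < tile_y t i p < 1).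

(** The projection moves the raised apexes by less than half of a tile, so the projected curves stay
    inside their tiles and touch the boundary only at their end points. *)
Lemma curve_in_tile t i j g c (T : tile) p : 0 < t < 2^-1 -> g \in curves T ->
  segment (corner_pt i j c) (apex i j g) p -> p = corner_pt i j c \/ in_tile t i j p.
Proof.
move=> ht hg /segmentP[s /andP[s0 s1] ->].
have [->|sn] := eqVneq s 0; [left; exact: point_at_0|right].
have {s0} s0 : 0 < s by rewrite lt_neqAle eq_sym sn.
have /andP[/andP[x0 x1] /andP[y0 y1]] := apex_open i j ht hg.
have c01 (e : bool) x : 0 < x -> x < 1 -> 0 < (1 - s) * (e : nat)%:R + s * x < 1.
  by case: e => /= h1 h2; apply/andP; split; nra.
by rewrite /in_tile tile_x_at tile_y_at !tile_xy_corner !c01.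
Qed.

Lemma nat_floor (m n : nat) (x : R) : 0 < x - m%:R < 1 -> 0 < x - n%:R < 1 -> m = n.
Proof.
move=> /andP[a b] /andP[c d].
have : (m%:R : R) < n.+1%:R by rewrite -addn1 natrD; lra.
have : (n%:R : R) < m.+1%:R by rewrite -addn1 natrD; lra.
by rewrite !ltr_nat; lia.
Qed.

Lemma nat_not_open (m n : nat) : 0 < (n%:R : R) - m%:R < 1 -> False.
Proof.
move=> /andP[a b].
have : (m%:R : R) < n%:R by lra.
have : (n%:R : R) < m.+1%:R by rewrite -addn1 natrD; lra.
by rewrite !ltr_nat; lia.
Qed.

Lemma in_tile_inj t i j i' j' p q : shear_x t p = shear_x t q -> shear_y t p = shear_y t q ->
  in_tile t i j p -> in_tile t i' j' q -> i = i' /\ j = j'.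
Proof.
move=> ex ey /andP[x1 y1] /andP[x2 y2]; rewrite /tile_x /tile_y ex ey in x1 y1.
by split; [apply: nat_floor y1 y2|apply: nat_floor x1 x2].
Qed.

Lemma corner_not_in_tile t i j i' j' c p : shear_x t p = shear_x t (corner_pt i j c) ->
  in_tile t i' j' p -> False.
Proof.
move=> e /andP[h _]; move: h; rewrite /tile_x e /shear_x !corner_ptE mulr0 subr0 -natrD.
exact: nat_not_open.
Qed.

Definition crossing_tile (T : tile) : bool :=
  match T with T9 | T10 => true | _ => false end.

(** The over-strand (o true) and the under-strand of a crossing tile. *)
Definition strand (o : bool) (T : tile) : curve :=
  match T with
  | T9 => if o then (TL, BR, true) else (TR, BL, false)
  | _ => if o then (TR, BL, true) else (TL, BR, false)
  end.

(** Constant along the under-strand and strictly monotone along the projected over-strand, so that the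
    two cross only once. *)
Definition across t i j (T : tile) p : R :=
  match T with T9 => tile_x t j p + tile_y t i p | _ => tile_y t i p - tile_x t j p end.

Lemma over_across t i j T p q : crossing_tile T -> 0 < t < 2^-1 ->
  draw_curve i j (strand true T) p -> draw_curve i j (strand true T) q ->
  across t i j T p = across t i j T q -> p = q.
Proof.
move=> hT /andP[t0 t1] /draw_curveP[c hc /segmentP[s /andP[s0 s1] ->]].
move=> /draw_curveP[c' hc' /segmentP[s' /andP[s0' s1'] ->]].
have t2 : 0 < t ^+ 2 by rewrite exprn_gt0.
have t3 : t ^+ 2 < t by nra.
have same (k : R) : 0 < k -> k * s = k * s' -> s = s'.
  by move=> k0; apply: mulfI; rewrite gt_eqF.
have opp (k k' : R) : 0 < k -> 0 < k' -> k * (1 - s) + k' * (1 - s') = 0 -> s = 1 /\ s' = 1.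
  move=> k0 k0' e; have h1 : 0 <= k * (1 - s) by rewrite mulr_ge0 //; lra.
  have h2 : 0 <= k' * (1 - s') by rewrite mulr_ge0 //; lra.
  have /eqP : k * (1 - s) = 0 by lra.
  have /eqP : k' * (1 - s') = 0 by lra.
  by rewrite !mulf_eq0 (gt_eqF k0) (gt_eqF k0') /= !subr_eq0 => /eqP <- /eqP <-.
case: T hT hc hc' => // _; rewrite !inE => /orP[]/eqP-> /orP[]/eqP->;
  rewrite /across !tile_x_at !tile_y_at !tile_xy_corner !tile_xy_apex /= => e.
- by rewrite (same (1 - t + t ^+ 2)) //; lra.
- by have [|||-> ->] := opp (1 - t + t ^+ 2) (1 + t - t ^+ 2); rewrite ?point_at_1 //; lra.
- by have [|||-> ->] := opp (1 + t - t ^+ 2) (1 - t + t ^+ 2); rewrite ?point_at_1 //; lra.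
- by rewrite (same (1 + t - t ^+ 2)) //; lra.
- by rewrite (same (1 + t + t ^+ 2)) //; lra.
- by have [|||-> ->] := opp (1 + t + t ^+ 2) (1 - t - t ^+ 2); rewrite ?point_at_1 //; lra.
- by have [|||-> ->] := opp (1 - t - t ^+ 2) (1 + t + t ^+ 2); rewrite ?point_at_1 //; lra.
- by rewrite (same (1 - t - t ^+ 2)) //; lra.
Qed.

Lemma under_across t i j T p : crossing_tile T -> draw_curve i j (strand false T) p ->
  across t i j T p = match T with T9 => 1 | _ => 0 end.
Proof.
move=> hT /draw_curveP[c hc /segmentP[s _ ->]].
by case: T hT hc => // _; rewrite !inE => /orP[]/eqP->;
  rewrite /across !tile_x_at !tile_y_at !tile_xy_corner !tile_xy_apex /=; field.
Qed.

Lemma flat_z i j g p : g.2 = false -> draw_curve i j g p -> cz p = 0.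
Proof.
move=> g2 /draw_curveP[c _ /segmentP[s _ ->]].
by rewrite point_at_E corner_ptE apexE g2 /=; ring.
Qed.

Lemma over_strand T g : g \in curves T -> g.2 -> crossing_tile T /\ g = strand true T.
Proof. by case: T => //=; rewrite !inE; try (move=> /orP[]); move=> /eqP->. Qed.

Lemma under_strand T g : g \in curves T -> ~~ g.2 -> crossing_tile T -> g = strand false T.
Proof. by case: T => //=; rewrite !inE => /orP[]/eqP->. Qed.

(** The points p and q project to the crossing of the tile z.1; p is on the over-strand if z.2. *)
Definition crossing_at t n (M : mosaic n) (z : 'I_n * 'I_n * bool) p q : Prop :=
  let T := M z.1.1 z.1.2 in
  [/\ crossing_tile T, draw_curve z.1.1 z.1.2 (strand z.2 T) p,
      draw_curve z.1.1 z.1.2 (strand (~~ z.2) T) q, shear_x t p = shear_x t q & shear_y t p = shear_y t q].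

Lemma crossing_at_inj t n (M : mosaic n) z p q p' q' : 0 < t < 2^-1 ->
  crossing_at t M z p q -> crossing_at t M z p' q' -> p = p' /\ q = q'.
Proof.
case: z => [[i j] o] ht [/= hT hp hq ex ey] [_ hp' hq' ex' ey'].
have acr X Y : shear_x t X = shear_x t Y -> shear_y t X = shear_y t Y ->
    across t i j (M i j) X = across t i j (M i j) Y.
  by rewrite /across /tile_x /tile_y => -> ->.
have flat X Y : draw_curve i j (strand false (M i j)) X ->
    draw_curve i j (strand false (M i j)) Y -> shear_x t X = shear_x t Y -> shear_y t X = shear_y t Y -> X = Y.
  have s2 : (strand false (M i j)).2 = false by case: (M i j).
  move=> /(flat_z s2) zX /(flat_z s2) zY; rewrite /shear_x /shear_y zX zY !mulr0 !subr0 => h1 h2.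
  by apply: point_ext; rewrite // zX zY.
case: o hp hq hp' hq' => /= hp hq hp' hq'.
  have e : p = p'.
    apply: (over_across hT ht hp hp').
    by rewrite (acr _ _ ex ey) (acr _ _ ex' ey') !(under_across t hT).
  by split=> //; apply: flat => //; rewrite -?ex -?ey e.
have e : q = q'.
  apply: (over_across hT ht hq hq').
  by rewrite -(acr _ _ ex ey) -(acr _ _ ex' ey') !(under_across t hT).
by split=> //; apply: flat => //; rewrite ?ex ?ey e.
Qed.

(** Points of the link with the same projection lie in one tile; all curves but over-strands are flat,
    and an over-strand projects injectively. *)
Lemma crossing_at_ex t n (M : mosaic n) p q : 0 < t < 2^-1 -> p != q ->
  @mosaic_link R n M p -> @mosaic_link R n M q -> shear_x t p = shear_x t q -> shear_y t p = shear_y t q ->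
  exists z, crossing_at t M z p q.
Proof.
move=> ht pq [i [j [g [hg hp]]]] [i' [j' [g' [hg' hq]]]] ex ey.
have [c hc sp] := (draw_curveP _ _ _ _).1 hp.
have [c' hc' sq] := (draw_curveP _ _ _ _).1 hq.
have [pc|pin] := curve_in_tile ht hg sp; have [qc|qin] := curve_in_tile ht hg' sq.
- case/eqP: pq; move: ex ey; rewrite pc qc /shear_x /shear_y !corner_ptE !mulr0 !subr0 => ex ey.
  by apply: point_ext; rewrite !corner_ptE.
- by case: (@corner_not_in_tile t i j i' j' c q); rewrite -?pc.
- by case: (@corner_not_in_tile t i' j' i j c' p); rewrite -?qc.
have [/val_inj ei /val_inj ej] := in_tile_inj ex ey pin qin.
subst i' j'.
have [g2|g2] := boolP g.2; have [g2'|g2'] := boolP g'.2.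
- have [hT eg] := over_strand hg g2; have [_ eg'] := over_strand hg' g2'.
  case/eqP: pq; rewrite eg in hp; rewrite eg' in hq; apply: (over_across hT ht hp hq).
  by rewrite /across /tile_x /tile_y ex ey.
- have [hT eg] := over_strand hg g2; have eg' := under_strand hg' g2' hT.
  by exists (i, j, true); split=> //=; rewrite -?eg -?eg'.
- have [hT eg] := over_strand hg' g2'; have eg' := under_strand hg g2 hT.
  by exists (i, j, false); split=> //=; rewrite -?eg -?eg'.
- have zp := flat_z (negPf g2) hp; have zq := flat_z (negPf g2') hq.
  case/eqP: pq; move: ex ey; rewrite /shear_x /shear_y zp zq !mulr0 !subr0 => ex ey.
  by apply: point_ext; rewrite // zp zq.
Qed.

(** Cramer's rule. *)
Lemma crosses_point t P Q A B : crosses t (P, Q) (A, B) ->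
  exists s u, [/\ 0 < s < 1, 0 < u < 1, shear_x t (point_at P Q s) = shear_x t (point_at A B u)
    & shear_y t (point_at P Q s) = shear_y t (point_at A B u)].
Proof.
move=> /andP[/=]; set c := orient t P Q A; set d := orient t P Q B.
set a := orient t A B P; set b := orient t A B Q => cd ab.
have frac (x y : R) : x * y < 0 -> x - y != 0 /\ 0 < x / (x - y) < 1.
  move=> xy; have [x0|x0|x0] := ltgtP x 0.
  - have y0 : 0 < y by rewrite -(nmulr_rlt0 _ x0).
    have h : x - y < 0 by lra.
    by split; [rewrite lt_eqF|rewrite ltr_ndivlMr // ltr_ndivrMr //; lra].
  - have y0 : y < 0 by rewrite -(pmulr_rlt0 _ x0).
    have h : 0 < x - y by lra.
    by split; [rewrite gt_eqF|rewrite ltr_pdivlMr // ltr_pdivrMr //; lra].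
  - by move: xy; rewrite x0 mul0r ltxx.
have [ab0 hs] := frac _ _ ab; have [cd0 hu] := frac _ _ cd.
exists (a / (a - b)), (c / (c - d)).
have e : c - d = - (a - b) by rewrite /a /b /c /d /orient; ring.
split=> //; rewrite {hu} e invrN mulrN.
  apply: (mulfI ab0); rewrite [LHS](_ : _ = (a - b) * shear_x t P + a * (shear_x t Q - shear_x t P)).
    rewrite [RHS](_ : _ = (a - b) * shear_x t A - c * (shear_x t B - shear_x t A)).
      by rewrite /a /b /c /orient; ring.
    by rewrite /shear_x !point_at_E; field.
  by rewrite /shear_x !point_at_E; field.
apply: (mulfI ab0); rewrite [LHS](_ : _ = (a - b) * shear_y t P + a * (shear_y t Q - shear_y t P)).
  rewrite [RHS](_ : _ = (a - b) * shear_y t A - c * (shear_y t B - shear_y t A)).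
    by rewrite /a /b /c /orient; ring.
  by rewrite /shear_y !point_at_E; field.
by rewrite /shear_y !point_at_E; field.
Qed.

Lemma size_relation (T : eqType) (F : finType) (r : T -> F -> Prop) (S : seq T) (V : {set F}) :
  uniq S -> (forall x, x \in S -> exists2 z, z \in V & r x z) ->
  (forall x y z, x \in S -> y \in S -> r x z -> r y z -> x = y) -> (size S <= #|V|)%N.
Proof.
elim: S V => // x S IH V /= /andP[xS uS] ex inj.
have [z zV rz] := ex x (mem_head _ _).
rewrite (cardsD1 z) zV add1n ltnS; apply: IH => // [y yS|y y' z' yS yS'].
  have [z' zV' rz'] := ex y (mem_behead (s := x :: S) yS).
  exists z' => //; rewrite !inE zV' andbT; apply: contraNneq xS => ez.
  rewrite (inj x y z) ?mem_head ?inE ?yS ?orbT //.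
  by rewrite -ez.
by apply: inj; rewrite inE ?yS ?yS' orbT.
Qed.

(** Every crossing of projected edges with different labels lies over the crossing point of a tile.  The
    tile and the information which edge is above determine the points of the link, which are
    interior to the edges and hence determine the edges. *)
Lemma linking_bound n (M : mosaic n) D : oriented_link D (@mosaic_link R n M) ->
  for_small (fun t => `|linking t D| <= (2 * #|[set z : 'I_n * 'I_n | crossing_tile (M z.1 z.2)]%SET|)%N%:R).
Proof.
move=> ol; have t12 : 0 < 2^-1 :> R by rewrite invr_gt0.
apply: (for_smallW (for_small_lt t12)) => t ht.
pose cond (x : ledge * ledge) := (x.1.1 != x.2.1) && crosses t x.1.2 x.2.2.
pose S := [seq x <- [seq (a, b) | a <- D, b <- D] | cond x].
have uD : uniq D by case: ol => v1 _ _ _ _; apply: map_uniq v1.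
have uS : uniq S by apply: filter_uniq; apply: allpairs_uniq => // -[? ?] [? ?] _ _ [-> ->].
apply: (@le_trans _ _ (size S)%:R).
  have -> : linking t D = \sum_(x <- [seq (a, b) | a <- D, b <- D]) weight t x.1 x.2.
    by rewrite big_allpairs.
  rewrite size_filter -sum1_count natr_sum [leRHS]big_mkcond.
  apply: (le_trans (ler_norm_sum _ _ _)); apply: ler_sum => x _.
  rewrite /weight /cond; case: eqP => _ /=; first by rewrite normr0.
  rewrite normrM normrX normrN1 expr1n mul1r /csign; case: ifP => _; last by rewrite normr0.
  by rewrite normr_sg; case: (_ != 0); rewrite ?lexx ?ler01.
rewrite ler_nat.
set V := [set z | _]%SET.
have -> : (2 * #|V| = #|finset.setX V [set: bool]|)%N by rewrite cardsX cardsT card_bool mulnC.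
pose r (x : ledge * ledge) (z : 'I_n * 'I_n * bool) :=
  exists p q, [/\ interior x.1 p, interior x.2 q & crossing_at t M z p q].
have memS x : x \in S -> [/\ x.1 \in D, x.2 \in D & cond x].
  by rewrite mem_filter => /andP[h /allpairsP[[a b] [/= ha hb e]]]; move: h; rewrite e.
have int_seg a p : interior a p -> seg a p.
  by move=> [s hs ->]; apply/segmentP; exists s => //; lra.
apply: (size_relation (r := r)) => // [x xS|x y z xS yS].
  have [h1 h2 /andP[lab cr]] := memS x xS.
  move: cr; rewrite [x.1.2]surjective_pairing [x.2.2]surjective_pairing.
  move=> /crosses_point[s [u [hs hu ex ey]]].
  set p := point_at _ _ s in ex ey; set q := point_at _ _ u in ex ey.
  have ip : interior x.1 p by exists s.
  have iq : interior x.2 q by exists u.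
  have pq : p != q.
    apply/eqP => e; apply: (seg_disjoint ol h1 h2 lab (int_seg _ _ ip)).
    by rewrite e; apply: int_seg.
  have Kp := seg_sub ol h1 (int_seg _ _ ip); have Kq := seg_sub ol h2 (int_seg _ _ iq).
  have [z hz] := crossing_at_ex ht pq Kp Kq ex ey.
  exists z; last by exists p, q.
  by rewrite !inE andbT; case: hz.
move=> [p [q [ip iq hz]]] [p' [q' [ip' iq' hz']]].
have [ep eq] := crossing_at_inj ht hz hz'; subst p' q'.
have [x1 x2 _] := memS x xS; have [y1 y2 _] := memS y yS.
have same a b X : a \in D -> b \in D -> interior a X -> interior b X -> a = b.
  move=> ha hb ia ib; apply/eqP/negPn/negP => ab.
  have [e _] := seg_meet ol ha hb ab (int_seg _ _ ia) (int_seg _ _ ib).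
  by move: (interior_ends ol ha ia); rewrite e.
rewrite [x]surjective_pairing [y]surjective_pairing; congr (_, _).
- exact: same ip ip'.
- exact: same iq iq'.
Qed.

End CrossingPoints.

(** * Counting the connection points of a mosaic *)

Section CrossingCount.

Lemma connection_touch n (M : mosaic n) (u : 'I_n * 'I_n) (p : nat * nat) :
  p \in connection_points M u ->
  [&& u.1 <= p.1 <= u.1.+1 & u.2 <= p.2 <= u.2.+1]%N.
Proof.
by move=> /mapP[[[] []] _ ->] /=; lia.
Qed.

Lemma connection_pair n (M : mosaic n) (p : nat * nat) : suitably_connected M ->
  (#|[set u | p \in connection_points M u]%SET| <= 2)%N.
Proof.
move=> sc; set V := [set u | _]%SET.
have [->|[t tV]] := set_0Vmem V; first by rewrite cards0.
have tp : p \in connection_points M t by rewrite inE in tV.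
rewrite (cardsD1 t) tV add1n ltnS -(sc t p tp) subset_leq_card //.
by apply/fintype.subsetP => u; rewrite !inE.
Qed.

(** A corner of the array touches only one tile. *)
Lemma connection_corner n (M : mosaic n) (p : nat * nat) u : suitably_connected M ->
  p.1 \in [:: 0; n]%N -> p.2 \in [:: 0; n]%N -> p \notin connection_points M u.
Proof.
move=> sc h1 h2; apply/negP => hu; have := sc u p hu.
apply/eqP; rewrite (_ : [set _ | _]%SET = finset.set0) ?cards0 //.
apply/setP => v; rewrite !inE; apply/negP => /andP[vu hv].
case/eqP: vu; move: (connection_touch hu) (connection_touch hv) h1 h2.
case: u v p {hu hv} => [u1 u2] [v1 v2] [p1 p2] /=; rewrite !inE => h1 h2 h3 h4.
have l1 := ltn_ord u1; have l2 := ltn_ord u2; have l3 := ltn_ord v1; have l4 := ltn_ord v2.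
congr (_, _); apply/val_inj => /=; lia.
Qed.

(** Double counting of the incidences between crossing tiles and lattice points: a crossing tile has
    four connection points, a lattice point belongs to at most two tiles, and the four corners of
    the array are connection points of none. *)
Lemma crossing_count n (M : mosaic n) : (0 < n)%N -> suitably_connected M ->
  (2 * #|[set z : 'I_n * 'I_n | crossing_tile (M z.1 z.2)]%SET| + 4 <= n.+1 ^ 2)%N.
Proof.
move=> n0 sc; set V := [set z | _]%SET.
pose Q := finset.setX [set ord0; @ord_max n]%SET [set ord0; @ord_max n]%SET.
have cQ : #|Q| = 4%N.
  by rewrite cardsX cards2 (_ : _ != _) // -val_eqE /= eq_sym -lt0n.
have mQ (p : 'I_n.+1 * 'I_n.+1) :
    (p \in Q) = ((p.1 : nat) \in [:: 0; n]%N) && ((p.2 : nat) \in [:: 0; n]%N).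
  by rewrite !inE -!val_eqE.
pose pp (p : 'I_n.+1 * 'I_n.+1) : nat * nat := (p.1 : nat, p.2 : nat).
have h4 (u : 'I_n * 'I_n) : u \in V -> (4 <= \sum_p (pp p \in connection_points M u))%N.
  rewrite inE => hu.
  pose f (c : corner) : 'I_n.+1 * 'I_n.+1 := (inord (u.1 + c.1), inord (u.2 + c.2)).
  have fE c : pp (f c) = lattice_corner u.1 u.2 c.
    have [l1 l2] := (ltn_ord u.1, ltn_ord u.2).
    by rewrite /pp /f /= !inordK // ltnS; case: c => -[] []; rewrite ?addn0 ?addn1 // ltnW.
  have finj : injective f.
    move=> [c1 c2] [d1 d2] /(congr1 pp); rewrite !fE => -[].
    by case: c1; case: c2; case: d1; case: d2 => //=; lia.
  pose s := [seq f c | c <- [:: TL; TR; BL; BR]].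
  have us : uniq s by rewrite map_inj_uniq.
  have -> : 4%N = #|s| by rewrite (card_uniqP us).
  rewrite -sum1_card big_mkcond /=; apply: leq_sum => p _.
  case: ifP => // /mapP[c hc ->]; rewrite fE map_f //.
  by move: hu hc; case: (M u.1 u.2) => //= _; rewrite !inE; case: c => -[] [].
have : (\sum_(u in V) 4 <= \sum_(p in ~: Q) 2)%N.
  apply: (@leq_trans (\sum_(u in V) \sum_p (pp p \in connection_points M u))).
    exact: leq_sum.
  rewrite exchange_big /= [leqRHS]big_mkcond /=; apply: leq_sum => p _.
  rewrite inE mQ; case: ifP => h.
    rewrite -big_mkcondr sum1_card; apply: leq_trans (connection_pair (pp p) sc).
    by apply: subset_leq_card; apply/fintype.subsetP => u; rewrite !inE => /andP[].
  rewrite big1 // => u _; move/negbFE: h => /andP[a b].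
  by rewrite (negPf (connection_corner (p := pp p) u sc a b)).
rewrite !sum_nat_const => H; have := cardsC Q; rewrite cQ card_prod !card_ord; lia.
Qed.

End CrossingCount.

(** * The strands of the mosaic of L_n *)

Section StrandsOfL.
Local Open Scope nat_scope.
Variable n : nat.
Hypothesis n_odd : odd n.
Hypothesis n_ge3 : 3 <= n.

Let on_side (a : nat) := (a == 0) || (a == n).

(** All lattice points but the corners of the array are connection points: every tile with a crossing uses
    its four corners, every other tile those that lie on the boundary of the array. *)
Lemma L_tile_corner i j (c : corner) : i < n -> j < n ->
  (c \in connection_corners (L_tile n i.+1 j.+1)) =
  (odd (i + j) || on_side (i + c.1) || on_side (j + c.2)) && ~~ (on_side (i + c.1) && on_side (j + c.2)).
Proof.
move=> hi hj; rewrite /L_tile /on_side !xpair_eqE.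
case: ifP => h1; first by case: ifP => h2; case: c => -[] [];
  rewrite !inE /TL /TR /BL /BR !xpair_eqE /=; lia.
do ![case: ifP => ?]; case: c => -[] []; rewrite ?inE /TL /TR /BL /BR ?xpair_eqE /=; lia.
Qed.

Lemma L_connection (u : 'I_n * 'I_n) (p : nat * nat) :
  (p \in connection_points (L_mosaic n) u) =
  [&& u.1 <= p.1 <= u.1.+1, u.2 <= p.2 <= u.2.+1, 
    odd (u.1 + u.2) || on_side p.1 || on_side p.2 & ~~ (on_side p.1 && on_side p.2)].
Proof.
have [l1 l2] := (ltn_ord u.1, ltn_ord u.2).
apply/mapP/and4P => [[c + ->]|[h1 h2 h3 h4]].
  rewrite mxE L_tile_corner //= => /andP[h3 h4]; split=> //; case: c {h3 h4} => -[] [] /=; lia.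
have e1 : p.1 = u.1 + (u.1 < p.1) by lia.
have e2 : p.2 = u.2 + (u.2 < p.2) by lia.
exists (u.1 < p.1, u.2 < p.2); first by rewrite mxE L_tile_corner //= -e1 -e2 h3 h4.
by rewrite [LHS]surjective_pairing /lattice_corner /= -e1 -e2.
Qed.

Lemma L_suitably_connected : suitably_connected (L_mosaic n).
Proof.
move=> [i j] [a b]; rewrite L_connection /= => /and4P[h1 h2 h3 h4].
have [l1 l2] := (ltn_ord i, ltn_ord j).
(* The other tile: opposite at an interior point, adjacent at a point of the boundary. *)
pose i' := if on_side a then i : nat else (a + a - i).-1.
pose j' := if on_side b then j : nat else (b + b - j).-1.
have hi' : i' < n by rewrite /i'; case: ifP; rewrite /on_side; lia.
have hj' : j' < n by rewrite /j'; case: ifP; rewrite /on_side; lia.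
rewrite (_ : [set _ | _]%SET = [set (Ordinal hi', Ordinal hj')]%SET) ?cards1 //.
apply/setP => -[x y]; rewrite !inE L_connection !xpair_eqE -!val_eqE /=.
have [l3 l4] := (ltn_ord x, ltn_ord y).
move: h1 h2 h3 h4 hi' hj'; rewrite /i' /j' /on_side {i' j'}.
move: l1 l2 l3 l4; move: (i : nat) (j : nat) (x : nat) (y : nat) => {}i {}j {}x {}y.
by do 2 case: ifP; move=> *; apply/idP/idP; lia.
Qed.

(** The components of L_n are rectangles, with sides parallel to the diagonals, and are oriented
    clockwise.  The function tells for which curves this reverses the listed orientation; for a
    diagonal it depends on the side of the diagonals of the array on which the tile lies. *)
Definition flipped i j (g : curve) : bool :=
  match g.1 with
  | ((false, false), (true, true)) => j <= i
  | ((false, true), (true, false)) => (i + j).+1 < n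
  | ((true, false), (true, true)) => true
  | ((false, false), (true, false)) => true
  | _ => false
  end.

Definition start_corner i j (g : curve) := if flipped i j g then g.1.2 else g.1.1.
Definition end_corner i j (g : curve) := if flipped i j g then g.1.1 else g.1.2.

Definition L_curves : seq (nat * nat * curve) :=
  [seq (u, g) | u <- [seq (i, j) | i <- iota 0 n, j <- iota 0 n],
                g <- curves (L_tile n u.1.+1 u.2.+1)].

Definition start_of (x : nat * nat * curve) :=
  lattice_corner x.1.1 x.1.2 (start_corner x.1.1 x.1.2 x.2).
Definition end_of (x : nat * nat * curve) :=
  lattice_corner x.1.1 x.1.2 (end_corner x.1.1 x.1.2 x.2).

Lemma mem_L_curves i j g : ((i, j, g) \in L_curves) =
  [&& i < n, j < n & g \in curves (L_tile n i.+1 j.+1)].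
Proof.
apply/allpairsPdep/and3P => [[[i' j'] [g' [/allpairsP[[? ?] [/=]]]]]|[hi hj hg]].
  by rewrite !mem_iota /= !add0n => hi hj [-> ->] hg [-> -> ->].
exists (i, j), g; split=> //; apply/allpairsP; exists (i, j).
by rewrite !mem_iota.
Qed.

(** The tile, curve, start and end of the clockwise strands: along the four sides of the
    rectangles, named after the points of the compass, and along the four sides of the array.  The flag of a diagonal is
    true for over-strands. *)
Inductive L_strand i j : curve -> nat * nat -> nat * nat -> Prop :=
| Strand_NE : i < j -> j < n -> odd (i + j) || (i == 0) && (j.+1 == n) ->
    L_strand i j (TL, BR, odd (i + j) && ~~ odd i) (i, j) (i.+1, j.+1)
| Strand_SW : j < i -> i < n -> odd (i + j) || (j == 0) && (i.+1 == n) ->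
    L_strand i j (TL, BR, odd (i + j) && ~~ odd i) (i.+1, j.+1) (i, j)
| Strand_NW : (i + j).+1 < n -> odd (i + j) || (i == 0) && (j == 0) ->
    L_strand i j (TR, BL, odd (i + j) && odd i) (i.+1, j) (i, j.+1)
| Strand_SE : n <= (i + j).+1 -> i < n -> j < n -> odd (i + j) || (i.+1 == n) && (j.+1 == n) ->
    L_strand i j (TR, BL, odd (i + j) && odd i) (i, j.+1) (i.+1, j)
| Strand_T : i = 0 -> ~~ odd j -> 0 < j -> j.+1 < n -> L_strand i j (TL, TR, false) (i, j) (i, j.+1)
| Strand_R : j.+1 = n -> ~~ odd i -> 0 < i -> i.+1 < n -> L_strand i j (TR, BR, false) (i, j.+1) (i.+1, j.+1)
| Strand_B : i.+1 = n -> ~~ odd j -> 0 < j -> j.+1 < n -> L_strand i j (BL, BR, false) (i.+1, j.+1) (i.+1, j)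
| Strand_L : j = 0 -> ~~ odd i -> 0 < i -> i.+1 < n -> L_strand i j (TL, BL, false) (i.+1, j) (i, j).

Lemma L_strandP i j g : (i, j, g) \in L_curves ->
  L_strand i j g (start_of (i, j, g)) (end_of (i, j, g)).
Proof.
rewrite mem_L_curves => /and3P[hi hj]; rewrite /L_tile !xpair_eqE.
have flag (b b' : bool) c c' s f : b = b' -> L_strand i j (c, c', b) s f -> L_strand i j (c, c', b') s f.
  by move=> ->.
case: ifP => h1.
  case: ifP => h2; rewrite !inE => /orP[]/eqP->;
  rewrite /start_of /end_of /start_corner /end_corner /flipped /=; case: ifP => h3;
  rewrite /lattice_corner /= !addn0 !addn1;
  (apply: flag; last by (apply: Strand_NE; lia) || (apply: Strand_SW; lia) || (apply: Strand_NW; lia) || (apply: Strand_SE; lia)); lia.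
do 6 ?[case: ifP => ?]; rewrite ?inE // => /eqP->;
  rewrite /start_of /end_of /start_corner /end_corner /flipped /=; try case: ifP => h3;
  rewrite /lattice_corner /= ?addn0 ?addn1;
  (apply: flag; last by (apply: Strand_NE; lia) || (apply: Strand_SW; lia) || (apply: Strand_NW; lia) || (apply: Strand_SE; lia)
   || (apply: Strand_T; lia) || (apply: Strand_R; lia) || (apply: Strand_B; lia) || (apply: Strand_L; lia)); lia.
Qed.

Lemma L_strandV i j g s f : L_strand i j g s f ->
  [/\ (i, j, g) \in L_curves, start_of (i, j, g) = s & end_of (i, j, g) = f].
Proof.
move=> h; rewrite mem_L_curves; have : i < n /\ j < n by case: h; lia.
move=> [hi hj]; rewrite hi hj /=; split.
- rewrite /L_tile !xpair_eqE.
  case: h => *; (case: ifP => ?; [case: ifP => ?|do 6 ?[case: ifP => ?]]);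
    rewrite ?inE ?xpair_eqE /TL /TR /BL /BR ?xpair_eqE /= ?eqb_id ?eqbF_neg; lia.
- by case: h => *; rewrite /start_of /start_corner /flipped /=; try (case: ifP => ?);
    rewrite /lattice_corner /= ?addn0 ?addn1 //; lia.
- by case: h => *; rewrite /end_of /end_corner /flipped /=; try (case: ifP => ?);
    rewrite /lattice_corner /= ?addn0 ?addn1 //; lia.
Qed.

Lemma L_strand_start i j g s f i' j' g' s' f' :
  L_strand i j g s f -> L_strand i' j' g' s' f' -> s = s' -> (i, j, g) = (i', j', g').
Proof.
have eqf x y x' y' c (b b' : bool) : x = x' -> y = y' -> b = b' ->
  (x, y, (c, b)) = (x', y', (c, b')) by move=> -> -> ->.
by destruct 1; destruct 1; intros [= ? ?];
  first [exfalso; lia | apply: eqf; lia].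
Qed.

Lemma L_strand_end i j g s f i' j' g' s' f' :
  L_strand i j g s f -> L_strand i' j' g' s' f' -> f = f' -> (i, j, g) = (i', j', g').
Proof.
have eqf x y x' y' c (b b' : bool) : x = x' -> y = y' -> b = b' ->
  (x, y, (c, b)) = (x', y', (c, b')) by move=> -> -> ->.
by destruct 1; destruct 1; intros [= ? ?];
  first [exfalso; lia | apply: eqf; lia].
Qed.

(** The number of the rectangle through a lattice point.  On the two sides of rectangle s that run down
    to the right, the difference of the lattice coordinates is 2s + 1 in absolute value; on the
    other two the sum of the coordinates, counted from the nearer corner of the array, is 2s. *)
Definition strand_label (p : nat * nat) : nat :=
  if odd (p.1 + p.2) then ((p.1 - p.2) + (p.2 - p.1))./2
  else if p.1 + p.2 < n then (p.1 + p.2)./2 else (n + n - (p.1 + p.2))./2.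

Lemma strand_label_inv i j g s f : L_strand i j g s f -> strand_label s = strand_label f.
Proof. by case=> *; rewrite /strand_label /=; do !case: ifP => ?; lia. Qed.

(** At each lattice point but the corners of the array exactly one strand leaves.  The cases are the four
    directions, each with the exception that the strand has arrived at a side, or next to a corner,
    of the array. *)
Lemma L_strand_next i j g s f : L_strand i j g s f ->
  exists i' j' g' f', L_strand i' j' g' f f'.
Proof.
move=> h.
have : [&& f.1 <= n, f.2 <= n & ~~ (on_side f.1 && on_side f.2)].
  by rewrite /on_side; case: h => *; rewrite /=; lia.
case: f {h} => a b /= /and3P[an bn]; rewrite /on_side => hc.
have use i0 j0 g0 s0 f0 : L_strand i0 j0 g0 s0 f0 -> s0 = (a, b) ->
    exists i' j' g' f', L_strand i' j' g' (a, b) f'.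
  by move=> h <-; exists i0, j0, g0, f0.
have pe (x y : nat) : x = a -> y = b -> (x, y) = (a, b) by move=> -> ->.
have [o|o] := boolP (odd (a + b)).
  have [ab|ab] := ltnP a b.
    have [bb|bb] := eqVneq b n.
      have [aa|aa] := eqVneq a.+1 n.
        by apply: (use _ _ _ _ _ (@Strand_SE a b.-1 _ _ _ _)); try apply: pe; lia.
      by apply: (use _ _ _ _ _ (@Strand_R a b.-1 _ _ _ _)); try apply: pe; lia.
    by apply: (use _ _ _ _ _ (@Strand_NE a b _ _ _)); try apply: pe; lia.
  have [bb|bb] := eqVneq b 0.
    have [aa|aa] := eqVneq a 1.
      by apply: (use _ _ _ _ _ (@Strand_NW a.-1 b _ _)); try apply: pe; lia.
    by apply: (use _ _ _ _ _ (@Strand_L a.-1 b _ _ _ _)); try apply: pe; lia.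
  by apply: (use _ _ _ _ _ (@Strand_SW a.-1 b.-1 _ _ _)); try apply: pe; lia.
have [ab|ab] := ltnP (a + b) n.
  have [aa|aa] := eqVneq a 0.
    have [bb|bb] := eqVneq b.+1 n.
      by apply: (use _ _ _ _ _ (@Strand_NE a b _ _ _)); try apply: pe; lia.
    by apply: (use _ _ _ _ _ (@Strand_T a b _ _ _ _)); try apply: pe; lia.
  by apply: (use _ _ _ _ _ (@Strand_NW a.-1 b _ _)); try apply: pe; lia.
have [aa|aa] := eqVneq a n.
  have [bb|bb] := eqVneq b 1.
    by apply: (use _ _ _ _ _ (@Strand_SW a.-1 b.-1 _ _ _)); try apply: pe; lia.
  by apply: (use _ _ _ _ _ (@Strand_B a.-1 b.-1 _ _ _ _)); try apply: pe; lia.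
by apply: (use _ _ _ _ _ (@Strand_SE a b.-1 _ _ _ _)); try apply: pe; lia.
Qed.

Lemma L_curves_uniq : uniq L_curves.
Proof.
apply: allpairs_uniq_dep => [||[u g] [u' g'] _ _ [-> ->]] //.
  by apply: allpairs_uniq => [||[? ?] [? ?] _ _ [-> ->]] //; exact: iota_uniq.
by move=> u _; case: (L_tile _ _ _).
Qed.

Lemma L_starts_uniq : uniq [seq start_of x | x <- L_curves].
Proof.
rewrite map_inj_in_uniq ?L_curves_uniq // => -[[i j] g] [[i' j'] g'] hx hy.
exact: L_strand_start (L_strandP hx) (L_strandP hy).
Qed.

Lemma L_ends_uniq : uniq [seq end_of x | x <- L_curves].
Proof.
rewrite map_inj_in_uniq ?L_curves_uniq // => -[[i j] g] [[i' j'] g'] hx hy.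
exact: L_strand_end (L_strandP hx) (L_strandP hy).
Qed.

(** The strands form closed curves. *)
Lemma L_starts_ends : perm_eq [seq start_of x | x <- L_curves] [seq end_of x | x <- L_curves].
Proof.
rewrite perm_sym; apply: uniq_perm; [exact: L_ends_uniq|exact: L_starts_uniq|].
have sub : {subset [seq end_of x | x <- L_curves] <= [seq start_of x | x <- L_curves]}.
  move=> p /mapP[[[i j] g] /L_strandP/L_strand_next[i' [j' [g' [f' /L_strandV[h <- _]]]]] ->].
  exact: map_f.
by have [] := uniq_min_size L_ends_uniq sub; rewrite ?size_map.
Qed.

Lemma L_curve_label x : x \in L_curves -> strand_label (start_of x) = strand_label (end_of x).
Proof. by case: x => [[i j] g] /L_strandP; exact: strand_label_inv. Qed.

Lemma odd_row_sum k i : \sum_(j < k.*2.+1) (odd (i + j) : nat) = k + odd i.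
Proof.
elim: k => [|k IH]; first by rewrite big_ord_recl big_ord0 /= addn0 addn0.
by rewrite doubleS 2!big_ord_recr /= IH; lia.
Qed.

(** The tiles with i + j odd carry the crossings. *)
Lemma L_crossing_total : 2 * \sum_(i < n) \sum_(j < n) (odd (i + j) : nat) = n ^ 2 - 1.
Proof.
have -> : n = n./2.*2.+1 by lia.
set k := n./2.
under eq_bigr => i _ do rewrite odd_row_sum.
rewrite big_split /= sum_nat_const card_ord.
have := odd_row_sum k 0; rewrite /= addn0 => ->.
by rewrite -muln2 expnS expn1; nia.
Qed.

End StrandsOfL.

(** * L_n as an oriented link *)

Section OrientationOfL.
Local Open Scope classical_set_scope.
Local Open Scope ring_scope.
Variable R : realType.
Local Notation point := 'rV[R]_3.
Local Notation ledge := (nat * (point * point))%type.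
Implicit Types (A B P Q X Y Z p q : point) (t s u v : R) (a b : ledge) (c : corner) (i j : nat) (g : curve).

Lemma oriented_link_is_link (D : seq ledge) (K : set point) :
  (0 < size D)%N -> oriented_link D K -> is_link K.
Proof.
move=> D0 ol; have [v1 v2 v3 v4 v5] := ol.
exists [seq a.2 | a <- D]; split.
- by rewrite size_map; split=> //; apply: (map_uniq (f := fst)); rewrite -map_comp.
- by move=> e /mapP[a ha ->]; exact: v3.
- move=> e P /mapP[a ha ->] Pa.
  have [b [hb _ Pb]] := out_edge ol ha Pa; have [b' [hb' _ Pb']] := prev_edge ol hb.
  have split2 (f : point * point) : f \in [seq a.2 | a <- D] ->
      (P \in [:: f.1; f.2] : nat) = ((f.1 == P) + (f.2 == P))%N.
    move=> /mapP[c hc ->]; rewrite !inE ![P == _]eq_sym.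
    by case: eqP => [e1|]; case: eqP => [e2|] //=; move: (v3 _ hc); rewrite e1 e2 eqxx.
  have cnt E : {subset E <= [seq a.2 | a <- D]} ->
      count (fun f : point * point => P \in [:: f.1; f.2]) E =
      (count_mem P [seq f.1 | f <- E] + count_mem P [seq f.2 | f <- E])%N.
    elim: E => //= f E IH sub; rewrite IH ?split2 ?sub ?mem_head //; last first.
      by move=> f' hf'; apply: sub; rewrite inE hf' orbT.
    by rewrite addnACA.
  rewrite cnt // -!map_comp.
  rewrite -[X in count_mem P X]/[seq a.2.1 | a <- D] -[X in (_ + count_mem P X)%N]/[seq a.2.2 | a <- D].
  rewrite !count_uniq_mem ?(end_uniq ol) //.
  rewrite -{1}Pb (map_f (fun a : ledge => a.2.1) hb) -Pb -Pb'.
  by rewrite (map_f (fun a : ledge => a.2.2) hb').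
- move=> e f P /mapP[a ha ->] /mapP[b hb ->] ab sa sb.
  have ne : a != b by apply: contraNneq ab => ->.
  exact: (seg_meet ol ha hb ne sa sb).
rewrite v5; apply/seteqP; split=> X.
  by move=> [a ha sa]; exists a.2; first exact: map_f.
by move=> [e /mapP[a ha ->] sa]; exists a.
Qed.

Lemma two_halves i j g c c' (T : tile) X : g \in curves T ->
  c \in [:: g.1.1; g.1.2] -> c' \in [:: g.1.1; g.1.2] -> c != c' ->
  segment (corner_pt R i j c) (apex R i j g) X -> segment (corner_pt R i j c') (apex R i j g) X ->
  X = apex R i j g.
Proof.
move=> hg hc hc' cc /segmentP[s hs ->] /segmentP[s' hs' e].
suff -> : s = 1 by rewrite point_at_1.
have ex := congr1 (tile_x 0 j) e; have ey := congr1 (tile_y 0 i) e.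
move: ex ey; rewrite !tile_x_at !tile_y_at !tile_xy_corner !tile_xy_apex !mul0r expr0n /= mul0r subr0 addr0 {e}.
move: hc hc' cc; rewrite !inE => /orP[]/eqP-> /orP[]/eqP->; rewrite ?eqxx // => _;
by case: T hg => //=; rewrite ?inE; try (move=> /orP[]); move=> /eqP-> /= ex ey; lra.
Qed.

Variable n : nat.
Hypothesis n_odd : odd n.
Hypothesis n_ge3 : (3 <= n)%N.

Local Notation Lcs := (L_curves n).
Implicit Types x y : nat * nat * curve.

Definition first_corner x := start_corner n x.1.1 x.1.2 x.2.
Definition last_corner x := end_corner n x.1.1 x.1.2 x.2.
Definition first_pt x : point := corner_pt R x.1.1 x.1.2 (first_corner x).
Definition last_pt x : point := corner_pt R x.1.1 x.1.2 (last_corner x).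
Definition mid_pt x : point := apex R x.1.1 x.1.2 x.2.
Definition curve_label x := strand_label n (start_of n x).
(** Both halves of a strand are edges with the label of the strand. *)
Definition half1 x : ledge := (curve_label x, (first_pt x, mid_pt x)).
Definition half2 x : ledge := (curve_label x, (mid_pt x, last_pt x)).
Definition L_edges : seq ledge := map half1 Lcs ++ map half2 Lcs.

Lemma L_tile_crossing i j : crossing_tile (L_tile n i j) = odd (i + j).
Proof. by rewrite /L_tile; case: ifP => // _; [case: ifP|do 6 ?[case: ifP => ?]]. Qed.

Lemma L_tile_two i j g g' : g \in curves (L_tile n i j) -> g' \in curves (L_tile n i j) ->
  g != g' -> crossing_tile (L_tile n i j).
Proof.
rewrite /L_tile; case: ifP => _; first by case: ifP.
by do 6 ?[case: ifP => ?]; rewrite ?inE // => /eqP-> /eqP->; rewrite eqxx.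
Qed.

Lemma L_curve_mem x : x \in Lcs -> x.2 \in curves (L_tile n x.1.1.+1 x.1.2.+1).
Proof. by case: x => [[i j] g]; rewrite mem_L_curves => /and3P[]. Qed.

Lemma corners_neq x : x \in Lcs -> first_corner x != last_corner x.
Proof.
move=> /L_curve_mem; rewrite /first_corner /last_corner /start_corner /end_corner.
have : forall T g, g \in curves T -> g.1.1 != g.1.2.
  by move=> [] g //=; rewrite ?inE; try (move=> /orP[]); move=> /eqP->.
by move=> h /h; case: ifP => // _; rewrite eq_sym.
Qed.

Lemma corners_mem x : [/\ first_corner x \in [:: x.2.1.1; x.2.1.2], last_corner x \in [:: x.2.1.1; x.2.1.2]
  & forall c, c \in [:: x.2.1.1; x.2.1.2] -> c = first_corner x \/ c = last_corner x].
Proof.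
rewrite /first_corner /last_corner /start_corner /end_corner; case: ifP => _; split; rewrite ?inE ?eqxx ?orbT //;
  move=> c; rewrite !inE => /orP[]/eqP->; by [left|right].
Qed.

(** An edge, the strand of which it is a half, and the corner at which it ends. *)
Variant L_edge_spec : ledge -> nat * nat * curve -> corner -> Prop :=
| L_edge1 x of x \in Lcs : L_edge_spec (half1 x) x (first_corner x)
| L_edge2 x of x \in Lcs : L_edge_spec (half2 x) x (last_corner x).

Lemma L_edgeP a : a \in L_edges -> exists x c, L_edge_spec a x c.
Proof.
rewrite mem_cat => /orP[]/mapP[x hx ->]; [exists x, (first_corner x)|exists x, (last_corner x)]; by constructor.
Qed.

Lemma L_edge_half a x c : L_edge_spec a x c -> [/\ x \in Lcs, a \in L_edges, c \in [:: x.2.1.1; x.2.1.2],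
  seg a = segment (corner_pt R x.1.1 x.1.2 c) (mid_pt x)
  & forall X, (X \in ends a) = (X == corner_pt R x.1.1 x.1.2 c) || (X == mid_pt x)].
Proof.
case=> {}x hx; have [h1 h2 _] := corners_mem x; split=> //.
- by rewrite mem_cat map_f.
- by move=> X; rewrite !inE.
- by rewrite mem_cat map_f ?orbT.
- by rewrite /seg segmentC.
- by move=> X; rewrite !inE orbC.
Qed.

Lemma L_edge_specE a x c : L_edge_spec a x c -> a = if c == first_corner x then half1 x else half2 x.
Proof. by case=> {}x /corners_neq h; rewrite ?eqxx // eq_sym (negPf h). Qed.

Lemma L_curve_lt x : x \in Lcs -> (x.1.1 < n)%N /\ (x.1.2 < n)%N.
Proof. by case: x => [[i j] g]; rewrite mem_L_curves => /and3P[]. Qed.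

(** Some direction of projection that keeps curves inside their tiles, used to separate edges of
    different tiles. *)
Let quarter_lt : 0 < (4^-1 : R) < 2^-1.
Proof. by apply/andP; split; lra. Qed.

Lemma apex_in_tile x : x \in Lcs -> in_tile 4^-1 x.1.1 x.1.2 (mid_pt x).
Proof. by move=> hx; apply: apex_open quarter_lt (L_curve_mem hx). Qed.

Lemma apex_not_corner i j c x : x \in Lcs -> mid_pt x != corner_pt R i j c.
Proof.
move=> hx; apply/eqP => e; apply: (corner_not_in_tile _ (apex_in_tile hx)).
by rewrite e.
Qed.

Lemma over_under_disjoint i j c c' g g' X :
  g.2 -> g'.2 = false -> segment (corner_pt R i j c) (apex R i j g) X ->
  segment (corner_pt R i j c') (apex R i j g') X -> X = corner_pt R i j c.
Proof.
move=> hg hg' /segmentP[s _ ->] /segmentP[s' _] /(congr1 (@cz R)).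
rewrite !point_at_E !corner_ptE !apexE hg hg' /= !mulr0 !add0r mulr1 => ->.
by rewrite point_at_0.
Qed.

(** A common point of two edges is a corner of both tiles or lies inside one tile.  In the second case it
    is the apex of a strand, or else the edges would belong to both strands of a crossing, where the
    over-strand is at height 0 only at the corners. *)
Lemma L_edges_meet a b : a \in L_edges -> b \in L_edges -> meet_at_ends a b.
Proof.
move=> /L_edgeP[x [c ha]] /L_edgeP[y [c' hb]] ab X.
have [hx _ hc -> ea] := L_edge_half ha; have [hy _ hc' -> eb] := L_edge_half hb.
move=> sa sb; rewrite ea eb.
have [e|tx] := curve_in_tile quarter_lt (L_curve_mem hx) sa;
  have [e'|ty] := curve_in_tile quarter_lt (L_curve_mem hy) sb.
- by rewrite {1}e e' !eqxx.
- by case: (corner_not_in_tile _ ty (c := c) (i := x.1.1) (j := x.1.2)); rewrite -e.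
- by case: (corner_not_in_tile _ tx (c := c') (i := y.1.1) (j := y.1.2)); rewrite -e'.
have [exy eyx] := in_tile_inj erefl erefl tx ty.
have := L_curve_mem hx; have := L_curve_mem hy.
case: x y hx hy exy eyx ha hb hc hc' sa sb tx ty {ea eb} => [[i j] g] [[i' j'] g'] hx hy /= ei ej.
subst i' j' => ha hb hc hc' sa sb tx ty hg' hg.
have noc c0 : X <> corner_pt R i j c0.
  by move=> e; apply: (corner_not_in_tile _ tx (c := c0) (i := i) (j := j)); rewrite e.
have [eg|ng] := eqVneq g g'.
  subst g'; have [ec0|cc] := eqVneq c c'; last first.
    have eX : X = mid_pt (i, j, g) := two_halves hg hc hc' cc sa sb.
    by rewrite eX !eqxx !orbT.
  by case/eqP: ab; rewrite (L_edge_specE ha) (L_edge_specE hb) ec0.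
have hT := L_tile_two hg hg' ng.
have [g2|g2] := boolP g.2; have [g2'|g2'] := boolP g'.2.
- by move: ng; have [_ ->] := over_strand hg g2; have [_ ->] := over_strand hg' g2'; rewrite eqxx.
- by case: (noc c); apply: over_under_disjoint g2 (negPf g2') sa sb.
- by case: (noc c'); apply: over_under_disjoint g2' (negPf g2) sb sa.
- by move: ng; rewrite (under_strand hg g2 hT) (under_strand hg' g2' hT) eqxx.
Qed.

Lemma lattice_pt_inj : injective (lattice_pt R).
Proof.
move=> [a b] [a' b'] e; have := congr1 (@cx R) e; have := congr1 (@cy R) e.
rewrite /lattice_pt !coordE /= => /oppr_inj/eqP + /eqP; rewrite !eqr_nat.
by move=> /eqP-> /eqP->.
Qed.

Lemma mid_pt_inj : {in Lcs &, injective mid_pt}.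
Proof.
move=> x y hx hy e.
have tx := apex_in_tile hx; have ty := apex_in_tile hy; rewrite e in tx.
have [exy eyx] := in_tile_inj erefl erefl tx ty.
have := L_curve_mem hx; have := L_curve_mem hy.
case: x y {hx hy tx ty} e exy eyx => [[i j] g] [[i' j'] g'] /= e ei ej; subst i' j' => hg' hg.
have [->//|ng] := eqVneq g g'.
have hT := L_tile_two hg hg' ng.
have := congr1 (@cz R) e; rewrite /mid_pt !apexE /=.
have [g2|g2] := boolP g.2; have [g2'|g2'] := boolP g'.2 => /= h.
- by move: ng; have [_ ->] := over_strand hg g2; have [_ ->] := over_strand hg' g2'; rewrite eqxx.
- by move/eqP: h; rewrite oner_eq0.
- by move/eqP: h; rewrite eq_sym oner_eq0.
- by move: ng; rewrite (under_strand hg g2 hT) (under_strand hg' g2' hT) eqxx.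
Qed.

Lemma L_oriented_link : oriented_link L_edges (L R n).
Proof.
apply: oriented_link_intro.
- rewrite map_cat -!map_comp cat_uniq; apply/and3P; split.
  + rewrite (_ : map _ _ = map (lattice_pt R) [seq start_of n x | x <- Lcs]); last first.
      by rewrite -map_comp; apply: eq_map.
    by rewrite (map_inj_uniq lattice_pt_inj); exact: L_starts_uniq.
  + apply/hasPn => X /mapP[x hx ->]; apply/mapP => -[y hy /= e].
    by move: (apex_not_corner y.1.1 y.1.2 (first_corner y) hx); rewrite e eqxx.
  + by rewrite map_inj_in_uniq ?L_curves_uniq //; exact: mid_pt_inj.
- rewrite !map_cat -!map_comp perm_catC; apply: perm_cat; first exact: perm_refl.
  pose f (v : nat * nat) := (strand_label n v, lattice_pt R v).
  rewrite [X in perm_eq X](_ : _ = map f [seq start_of n x | x <- Lcs]); last first.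
    by rewrite -map_comp; apply: eq_map.
  rewrite [X in perm_eq _ X](_ : _ = map f [seq end_of n x | x <- Lcs]); last first.
    rewrite -map_comp; apply/eq_in_map => x hx /=.
    by rewrite /f /= -(L_curve_label n_odd n_ge3 hx).
  by apply: perm_map; exact: L_starts_ends.
- move=> a; rewrite mem_cat => /orP[]/mapP[x hx ->] /=; last exact: apex_not_corner.
  by rewrite eq_sym; exact: apex_not_corner.
- exact: L_edges_meet.
move=> X; split.
  move=> [i [j [g [hg /draw_curveP[c hc hX]]]]]; rewrite mxE in hg.
  have hx : (i : nat, j : nat, g) \in Lcs by rewrite mem_L_curves !ltn_ord.
  have [_ _ h] := corners_mem (i : nat, j : nat, g).
  have [e|e] := h c hc; rewrite e in hX.
    by exists (half1 (i : nat, j : nat, g)); rewrite // mem_cat map_f.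
  exists (half2 (i : nat, j : nat, g)); first by rewrite mem_cat map_f ?orbT.
  by rewrite /seg segmentC.
move=> [a /L_edgeP[x [c ha]]]; have [hx _ hc -> _] := L_edge_half ha.
have [l1 l2] := L_curve_lt hx.
move=> hX; exists (Ordinal l1), (Ordinal l2), x.2; split; first by rewrite mxE; exact: L_curve_mem.
by apply/draw_curveP; exists c.
Qed.

Lemma L_is_link : is_link (L R n).
Proof.
apply: oriented_link_is_link L_oriented_link; rewrite size_cat size_map.
have : (0, 0, (TR, BL, false))%N \in Lcs.
  by rewrite mem_L_curves; case: n n_ge3 => // m _; rewrite /L_tile.
by case: Lcs.
Qed.

End OrientationOfL.

(** * The linking sum of L_n *)

Section LinkingOfL.
Local Open Scope classical_set_scope.
Local Open Scope ring_scope.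
Variable R : realType.
Local Notation point := 'rV[R]_3.
Local Notation ledge := (nat * (point * point))%type.
Implicit Types (A B P Q X Y Z p q : point) (t s u v : R) (a b : ledge) (c : corner) (i j : nat) (g : curve).
Implicit Types x y : nat * nat * curve.

Lemma orient_local i j t P Q X :
  orient t P Q X = (tile_y t i Q - tile_y t i P) * (tile_x t j X - tile_x t j P)
    - (tile_x t j Q - tile_x t j P) * (tile_y t i X - tile_y t i P).
Proof. by rewrite /orient /tile_x /tile_y; ring. Qed.

Lemma csign_off1 t P Q A B : 0 <= orient t P Q A * orient t P Q B -> csign t (P, Q) (A, B) = 0.
Proof. by rewrite /csign /crosses /= leNgt => /negbTE ->. Qed.

Lemma csign_off2 t P Q A B : 0 <= orient t A B P * orient t A B Q -> csign t (P, Q) (A, B) = 0.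
Proof. by rewrite csignC; exact: csign_off1. Qed.

Lemma csign_on t P Q A B : orient t P Q A * orient t P Q B < 0 ->
  orient t A B P * orient t A B Q < 0 -> csign t (P, Q) (A, B) = Num.sg (vol P Q A B).
Proof. by rewrite /csign /crosses /= => -> ->. Qed.

(** Of the four pairs of halves of the two strands of a crossing one crosses: the raised apex V or U
    is shifted to the lower left.  The sign is computed with both diagonals running downwards. *)
Lemma crossing_sum t i j o : 0 < t < 2^-1 ->
  let P := corner_pt R i j TL in let Q := corner_pt R i j BR in
  let A := corner_pt R i j TR in let B := corner_pt R i j BL in
  let V := apex R i j (TL, BR, o) in let U := apex R i j (TR, BL, ~~ o) in
  csign t (P, V) (A, U) + csign t (P, V) (U, B) + csign t (V, Q) (A, U) + csign t (V, Q) (U, B)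
  = (-1) ^+ ~~ o.
Proof.
move=> /andP[t0 t1] P Q A B V U.
have t2 : 0 < t ^+ 2 by rewrite exprn_gt0.
have t3 : t ^+ 2 < t by nra.
have loc := (orient_local i j, @tile_xy_corner R t i j, @tile_xy_apex R t i j).
case: o @V @U => V U.
- rewrite (csign_off2 (P := P) (Q := V) (A := A) (B := U)); last first.
    by rewrite /P /A /V /U !loc /=; nra.
  rewrite (csign_off2 (P := P) (Q := V) (A := U) (B := B)); last first.
    by rewrite /P /B /V /U !loc /=; nra.
  rewrite (csign_off1 (P := V) (Q := Q) (A := A) (B := U)); last first.
    by rewrite /Q /A /V /U !loc /=; nra.
  rewrite csign_on; last 2 first.
  + by rewrite /Q /B /V /U !loc /=; nra.
  + by rewrite /Q /B /V /U !loc /=; nra.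
  rewrite gtr0_sg ?expr0 ?add0r //.
  by rewrite /vol /det3 /Q /B /V /U !corner_ptE !apexE /=; lra.
- rewrite (csign_off1 (P := P) (Q := V) (A := U) (B := B)); last first.
    by rewrite /P /B /V /U !loc /=; nra.
  rewrite (csign_off2 (P := V) (Q := Q) (A := A) (B := U)); last first.
    by rewrite /Q /A /V /U !loc /=; nra.
  rewrite (csign_off1 (P := V) (Q := Q) (A := U) (B := B)); last first.
    by rewrite /Q /B /V /U !loc /=; nra.
  rewrite csign_on; last 2 first.
  + by rewrite /P /A /V /U !loc /=; nra.
  + by rewrite /P /A /V /U !loc /=; nra.
  rewrite ltr0_sg ?expr1 ?addr0 //.
  by rewrite /vol /det3 /P /A /V /U !corner_ptE !apexE /=; lra.
Qed.

Variable n : nat.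
Hypothesis n_odd : odd n.
Hypothesis n_ge3 : (3 <= n)%N.

Local Notation Lcs := (L_curves n).
Local Notation first_pt := (first_pt R n).
Local Notation last_pt := (last_pt R n).
Local Notation mid_pt := (mid_pt R).
Local Notation half1 := (half1 R n).
Local Notation half2 := (half2 R n).

(** Alternation in terms of the labels: the parity of the row, which decides what strand is above, is
    that of the number of sign changes due to labels and reversals of the strands. *)
Lemma L_signs i j o o' : odd (i + j) -> (i < n)%N -> (j < n)%N ->
  let x := (i, j, (TL, BR, o)) in let y := (i, j, (TR, BL, o')) in
  curve_label n x != curve_label n y /\
  odd (curve_label n x + curve_label n y + flipped n i j x.2 + flipped n i j y.2) = odd i.
Proof.
move=> h hi hj; rewrite /curve_label /start_of /start_corner /flipped /=.
by do 2 case: ifP => ?; rewrite /strand_label /lattice_corner /= ?addn0 ?addn1;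
  do ?[case: ifP => ?]; split; lia.
Qed.

(** Crossing signs of the two halves of a curve in its listed orientation. *)
Definition curve_sum t x f := csign t (corner_pt R x.1.1 x.1.2 x.2.1.1, mid_pt x) f
  + csign t (mid_pt x, corner_pt R x.1.1 x.1.2 x.2.1.2) f.

Lemma half_sum t x f : csign t (first_pt x, mid_pt x) f + csign t (mid_pt x, last_pt x) f =
  (-1) ^+ flipped n x.1.1 x.1.2 x.2 * curve_sum t x f.
Proof.
rewrite /first_pt /last_pt /first_corner /last_corner /start_corner /end_corner /curve_sum; case: ifP => _.
  by rewrite expr1 csignNl [X in _ + X]csignNl; ring.
by rewrite expr0 mul1r.
Qed.

Definition curve_weight t x y := weight t (half1 x) (half1 y) + weight t (half1 x) (half2 y)
  + (weight t (half2 x) (half1 y) + weight t (half2 x) (half2 y)).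

Lemma curve_weightC t x y : curve_weight t x y = curve_weight t y x.
Proof. rewrite /curve_weight (weightC t (half1 x) (half1 y)) (weightC t (half1 x) (half2 y)).
by rewrite (weightC t (half2 x) (half1 y)) (weightC t (half2 x) (half2 y)); ring. Qed.

(** All crossings of L_n contribute with the same sign: the exponents of -1 that come from the labels,
    the orientations and the row cancel by L_signs. *)
Lemma curve_weight_crossing t i j o : 0 < t < 2^-1 -> odd (i + j) -> (i < n)%N -> (j < n)%N ->
  o = ~~ odd i ->
  curve_weight t (i, j, (TL, BR, o)) (i, j, (TR, BL, ~~ o)) = 1.
Proof.
move=> ht h hi hj ho; set x := (i, j, (TL, BR, o)); set y := (i, j, (TR, BL, ~~ o)).
have [ll par] := L_signs o (~~ o) h hi hj; rewrite -/x -/y in ll par.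
rewrite /curve_weight /weight /= (negPf ll) -!mulrDr.
set e1 := (first_pt x, mid_pt x); set e2 := (mid_pt x, last_pt x); set f1 := (first_pt y, mid_pt y); set f2 := (mid_pt y, last_pt y).
(* sum first over the halves of x, then over those of y, restoring the listed orientations *)
have -> : csign t e1 f1 + csign t e1 f2 + (csign t e2 f1 + csign t e2 f2) =
   (csign t e1 f1 + csign t e2 f1) + (csign t e1 f2 + csign t e2 f2) by ring.
rewrite !half_sum -mulrDr.
have -> : curve_sum t x f1 + curve_sum t x f2 =
   (csign t f1 (corner_pt R i j TL, mid_pt x) + csign t f2 (corner_pt R i j TL, mid_pt x))
 + (csign t f1 (mid_pt x, corner_pt R i j BR) + csign t f2 (mid_pt x, corner_pt R i j BR)).
  by rewrite /curve_sum /= ![csign t f1 _]csignC ![csign t f2 _]csignC; ring.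
rewrite !half_sum -mulrDr.
have -> : curve_sum t y (corner_pt R i j TL, mid_pt x) + curve_sum t y (mid_pt x, corner_pt R i j BR) = (-1) ^+ ~~ o.
  rewrite -(crossing_sum i j o ht) /curve_sum /=.
  by rewrite ![csign t (_, mid_pt y) _]csignC ![csign t (mid_pt y, _) _]csignC; ring.
by rewrite -!exprD -signr_odd !addnA oddD /= par ho negbK oddb addbb expr0.
Qed.

Lemma half_interior t a x c s : 0 < t < 2^-1 -> 0 < s < 1 -> L_edge_spec n a x c ->
  in_tile t x.1.1 x.1.2 (point_at a.2.1 a.2.2 s).
Proof.
move=> ht hs ha; have [hx _ _ sa ea] := L_edge_half ha.
have h : seg a (point_at a.2.1 a.2.2 s) by apply/segmentP; exists s => //; lra.
move: (h); rewrite sa => /(curve_in_tile ht (L_curve_mem hx))[e|//].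
have ne : a.2.1 != a.2.2.
  by have [_ _ v3 _ _] := L_oriented_link R n_odd n_ge3; apply: v3; have [] := L_edge_half ha.
have [n1 n2] := between_neq ne hs.
have : point_at a.2.1 a.2.2 s \in ends a by rewrite ea e eqxx.
by rewrite !inE eq_sym (negPf n1) (negPf n2).
Qed.

Lemma weight_far t a b x y c c' : 0 < t < 2^-1 -> L_edge_spec n a x c -> L_edge_spec n b y c' ->
  x.1 != y.1 -> weight t a b = 0.
Proof.
move=> ht ha hb xy; rewrite /weight; case: ifP => // _; rewrite /csign; case: ifP => [|_]; last by rewrite mulr0.
rewrite [a.2]surjective_pairing [b.2]surjective_pairing => /crosses_point[s [u [hs hu ex ey]]].
have [e1 e2] := in_tile_inj ex ey (half_interior ht hs ha) (half_interior ht hu hb).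
by case/eqP: xy; rewrite [x.1]surjective_pairing [y.1]surjective_pairing e1 e2.
Qed.

Lemma curve_weightE t x y : 0 < t < 2^-1 -> x \in Lcs -> y \in Lcs ->
  curve_weight t x y = ((x.1 == y.1) && (x.2 != y.2))%:R.
Proof.
move=> ht hx hy; have [exy|nxy] /= := eqVneq x.1 y.1; last first.
  have [a1 a2] := (L_edge1 R hx, L_edge2 R hx).
  have [b1 b2] := (L_edge1 R hy, L_edge2 R hy).
  rewrite /curve_weight (weight_far ht a1 b1 nxy) (weight_far ht a1 b2 nxy).
  by rewrite (weight_far ht a2 b1 nxy) (weight_far ht a2 b2 nxy) !addr0.
have [e|ng] /= := eqVneq x.2 y.2.
  have -> : x = y by rewrite [x]surjective_pairing [y]surjective_pairing exy e.
  by rewrite /curve_weight /weight /= eqxx !addr0.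
have := L_curve_mem hx; have := L_curve_mem hy; have [hi hj] := L_curve_lt hx.
case: x y {hx hy} exy ng hi hj => [[i j] g] [[i' j'] g'] /= [<- <-] ng hi hj hg' hg.
have hT := L_tile_two hg hg' ng; rewrite L_tile_crossing in hT.
have hT' : odd (i + j) by lia.
move: hg hg' ng; rewrite /L_tile hT /=; case: ifP => oi; rewrite !inE => /orP[]/eqP-> /orP[]/eqP->;
  rewrite ?eqxx // => _.
- by rewrite (curve_weight_crossing ht (o := true)) //; rewrite -[odd i]negbK oi.
- by rewrite curve_weightC (curve_weight_crossing ht (o := true)) // -[odd i]negbK oi.
- by rewrite (curve_weight_crossing ht (o := false)) // oi.
- by rewrite curve_weightC (curve_weight_crossing ht (o := false)) // oi.
Qed.

(** Two curves for each of the (n^2 - 1) / 2 crossing tiles, in both orders. *)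
Lemma curve_pairs : (\sum_(x <- Lcs) \sum_(y <- Lcs) ((x.1 == y.1) && (x.2 != y.2)) = n ^ 2 - 1)%N.
Proof.
rewrite -(L_crossing_total n_odd n_ge3).
set tiles := [seq (i, j) | i <- iota 0 n, j <- iota 0 n].
have ut : uniq tiles.
  by apply: allpairs_uniq => [||[? ?] [? ?] _ _ [-> ->]] //; exact: iota_uniq.
have -> : (\sum_(x <- Lcs) \sum_(y <- Lcs) ((x.1 == y.1) && (x.2 != y.2)) =
  \sum_(v <- tiles) 2 * odd (v.1 + v.2))%N.
  rewrite /L_curves -/tiles big_allpairs_dep /= !big_seq; apply: eq_bigr => v hv.
  transitivity (\sum_(g <- curves (L_tile n v.1.+1 v.2.+1))
     \sum_(g' <- curves (L_tile n v.1.+1 v.2.+1)) (g != g'))%N.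
    apply: eq_bigr => g _; rewrite big_allpairs_dep /= (bigD1_seq v) //=.
    rewrite [X in (_ + X)%N]big1 ?addn0 => [|v' /negPf ne].
      by apply: eq_bigr => g' _; rewrite eqxx.
    by rewrite big1 // => g' _; rewrite eq_sym ne.
  have := L_tile_crossing n v.1.+1 v.2.+1; rewrite addSn addnS /= negbK => <-.
  have := @L_tile_two n v.1.+1 v.2.+1.
  case: (L_tile _ _ _) => two; rewrite ?big_cons ?big_nil //.
  - by have := two (TL, TR, false) (BL, BR, false) isT isT isT.
  - by have := two (TL, BL, false) (TR, BR, false) isT isT isT.
have iE : iota 0 n = index_iota 0 n by rewrite /index_iota subn0.
rewrite /tiles big_allpairs /= iE big_mkord big_distrr /=; apply: eq_bigr => i _.
by rewrite big_mkord big_distrr.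
Qed.

Lemma linking_L : for_small (fun t => linking t (L_edges R n) = (n ^ 2 - 1)%N%:R).
Proof.
have h2 : 0 < 2^-1 :> R by rewrite invr_gt0.
apply: (for_smallW (for_small_lt h2)) => t ht; rewrite -curve_pairs natr_sum.
have E (F : ledge -> R) : \sum_(a <- L_edges R n) F a = \sum_(x <- Lcs) (F (half1 x) + F (half2 x)).
  by rewrite big_cat !big_map big_split.
rewrite /linking E !big_seq; apply: eq_bigr => x hx.
rewrite !E -big_split natr_sum !big_seq; apply: eq_bigr => y hy.
by rewrite -(curve_weightE ht hx hy).
Qed.

End LinkingOfL.

(** * The mosaic number of L_n *)

Section MosaicNumber.
Variables (R : realType) (n : nat).
Hypothesis n_odd : odd n.
Hypothesis n_ge3 : (3 <= n)%N.

Lemma L_representable : representable (L R n) n.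
Proof.
exists (L_mosaic n); split; first exact: L_suitably_connected.
by split; [exact: L_is_link|exact: L_is_link|exact: rst_refl].
Qed.

(** With c crossing tiles, the linking sum n^2 - 1 is at most 2c, while 2c + 4 <= (m + 1)^2. *)
Lemma L_representable_ge m : representable (L R n) m -> (n <= m)%N.
Proof.
move=> [M [sc eqM]].
have hL : has_linking (n ^ 2 - 1)%:R%R (L R n).
  by exists (L_edges R n); [exact: L_oriented_link|exact: linking_L].
have [D ol lk] := link_equiv_linking eqM hL.
have [t [_ [e]]] := for_small_ex (for_smallI lk (linking_bound ol)).
rewrite e normr_nat ler_nat.
have n2 : (n ^ 2 = n * n)%N by rewrite expnS expn1.
have [m0|m0] := posnP m.
  subst m; have /eqP -> : #|[set z : 'I_0 * 'I_0 | crossing_tile (M z.1 z.2)]%SET| == 0%N.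
    by rewrite cards_eq0; apply/eqP/setP => -[[]].
  nia.
have := crossing_count m0 sc.
have m2 : (m.+1 ^ 2 = m.+1 * m.+1)%N by rewrite expnS expn1.
nia.
Qed.

End MosaicNumber.

Theorem theorem6p7 (R : realType) (n : nat) (hodd : odd n) (hn : (3 <= n)%N) :
  corner_mosaic_number (L R n) = n.
Proof.
have rep := L_representable R hodd hn.
apply: xget_unique; first by split=> // m; exact: L_representable_ge.
move=> m [repm minm]; apply/eqP.
by rewrite eqn_leq (minm n rep) (L_representable_ge hodd hn repm).
Qed.
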